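(* Let $d\in\{1,2,3\}$ and let $X_0$ be either $H^s(\mathbb{R}^d)$ for some $s<0$, or $L^p(\mathbb{R}^d)$ for some $1\le p<2$ (spaces of $\mathbb{C}^N$-valued functions or distributions). There exists $\psi_0^{\mathrm{bad}}\in X_0\setminus L^2(\mathbb{R}^d)$ such that for any neighbourhood $\Omega_0$ of $\psi_0^{\mathrm{bad}}$ in $X_0$, there do not exist continuous maps $$I_\mu,J_\mu\colon\Omega_0\longrightarrow\mathcal{D}'(B)\qquad(\mu=0,\dots,d)$$ with the property that if $\psi_0\in\Omega_0\cap C_c^\infty(\mathbb{R}^d)$, then $a_\mu:=I_\mu[\psi_0]$ and $b_\mu:=J_\mu[\psi_0]$ $(\mu=0,\dots,d)$ satisfy the constraint equations $$b_0=\sum_{j=1}^d\partial_ja_j,\qquad \sum_{j=1}^d\partial_j\left(\partial_ja_0-b_j\right)=|\psi_0|^2\qquad\text{in }B.$$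
   Context: $N=2$ for $d=1,2$ and $N=4$ for $d=3$. $H^s(\mathbb{R}^d)$ is the usual (inhomogeneous) $L^2$-based Sobolev space. $B$ is the open unit ball in $\mathbb{R}^d$ centred at the origin, and $\mathcal{D}'(B)$ is the space of distributions on $B$. The constraint equations are understood in $\mathcal{D}'(B)$. $|\psi_0|^2=\psi_0^*\psi_0$. *)

(* Defs.v *)
From HB Require Import structures.
From mathcomp Require Import all_boot all_order all_algebra.
From mathcomp Require Import all_classical all_reals all_analysis.
From mathcomp Require Import complex ring.
Set Implicit Arguments.
Unset Strict Implicit.
Unset Printing Implicit Defensive.
Import Order.TTheory GRing.Theory Num.Theory.
Import numFieldNormedType.Exports.
Local Open Scope classical_set_scope.
Local Open Scope ring_scope.

Definition rV_display : measure_display.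
Proof. exact: default_measure_display. Qed.

Section rV_measurable.
Context {R : realType} (d : nat).

Let coord (i : 'I_d) (x : 'rV[R]_d) : measurableTypeR R := x ord0 i.

Let rV_set0 : g_sigma_preimage coord set0.
Proof. exact: sigma_algebra0. Qed.

Let rV_setC A : g_sigma_preimage coord A -> g_sigma_preimage coord (~` A).
Proof. exact: sigma_algebraC. Qed.

Let rV_bigcup (F : _^nat) : (forall i, g_sigma_preimage coord (F i)) ->
  g_sigma_preimage coord (\bigcup_i (F i)).
Proof. exact: sigma_algebra_bigcup. Qed.

(* The product sigma-algebra, i.e. the Borel sets of R^d. *)
HB.instance Definition _ := @isMeasurable.Build rV_display
  'rV[R]_d (g_sigma_preimage coord) rV_set0 rV_setC rV_bigcup.

Lemma measurable_rV_coord (i : 'I_d) : measurable_fun [set: 'rV[R]_d] (coord i).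
Proof.
move=> _ Y mY; rewrite setTI; apply: sub_sigma_algebra => /=.
rewrite -bigcup_seq/=; exists i => /=; first by rewrite mem_index_enum.
by exists Y => //; rewrite setTI.
Qed.

Lemma measurable_fun_rVP d' (T : measurableType d') (f : T -> 'rV[R]_d) :
  (forall i, measurable_fun [set: T] (coord i \o f)) ->
  measurable_fun [set: T] f.
Proof.
move=> mf _ A mA; rewrite setTI.
suff /(_ A mA) : (measurable : set (set 'rV[R]_d)) `<=`
  [set A | measurable (f @^-1` A)] by [].
apply: smallest_sub.
  split => [|B mB|F mF] /=.
  - by rewrite preimage_set0.
  - by rewrite setTD preimage_setC; exact: measurableC.
  - by rewrite preimage_bigcup; exact: bigcupT_measurable.
rewrite -bigcup_seq => B [i _ [C mC <-]] /=.
by have := mf i measurableT C mC; rewrite !setTI.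
Qed.

End rV_measurable.

Section lebesgue_rV_step.
Context {R : realType} (d : nat).

Definition rV_cons (p : measurableTypeR R * 'rV[R]_d) : 'rV[R]_d.+1 :=
  \row_(i < d.+1) oapp (p.2 ord0) (p.1 : R) (unlift ord0 i).

Let rV_uncons (x : 'rV[R]_d.+1) : measurableTypeR R * 'rV[R]_d :=
  (x ord0 ord0, \row_j x ord0 (lift ord0 j)).

Let rV_consK : cancel rV_cons rV_uncons.
Proof.
case=> x v; rewrite /rV_uncons /rV_cons !mxE unlift_none; congr pair.
by apply/rowP => j; rewrite !mxE liftK.
Qed.

Lemma measurable_rV_cons : measurable_fun setT rV_cons.
Proof.
apply: measurable_fun_rVP => i /=.
rewrite [X in measurable_fun _ X](_ : _ =
  (fun p : measurableTypeR R * 'rV[R]_d =>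
     oapp (p.2 ord0) (p.1 : R) (unlift ord0 i))); last first.
  by apply/funext => p /=; rewrite mxE.
case: unliftP => [j|] _ /=; last exact: measurable_fst.
exact: (measurableT_comp (measurable_rV_coord j) measurable_snd).
Qed.

Let measurable_rV_uncons : measurable_fun setT rV_uncons.
Proof.
apply: measurable_fun_pair; first exact: measurable_rV_coord.
apply: measurable_fun_rVP => j /=.
rewrite [X in measurable_fun _ X](_ : _ =
  (fun x : 'rV[R]_d.+1 => x ord0 (lift ord0 j))).
  exact: measurable_rV_coord.
by apply/funext => x /=; rewrite mxE.
Qed.

Variable mu : {sigma_finite_measure set 'rV[R]_d -> \bar R}.

Definition lebesgue_rV_step : set 'rV[R]_d.+1 -> \bar R :=
  pushforward (@lebesgue_measure R \x mu)%E rV_cons.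

Let step0 : lebesgue_rV_step set0 = 0%E.
Proof. by rewrite /lebesgue_rV_step /pushforward preimage_set0 measure0. Qed.

Let step_ge0 A : (0 <= lebesgue_rV_step A)%E.
Proof. by rewrite /lebesgue_rV_step /pushforward measure_ge0. Qed.

Let step_sigma_additive : semi_sigma_additive lebesgue_rV_step.
Proof.
have mcons := measurable_rV_cons.
exact: (@measure_semi_sigma_additive _ _ _
  (measure_function_pushforward__canonical__measure_function_Measure
     (@lebesgue_measure R \x mu)%E mcons)).
Qed.

HB.instance Definition _ := isMeasure.Build _ _ _ lebesgue_rV_step
  step0 step_ge0 step_sigma_additive.

Let step_sigma_finite : sigma_finite setT lebesgue_rV_step.
Proof.
have /sigma_finiteP[F [FT ndF mF]] := sigma_finiteT (@lebesgue_measure R).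
have /sigma_finiteP[G [GT ndG mG]] := sigma_finiteT mu.
exists (fun n => rV_uncons @^-1` (F n `*` G n)).
  apply/esym; rewrite -subTset => x _.
  have [n _ Fn] : (\bigcup_i F i) (x ord0 ord0) by rewrite -FT.
  have [m _ Gm] : (\bigcup_i G i) (\row_j x ord0 (lift ord0 j)) by rewrite -GT.
  exists (maxn n m) => //; split => /=.
    have /subsetPset := ndF _ _ (leq_maxl n m); exact.
  have /subsetPset := ndG _ _ (leq_maxr n m); exact.
move=> n; have [mFn Fn] := mF n; have [mGn Gn] := mG n; split.
  rewrite -[X in measurable X]setTI; apply: measurable_rV_uncons => //.
  exact: measurableX.
rewrite /lebesgue_rV_step /pushforward -comp_preimage.
have -> : rV_uncons \o rV_cons = id by apply/funext => p; exact: rV_consK.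
by rewrite preimage_id product_measure1E// lte_mul_pinfty// ge0_fin_numE.
Qed.

HB.instance Definition _ := Measure_isSigmaFinite.Build _ _ _ lebesgue_rV_step
  step_sigma_finite.

End lebesgue_rV_step.

Section lebesgue_rV.
Context {R : realType}.

(* d-dimensional Lebesgue measure as an iterated product; lebesgue_rV_step
   transports leb^1 x leb^d along R x R^d ~ R^(d+1). *)
Fixpoint lebesgue_rV d : {sigma_finite_measure set 'rV[R]_d -> \bar R} :=
  match d with
  | 0 => @dirac _ 'rV[R]_0 0 R
  | d'.+1 => lebesgue_rV_step (lebesgue_rV d')
  end.

End lebesgue_rV.

Section smooth.
Context {R : realType} {d : nat}.
Implicit Types (f g : 'rV[R]_d -> R) (F G : 'rV[R]_d -> R[i]) (s : seq 'I_d).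

Definition iter_partial s f : 'rV[R]_d -> R :=
  foldr (fun j g x => 'D_('e_j) g x) f s.

Definition smooth f := forall s, continuous (iter_partial s f) /\
  forall j x, derivable (iter_partial s f) x 'e_j.

(* Functions into R[i] are differentiated componentwise. *)
Definition csmooth F :=
  smooth (fun x => complex.Re (F x)) /\ smooth (fun x => complex.Im (F x)).

Definition iter_cpartial s F (x : 'rV[R]_d) : R[i] :=
  (iter_partial s (fun x => complex.Re (F x)) x
   +i* iter_partial s (fun x => complex.Im (F x)) x)%C.

Definition csupport F : set 'rV[R]_d := closure [set x | F x != 0].

Lemma iter_partial_rcons s j f :
  iter_partial (rcons s j) f = iter_partial s (fun x => 'D_('e_j) f x).
Proof. by rewrite /iter_partial foldr_rcons. Qed.

Lemma smooth_partial j f : smooth f -> smooth (fun x => 'D_('e_j) f x).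
Proof. by move=> sf s; rewrite -iter_partial_rcons; exact: sf. Qed.

Lemma iter_partialD s f g : smooth f -> smooth g ->
  iter_partial s (fun x => f x + g x) =
  (fun x => iter_partial s f x + iter_partial s g x).
Proof.
move=> sf sg; elim: s => //= j s ->; apply/funext => x.
by apply: deriveD; [exact: (sf s).2|exact: (sg s).2].
Qed.

Lemma iter_partialZ s (a : R) f : smooth f ->
  iter_partial s (fun x => a * f x) = (fun x => a * iter_partial s f x).
Proof.
move=> sf; elim: s => //= j s ->; apply/funext => x.
by apply: (@deriveZ _ _ _ (iter_partial s f)); exact: (sf s).2.
Qed.

Lemma smoothD f g : smooth f -> smooth g -> smooth (fun x => f x + g x).
Proof.
move=> sf sg s; rewrite iter_partialD//; split=> [x|j x].
  by apply: continuousD; [exact: (sf s).1|exact: (sg s).1].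
by apply: derivableD; [exact: (sf s).2|exact: (sg s).2].
Qed.

Lemma smoothZ (a : R) f : smooth f -> smooth (fun x => a * f x).
Proof.
move=> sf s; rewrite iter_partialZ//; split=> [x|j x].
  by apply: continuousM; [exact: cst_continuous|exact: (sf s).1].
by apply: (@derivableZ _ _ _ (iter_partial s f)); exact: (sf s).2.
Qed.

Lemma iter_partial0 s : iter_partial s (fun=> 0) = (fun=> 0).
Proof.
by elim: s => //= j s ->; apply/funext => x; exact: (@derive_cst _ _ _ 0).
Qed.

Lemma smooth0 : smooth (fun=> 0).
Proof.
move=> s; rewrite iter_partial0; split => [|j x]; first exact: cst_continuous.
exact: (@derivable_cst _ _ _ 0).
Qed.

Let Re_lin (c z w : R[i]) : complex.Re (c * z + w) =
  complex.Re c * complex.Re z + (- complex.Im c * complex.Im z + complex.Re w).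
Proof. by case: c z w => [a b] [x y] [u v] /=; rewrite addrA mulNr. Qed.

Let Im_lin (c z w : R[i]) : complex.Im (c * z + w) =
  complex.Re c * complex.Im z + (complex.Im c * complex.Re z + complex.Im w).
Proof. by case: c z w => [a b] [x y] [u v] /=; rewrite addrA. Qed.

Lemma csmooth0 : csmooth (fun=> 0).
Proof. by split; exact: smooth0. Qed.

Lemma iter_cpartial0 s : iter_cpartial s (fun=> 0) = (fun=> 0).
Proof. by apply/funext => x; rewrite /iter_cpartial /= iter_partial0. Qed.

Lemma csmooth_lin (c : R[i]) F G : csmooth F -> csmooth G ->
  csmooth (fun x => c * F x + G x).
Proof.
move=> [sF1 sF2] [sG1 sG2]; split.
  under [X in smooth X]eq_fun do rewrite Re_lin.
  exact: (smoothD (smoothZ _ sF1) (smoothD (smoothZ _ sF2) sG1)).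
under [X in smooth X]eq_fun do rewrite Im_lin.
exact: (smoothD (smoothZ _ sF2) (smoothD (smoothZ _ sF1) sG2)).
Qed.

Lemma iter_cpartial_lin s (c : R[i]) F G : csmooth F -> csmooth G ->
  iter_cpartial s (fun x => c * F x + G x) =
  (fun x => c * iter_cpartial s F x + iter_cpartial s G x).
Proof.
move=> [sF1 sF2] [sG1 sG2]; apply/funext => x; rewrite /iter_cpartial.
have -> : (fun x => complex.Re (c * F x + G x)) = (fun x => complex.Re c *
    complex.Re (F x) + (- complex.Im c * complex.Im (F x) + complex.Re (G x))).
  by apply/funext => y; rewrite Re_lin.
have -> : (fun x => complex.Im (c * F x + G x)) = (fun x => complex.Re c *
    complex.Im (F x) + (complex.Im c * complex.Re (F x) + complex.Im (G x))).
  by apply/funext => y; rewrite Im_lin.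
rewrite (iter_partialD _ (smoothZ _ sF1) (smoothD (smoothZ _ sF2) sG1)).
rewrite (iter_partialD _ (smoothZ _ sF2) sG1).
rewrite (iter_partialD _ (smoothZ _ sF2) (smoothD (smoothZ _ sF1) sG2)).
rewrite (iter_partialD _ (smoothZ _ sF1) sG2) !iter_partialZ//.
by case: c => a b /=; apply/eqP; rewrite eq_complex/= mulNr !addrA !eqxx.
Qed.

Definition cpartial (j : 'I_d) F := iter_cpartial [:: j] F.

Lemma csmooth_partial j F : csmooth F -> csmooth (cpartial j F).
Proof. by move=> [sF1 sF2]; split; exact: smooth_partial. Qed.

Lemma iter_cpartial_partial s j F :
  iter_cpartial s (cpartial j F) = iter_cpartial (rcons s j) F.
Proof. by rewrite /iter_cpartial !iter_partial_rcons. Qed.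

Lemma csupport_partial j F : csupport (cpartial j F) `<=` csupport F.
Proof.
rewrite (_ : csupport F = closure (csupport F)); last first.
  by apply/closure_id; exact: closed_closure.
apply: closureS => x /=; apply: contra_neqP => xF.
have F0 : \near x, F x = 0.
  have : (~` closure [set x | F x != 0]) x by [].
  rewrite -interiorC => /filterS; apply => y /=.
  by move/negP; rewrite negbK => /eqP.
rewrite /cpartial /iter_cpartial /=.
rewrite (near_eq_derive (g := cst 0)); last first.
  by near=> y; rewrite (near F0 y).
rewrite (near_eq_derive (f := fun x => complex.Im (F x)) (g := cst 0)); last first.
  by near=> y; rewrite (near F0 y).
by rewrite !derive_cst.
Unshelve. all: by end_near. Qed.

End smooth.

Local Notation cabs := ComplexField.Normc.normc.

Section testfun.
Context {R : realType} {d : nat}.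
Variable U : set 'rV[R]_d.

Definition test_function : {pred 'rV[R]_d -> R[i]} := mem
  [set F | [/\ csmooth F, compact (csupport F) & csupport F `<=` U]].

Lemma test_function_submod_closed : submod_closed test_function.
Proof.
split=> [|c F G].
  rewrite inE/= /csupport (_ : [set x | _] = set0); last first.
    by apply/seteqP; split => x //=; rewrite eqxx.
  by rewrite closure0; split; [exact: csmooth0|exact: compact0|].
rewrite !inE/= => -[sF cF FU] [sG cG GU].
have sub : csupport (c *: F + G) `<=` csupport F `|` csupport G.
  rewrite /csupport -closureU; apply: closureS => x /= nz.
  have [Fx|Fx] := eqVneq (F x) 0; last by left.
  right; apply: contraNneq nz => Gx.
  by rewrite -[X in X == _]/(c * F x + G x) Fx Gx mulr0 addr0.
split.
- exact: csmooth_lin.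
- apply: (subclosed_compact _ (compactU cF cG) sub); exact: closed_closure.
- by move=> x /sub[/FU|/GU].
Qed.

HB.instance Definition _ := GRing.isSubmodClosed.Build _ _ test_function
  test_function_submod_closed.

Record testfun := TestFun {
  testfun_fun :> 'rV[R]_d -> R[i]; _ : testfun_fun \in test_function }.

HB.instance Definition _ := [isSub for testfun_fun].
HB.instance Definition _ := [Choice of testfun by <:].
HB.instance Definition _ := [SubChoice_isSubLmodule of testfun by <:].

Lemma testfun_partial_subproof j (phi : testfun) :
  cpartial j phi \in test_function.
Proof.
case: phi => F /=; rewrite !inE/= => -[sF cF FU]; split.
- exact: csmooth_partial.
- apply: (subclosed_compact _ cF); last exact: csupport_partial.
  exact: closed_closure.
- exact: (subset_trans (@csupport_partial _ _ _ _)).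
Qed.

Definition testfun_partial j (phi : testfun) : testfun :=
  TestFun (testfun_partial_subproof j phi).

Lemma testfun_partial_is_linear j : linear (testfun_partial j).
Proof.
move=> c phi psi; apply/val_inj => /=.
have /set_mem[sF _ _] := valP phi; have /set_mem[sG _ _] := valP psi.
exact: (iter_cpartial_lin [:: j] c sF sG).
Qed.

(* The continuity condition is |T phi| <= c * max_(|alpha| <= m) sup |D^alpha phi|
   for phi supported in K, the maximum being replaced by its upper bounds M. *)
Definition is_distribution : {pred testfun -> R[i]} := mem
  [set T : testfun -> R[i] | scalar T /\
    forall K, compact K -> K `<=` U -> exists (c : R) (m : nat),
      forall (phi : testfun) (M : R), csupport phi `<=` K ->
        (forall s x, (size s <= m)%N -> cabs (iter_cpartial s phi x) <= M) ->
        cabs (T phi) <= c * M].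

Lemma is_distribution_zmod_closed : zmod_closed is_distribution.
Proof.
split=> [|S T].
  rewrite inE/=; split=> [c phi psi|K _ _]; first by rewrite -[LHS]/(0 : R[i]) -[RHS]/(c * 0 + 0) mulr0 addr0.
  exists 0, 0 => phi M _ _; rewrite mul0r -[X in X <= _]/(cabs 0).
  by rewrite ComplexField.Normc.normc0.
rewrite !inE/= => -[lS bS] [lT bT]; split=> [c phi psi|K cK KU].
  rewrite -[LHS]/(S (c *: phi + psi) - T (c *: phi + psi)).
  by rewrite -[RHS]/(c * (S phi - T phi) + (S psi - T psi)) lS lT; ring.
have [c1 [m1 h1]] := bS K cK KU; have [c2 [m2 h2]] := bT K cK KU.
exists (c1 + c2), (maxn m1 m2) => phi M phiK hM.
rewrite -[X in cabs X]/(S phi - T phi) mulrDl (le_trans (le_normcD _ _))// normcN lerD//.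
  by apply: h1 => // s x sm; apply: hM; rewrite (leq_trans sm)// leq_maxl.
by apply: h2 => // s x sm; apply: hM; rewrite (leq_trans sm)// leq_maxr.
Qed.

HB.instance Definition _ := GRing.isZmodClosed.Build _ is_distribution
  is_distribution_zmod_closed.

Record schwartz_distribution := SchwartzDistribution {
  distribution_fun :> testfun -> R[i];
  _ : distribution_fun \in is_distribution }.

HB.instance Definition _ := [isSub for distribution_fun].
HB.instance Definition _ := [Choice of schwartz_distribution by <:].
HB.instance Definition _ :=
  [SubChoice_isSubZmodule of schwartz_distribution by <:].

(* The weak-* topology: pointwise convergence on test functions. *)
HB.instance Definition _ := Topological.copy schwartz_distribution
  (initial_topology
     (distribution_fun : schwartz_distribution -> {ptws testfun -> R[i]^o})).

Lemma distribution_partial_subproof j (T : schwartz_distribution) :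
  (fun phi => - T (testfun_partial j phi)) \in is_distribution.
Proof.
have /set_mem[lT bT] : (T : testfun -> R[i]) \in is_distribution := valP T.
rewrite inE; split=> [c phi psi|K cK KU].
  by rewrite testfun_partial_is_linear lT; ring.
have [c [m h]] := bT K cK KU; exists c, m.+1 => phi M phiK hM.
rewrite normcN; apply: h => [|s x sm].
  exact: (subset_trans (@csupport_partial _ _ _ _)).
have := hM (rcons s j) x.
by rewrite size_rcons -iter_cpartial_partial; exact.
Qed.

Definition distribution_partial j (T : schwartz_distribution) :
    schwartz_distribution :=
  SchwartzDistribution (distribution_partial_subproof j T).

End testfun.

Section schwartz.
Context {R : realType} {d : nat}.

(* `|x| is the sup norm on R^d, equivalent to the Euclidean one. *)
Definition schwartz_function : {pred 'rV[R]_d -> R[i]} := mem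
  [set F | csmooth F /\ forall s k, exists M : R, forall x,
     `|x| ^+ k * cabs (iter_cpartial s F x) <= M].

Lemma schwartz_function_submod_closed : submod_closed schwartz_function.
Proof.
split=> [|c F G].
  rewrite inE; split; first exact: csmooth0.
  move=> s k; exists 0 => x.
  by rewrite (_ : cabs _ = 0) ?mulr0// iter_cpartial0 ComplexField.Normc.normc0.
rewrite !inE => -[sF bF] [sG bG]; split; first exact: csmooth_lin.
move=> s k; have [M1 h1] := bF s k; have [M2 h2] := bG s k.
exists (cabs c * M1 + M2) => x.
rewrite [X in cabs X](_ : _ = c * iter_cpartial s F x + iter_cpartial s G x).
  rewrite (le_trans (ler_wpM2l _ (le_normcD _ _)))// ?exprn_ge0//.
  rewrite ComplexField.Normc.normcM mulrDr mulrCA lerD//.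
  by rewrite ler_wpM2l//; case: (c) => a b; exact: sqrtr_ge0.
by rewrite (iter_cpartial_lin _ _ sF sG).
Qed.

HB.instance Definition _ := GRing.isSubmodClosed.Build _ _ schwartz_function
  schwartz_function_submod_closed.

Record schwartz := Schwartz {
  schwartz_fun :> 'rV[R]_d -> R[i];
  _ : schwartz_fun \in schwartz_function }.

HB.instance Definition _ := [isSub for schwartz_fun].
HB.instance Definition _ := [Choice of schwartz by <:].
HB.instance Definition _ := [SubChoice_isSubLmodule of schwartz by <:].

Definition is_tempered : {pred schwartz -> R[i]} := mem
  [set u : schwartz -> R[i] | scalar u /\ exists (c : R) (m : nat),
     forall (phi : schwartz) (M : R),
       (forall s k x, (size s <= m)%N -> (k <= m)%N ->
          `|x| ^+ k * cabs (iter_cpartial s phi x) <= M) ->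
       cabs (u phi) <= c * M].

Lemma is_tempered_zmod_closed : zmod_closed is_tempered.
Proof.
split=> [|S T].
  rewrite inE/=; split=> [c phi psi|]; first by rewrite -[LHS]/(0 : R[i]) -[RHS]/(c * 0 + 0) mulr0 addr0.
  exists 0, 0 => phi M _; rewrite mul0r -[X in X <= _]/(cabs 0).
  by rewrite ComplexField.Normc.normc0.
rewrite !inE/= => -[lS bS] [lT bT]; split=> [c phi psi|].
  rewrite -[LHS]/(S (c *: phi + psi) - T (c *: phi + psi)).
  by rewrite -[RHS]/(c * (S phi - T phi) + (S psi - T psi)) lS lT; ring.
have [c1 [m1 h1]] := bS; have [c2 [m2 h2]] := bT.
exists (c1 + c2), (maxn m1 m2) => phi M hM.
rewrite -[X in cabs X]/(S phi - T phi) mulrDl (le_trans (le_normcD _ _))// normcN lerD//.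
  apply: h1 => // s k x sm km; apply: hM.
    by rewrite (leq_trans sm)// leq_maxl.
  by rewrite (leq_trans km)// leq_maxl.
apply: h2 => // s k x sm km; apply: hM; first by rewrite (leq_trans sm)// leq_maxr.
by rewrite (leq_trans km)// leq_maxr.
Qed.

HB.instance Definition _ := GRing.isZmodClosed.Build _ is_tempered
  is_tempered_zmod_closed.

Record tempered := Tempered {
  tempered_fun :> schwartz -> R[i]; _ : tempered_fun \in is_tempered }.

HB.instance Definition _ := [isSub for tempered_fun].
HB.instance Definition _ := [Choice of tempered by <:].
HB.instance Definition _ := [SubChoice_isSubZmodule of tempered by <:].

End schwartz.
Arguments schwartz : clear implicits.
Arguments tempered : clear implicits.

Section integration.
Context {R : realType} {d : nat}.
Implicit Types (f g : 'rV[R]_d -> R[i]).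

Definition cmeasurable f :=
  measurable_fun [set: 'rV[R]_d] (fun x => complex.Re (f x)) /\
  measurable_fun [set: 'rV[R]_d] (fun x => complex.Im (f x)).

Definition cintegral f : R[i] :=
  ((\int[lebesgue_rV d]_x complex.Re (f x))
   +i* (\int[lebesgue_rV d]_x complex.Im (f x)))%C.

Definition induces_distribution (U : set 'rV[R]_d) f
    (T : schwartz_distribution U) :=
  forall phi : testfun U, T phi = cintegral (fun x => f x * phi x).

Definition induces_tempered f (u : tempered R d) :=
  forall phi : schwartz R d, u phi = cintegral (fun x => f x * phi x).

Definition dotv (x y : 'rV[R]_d) : R := \sum_(j < d) x ord0 j * y ord0 j.

Definition fourier f (xi : 'rV[R]_d) : R[i] :=
  cintegral (fun x => (cos (dotv x xi) -i* sin (dotv x xi))%C * f x).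

(* The Fourier transform of the tempered distribution u, defined by duality
   from that of Schwartz functions, is the function g.  For each phi, phihat is
   the element of the Schwartz space given by the function fourier phi. *)
Definition has_fourier_transform (u : tempered R d) g :=
  forall phi phihat : schwartz R d, phihat =1 fourier phi ->
    u phihat = cintegral (fun xi => g xi * phi xi).

End integration.

Section data_spaces.
Context {R : realType} {d : nat}.

Definition vnorm N (z : 'I_N -> R[i]) : R :=
  Num.sqrt (\sum_(k < N) cabs (z k) ^+ 2).

(* C^N-valued tempered distributions; elements of L^p(R^d; C^N), 1 <= p, are
   identified with the distributions they induce. *)
Definition vtempered N := 'I_N -> tempered R d.

(* Both norms are +oo outside of the corresponding space.  The representing
   function is unique up to null sets, so that the infimum merely extracts its
   norm. *)
Definition lebesgue_norm N (p : R) (u : vtempered N) : \bar R :=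
  ereal_inf [set y | exists f : 'I_N -> 'rV[R]_d -> R[i],
    [/\ forall k, cmeasurable (f k),
        forall k, induces_tempered (f k) (u k) &
        y = Lnorm (lebesgue_rV d) p%:E (fun x => (vnorm (f ^~ x))%:E)]].

Definition sobolev_norm N (s : R) (u : vtempered N) : \bar R :=
  ereal_inf [set y | exists g : 'I_N -> 'rV[R]_d -> R[i],
    [/\ forall k, cmeasurable (g k),
        forall k, has_fourier_transform (u k) (g k) &
        y = Lnorm (lebesgue_rV d) 2%:E
          (fun xi => ((1 + dotv xi xi) `^ (s / 2) * vnorm (g ^~ xi))%:E)]].

Definition norm_space N (nu : vtempered N -> \bar R) : set (vtempered N) :=
  [set u | (nu u < +oo)%E].

Definition norm_nbhs N (nu : vtempered N -> \bar R) (u : vtempered N) :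
    set_system (vtempered N) :=
  filter_from [set e : R | 0 < e] (fun e => [set v | (nu (v - u)%R < e%:E)%E]).

Definition norm_continuous_on N (nu : vtempered N -> \bar R)
    (Omega : set (vtempered N)) (U : set 'rV[R]_d)
    (F : vtempered N -> schwartz_distribution U) :=
  forall u, Omega u -> F v @[v --> within Omega (norm_nbhs nu u)] --> F u.

(* Not the unit ball of the library norm on 'rV[R]_d, which is the sup norm. *)
Definition unit_ball : set 'rV[R]_d := [set x | dotv x x < 1].

End data_spaces.
Arguments vtempered : clear implicits.
Arguments unit_ball : clear implicits.

Definition spin_dim (d : nat) : nat := if d == 3 then 4 else 2.

(* Main.v *)
(** If smooth data [psi_n] converge to [psi_bad] in [X_0] while
    [int |psi_n|^2 chi] tends to infinity for some test function [chi] of the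
    ball, continuous potentials cannot exist: the second constraint equation,
    tested against [chi], writes [int |psi_n|^2 chi] as a value of a distribution
    depending continuously on [psi_n].

    One datum serves all the spaces [X_0].  In the first coordinate it is the sum
    over [k] of the bumps [sqrt 2 ^ k h (2 ^ k t)], in the other coordinates a
    fixed bump; [psi_n] is a partial sum.  The bumps have disjoint supports and
    the same [L^2] norm, so [||psi_n||_2^2] grows like [n], whereas their [L^p]
    norms decay geometrically for [p < 2].  Their Fourier transforms are bounded
    both by [C sqrt 2 ^ - k] and by [C sqrt 2 ^ k / (1 + |tau|)]; interpolating
    between the two bounds gives geometric decay in [H^s] for every [s < 0]. *)

Require Import Defs.
From HB Require Import structures.
From mathcomp Require Import all_boot all_order all_algebra.
From mathcomp Require Import all_classical all_reals all_analysis.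
From mathcomp Require Import measurable_realfun complex ring lra.
Set Implicit Arguments.
Unset Strict Implicit.
Unset Printing Implicit Defensive.
Import Order.TTheory GRing.Theory Num.Theory.
Import numFieldNormedType.Exports.
Local Open Scope classical_set_scope.
Local Open Scope ring_scope.
Local Notation cabs := ComplexField.Normc.normc.

(** * Smooth compactly supported functions *)

(** The tensor structure reduces every estimate to the first coordinate: for [s < 0] the weight
    [(1 + |xi|^2)^s] is dominated by a negative power of [1 + |tau|], with [tau] the first
    frequency, and the transform of the fixed bump in the other variables is square integrable.
    Interpolation with exponent [theta] bounds the [k]-th transform by a multiple of [sqrt 2 ^ (k (1
    - 2 theta)) (1 + |tau|) ^ (theta - 1)]. Summability over [k] asks for [theta > 1/2],
    integrability of the weighted square for [theta < 1/2 - s]. This window is nonempty because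
    [s < 0], and no Plancherel identity enters. The supports fix the geometry: all partial sums live
    in the cube [(0, 1/2)^d], whose closure lies in the open unit ball for [d <= 3] since [3/4 < 1].
    This leaves room for a single cutoff [chi] in the ball that is bounded below on the cube. *)

Section expinv.
Context {R : realType}.
Implicit Types (p : {poly R}) (t y : R).

(* Closed under differentiation, because [exp (- 1/t)] flattens every polynomial
   in [1/t] at [0]. *)
Definition expinv p t : R :=
  if 0 < t then p.[t^-1] * expR (- t^-1) else 0.

(** The exponential dominates the single term [y ^ n / n!] of its series. *)
Lemma pow_le_fact_expR (n : nat) y : 0 <= y -> y ^+ n <= n`!%:R * expR y.
Proof.
move=> y0; case: n => [|n]; first by rewrite expr0 fact0 mul1r -expR0 ler_expR.
have := expR_ge1Dxn n y0.
rewrite -(@ler_pM2l _ (n.+1)`!%:R) ?ltr0n ?fact_gt0//; apply: le_trans.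
rewrite mulrDr mulr1 mulrCA divff ?pnatr_eq0 -?lt0n ?fact_gt0// mulr1.
by rewrite lerDr ler0n.
Qed.

Lemma horner_expR_bounded p : exists2 C, 0 <= C &
  forall y, 0 <= y -> `|p.[y] * expR (- y)| <= C.
Proof.
exists (\sum_(i < size p) `|p`_i| * i`!%:R).
  by apply: sumr_ge0 => i _; rewrite mulr_ge0.
move=> y y0; rewrite normrM (ger0_norm (expR_ge0 _)) expRN ler_pdivrMr ?expR_gt0//.
rewrite horner_coef mulr_suml (le_trans (ler_norm_sum _ _ _))// ler_sum// => i _.
rewrite normrM -mulrA ler_wpM2l// ger0_norm ?exprn_ge0//.
exact: pow_le_fact_expR.
Qed.

(** Apply the uniform bound to [X^2 p] at [y = 1 / t]: the two extra powers of [1 / t] turn into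
    [t ^ 2]. A quadratic bound is what makes the derivative at [0] vanish. *)
Lemma expinv_sqr_bound p : exists2 C, 0 <= C &
  forall t, `|expinv p t| <= C * t ^+ 2.
Proof.
have [C C0 hC] := horner_expR_bounded ('X^2 * p).
exists C => // t; rewrite /expinv; case: ifPn => t0; last first.
  by rewrite normr0 mulr_ge0// sqr_ge0.
have := hC _ (ltW (_ : 0 < t^-1)); rewrite invr_gt0 => /(_ t0).
rewrite hornerM hornerXn -mulrA normrM (@ger0_norm _ (_ ^+ 2)) ?sqr_ge0//.
by rewrite exprVn mulrC ler_pdivrMr ?exprn_gt0.
Qed.

Lemma expinv_le0 p t : t <= 0 -> expinv p t = 0.
Proof. by rewrite /expinv ltNge => ->. Qed.

Lemma expinv_gt0E p t : 0 < t -> expinv p t = p.[t^-1] * expR (- t^-1).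
Proof. by rewrite /expinv => ->. Qed.

(** With [y = 1 / t], the derivative of [p(y) exp (- y)] in [t] is [y ^ 2 (p(y) - p'(y)) exp (- y)],
    whence the polynomial [X^2 (p - p')]. *)
Lemma is_derive_expinv p t :
  is_derive t 1 (expinv p) (expinv ('X^2 * (p - p^`())) t).
Proof.
have [t0|t0|<-] := ltgtP 0 t.
- have tN0 : t != 0 by rewrite gt_eqF.
  have dV : is_derive t 1 (fun x : R => x^-1) (- t ^- 2 *: 1).
    by apply: (@is_deriveV _ id t 1 1).
  have dp : is_derive t 1 (horner p \o (fun x : R => x^-1)) (p^`().[t^-1] * (- t ^- 2 *: 1)).
    by apply: is_derive1_comp.
  have de : is_derive t 1 (expR \o (fun x : R => - x^-1)) (expR (- t^-1) * - (- t ^- 2 *: 1)).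
    by apply: is_derive1_comp; apply: is_deriveN.
  rewrite expinv_gt0E//.
  apply: (@near_eq_is_derive _ _ _ ((horner p \o (fun x : R => x^-1)) * (expR \o (fun x : R => - x^-1)))).
  + near=> x; rewrite expinv_gt0E//; near: x; exact: lt_nbhsr.
  + apply: is_derive_eq.
    rewrite /= !hornerE /= /GRing.scale /= !mulr1.
    field.
    by [].
- rewrite (expinv_le0 _ (ltW t0)).
  apply: (@near_eq_is_derive _ _ _ (cst (0 : R))).
  + near=> x; rewrite expinv_le0// ltW//; near: x; exact: lt_nbhsl.
(* At the origin the difference quotient is at most [C |h|], by the quadratic bound. *)
- rewrite (expinv_le0 _ (lexx 0)).
  have [C C0 hC] := expinv_sqr_bound p.
  have E0 := expinv_le0 p (lexx 0).
  suff l0 : h^-1 *: (expinv p (h *: (1 : R) + 0) - expinv p 0) @[h --> 0^'] --> (0 : R).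
    by apply: DeriveDef; [exact: cvgP l0|exact: cvg_lim l0].
  apply/cvgrPdist_le => e e0; near=> h.
  have hN0 : h != 0 by near: h; exact: nbhs_dnbhs_neq.
  rewrite sub0r normrN E0 subr0 addr0 /GRing.scale /= mulr1 normrM normfV.
  rewrite ler_pdivrMl ?normr_gt0// (le_trans (hC h))// -real_normK ?num_real//.
  rewrite expr2 mulrCA ler_wpM2l//.
  have /ltW : `|h| < e / (C + 1).
    near: h; apply: dnbhs0_lt; by rewrite divr_gt0// ltr_wpDl.
  rewrite ler_pdivlMr ?ltr_wpDl// mulrC; apply: le_trans.
  by rewrite ler_wpM2r// lerDl.
Unshelve. all: by end_near. Qed.

End expinv.

Section smoothness.
Context {R : realType} {d : nat}.
Implicit Types (F G : 'rV[R]_d -> R) (p : {poly R}).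

Lemma is_derive_line F (x v : 'rV[R]_d) (df : R) :
  is_derive (0 : R) 1 (fun h : R => F (h *: v + x)) df -> is_derive x v F df.
Proof.
move=> [dF DF]; apply: DeriveDef; first exact/derivable1P.
rewrite -DF /derive; set g1 := fun h => h^-1 *: _; set g2 := fun h => h^-1 *: _.
suff -> : g1 = g2 by [].
by rewrite funeqE /g1 /g2 => h /=; rewrite addr0 scale0r add0r [_%:A]mulr1.
Qed.

(** [smooth] quantifies over all words of partial derivatives; a class stable under each of them
    makes the induction on the word go through. *)
Lemma smooth_coinduct (P : ('rV[R]_d -> R) -> Prop) :
  (forall F, P F -> continuous F /\
    forall j, (forall x, derivable F x 'e_j) /\ P (fun x => 'D_('e_j) F x)) ->
  forall F, P F -> smooth F.
Proof.
move=> hP F PF s.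
have {PF}/hP[cF dF] : P (iter_partial s F).
  by elim: s => //= j s /hP[_ /(_ j)[]].
by split => // j x; exact: (dF j).1.
Qed.

Lemma smooth_cst (a : R) : smooth (fun _ : 'rV[R]_d => a).
Proof.
apply: (smooth_coinduct (P := fun F => exists b, F = fun=> b)); last by exists a.
move=> _ [b ->]; split; first exact: cst_continuous.
move=> j; split; first by move=> x; exact: derivable_cst.
by exists 0; apply/funext => x; exact: derive_cst.
Qed.

(* Products of smooth functions are not stable under [D_j], but sums of such
   products are, by the Leibniz rule. *)
Inductive prod_span : ('rV[R]_d -> R) -> Prop :=
| prod_spanM F G of smooth F & smooth G : prod_span (fun x => F x * G x)
| prod_spanD F G of prod_span F & prod_span G : prod_span (fun x => F x + G x).

Lemma smoothM F G : smooth F -> smooth G -> smooth (fun x => F x * G x).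
Proof.
move=> sF sG; apply: (smooth_coinduct (P := prod_span)); last exact: prod_spanM.
move=> {F G sF sG} H PH; elim: PH => {H} [F G sF sG|F G _ [cF dF] _ [cG dG]].
  split=> [x|j]; first exact: (@continuousM _ _ F G x ((sF [::]).1 x) ((sG [::]).1 x)).
  have dF x : derivable F x 'e_j by exact: (sF [::]).2.
  have dG x : derivable G x 'e_j by exact: (sG [::]).2.
  split=> [x|]; first exact: (@derivableM _ _ F G x 'e_j (dF x) (dG x)).
  rewrite (_ : (fun x => _) =
      fun x => F x * 'D_('e_j) G x + 'D_('e_j) F x * G x); last first.
    by apply/funext => x; rewrite (@deriveM _ _ F G x 'e_j (dF x) (dG x)) /GRing.scale/= [G x * _]mulrC.
  exact: (prod_spanD (prod_spanM sF (smooth_partial j sG)) (prod_spanM (smooth_partial j sF) sG)).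
split=> [x|j]; first exact: (@continuousD _ _ _ F G x (cF x) (cG x)).
split=> [x|]; first by apply: derivableD; [exact: (dF j).1|exact: (dG j).1].
rewrite (_ : (fun x => _) = fun x => 'D_('e_j) F x + 'D_('e_j) G x); last first.
  by apply/funext => x; rewrite deriveD//; [exact: (dF j).1|exact: (dG j).1].
by apply: prod_spanD; [exact: (dF j).2|exact: (dG j).2].
Qed.

Lemma smooth_sum I (r : seq I) (F : I -> 'rV[R]_d -> R) :
  (forall i, smooth (F i)) -> smooth (fun x => \sum_(i <- r) F i x).
Proof.
move=> sF; elim: r => [|i r ih].
  rewrite (_ : (fun x => _) = fun=> 0); first exact: smooth_cst.
  by apply/funext => x; rewrite big_nil.
rewrite (_ : (fun x => _) = fun x => F i x + \sum_(j <- r) F j x).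
  exact: smoothD (sF i) ih.
by apply/funext => x; rewrite big_cons.
Qed.

Lemma smooth_prod I (r : seq I) (F : I -> 'rV[R]_d -> R) :
  (forall i, smooth (F i)) -> smooth (fun x => \prod_(i <- r) F i x).
Proof.
move=> sF; elim: r => [|i r ih].
  rewrite (_ : (fun x => _) = fun=> 1); first exact: smooth_cst.
  by apply/funext => x; rewrite big_nil.
rewrite (_ : (fun x => _) = fun x => F i x * \prod_(j <- r) F j x).
  exact: smoothM (sF i) ih.
by apply/funext => x; rewrite big_cons.
Qed.

(** The stable class consists of the functions [c * expinv q (a x_i + b)]: a derivative in direction
    [j] multiplies [c] by [a] or by [0] and replaces [q]. *)
Lemma smooth_expinv p (a b : R) (i : 'I_d) :
  smooth (fun x => expinv p (a * x ord0 i + b)).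
Proof.
apply: (smooth_coinduct
  (P := fun F => exists (c : R) q, F = fun x => c * expinv q (a * x ord0 i + b))).
  move=> _ [c [q ->]].
  have dE j (x : 'rV[R]_d) : is_derive x 'e_j (fun x => c * expinv q (a * x ord0 i + b))
      (c * (a * (j == i)%:R) * expinv ('X^2 * (q - q^`())) (a * x ord0 i + b)).
    apply: (@is_derive_line (fun x => c * expinv q (a * x ord0 i + b)) x 'e_j).
    pose l (h : R) := (a * (j == i)%:R) * h + (a * x ord0 i + b).
    rewrite (_ : (fun h => _) = fun h => c * (expinv q \o l) h); last first.
      apply/funext => h /=; rewrite /l !mxE/= [i == j]eq_sym; congr (c * expinv _ _); ring.
    have dl : is_derive (0 : R) 1 l (a * (j == i)%:R).
      by apply: is_derive_eq; rewrite ?addr0 /GRing.scale /= mulr1.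
    have dq := is_derive_expinv q (l 0).
    have dc := is_derive1_comp dq dl.
    apply: is_derive_eq.
    rewrite /l mulr0 add0r /GRing.scale/=; ring.
  split=> [x|j].
    have cl : {for x, continuous (fun x : 'rV[R]_d => a * x ord0 i + b)}.
      apply: (@continuousD _ _ _ (fun x : 'rV[R]_d => a * x ord0 i) (fun=> b)).
        apply: (@continuousM _ _ (fun=> a) (fun x : 'rV[R]_d => x ord0 i)).
          exact: cst_continuous.
        exact: coord_continuous.
      exact: cst_continuous.
    have cq : {for (a * x ord0 i + b), continuous (expinv q)}.
      apply: differentiable_continuous; apply/derivable1_diffP.
      exact: (@ex_derive _ _ _ _ _ _ _ (is_derive_expinv q _)).
    have cc : {for x, continuous (fun _ : 'rV[R]_d => c)} by exact: cst_continuous.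
    have := continuousM cc (continuous_comp cl cq). exact.
  split=> [x|]; first by have [] := dE j x.
  exists (c * (a * (j == i)%:R)), ('X^2 * (q - q^`())).
  by apply/funext => x; have [] := dE j x.
by exists 1, p; apply/funext => x; rewrite mul1r.
Qed.

End smoothness.

(** * Integration over R^d *)

Section rV_measure.
Context {R : realType}.

Lemma continuous_measurable_rV d (F : 'rV[R]_d -> R) :
  continuous F -> measurable_fun [set: 'rV[R]_d] F.
Proof.
move=> cF.
pose q (n : nat) (v : {ffun 'I_d -> int}) : 'rV[R]_d := \row_i ((v i)%:~R / n.+1%:R).
pose fl (n : nat) (x : 'rV[R]_d) : {ffun 'I_d -> int} :=
  [ffun i => Num.floor (n.+1%:R * x ord0 i)].
(* [F] is the limit of [F] evaluated at the points rounded to the lattice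
   [(Z / (n + 1))^d], which take countably many values. *)
apply: (@measurable_fun_cvg _ _ _ _ (fun n x => F (q n (fl n x)))).
  move=> n _ B _; rewrite setTI.
  rewrite [X in measurable X](_ : _ = \bigcup_(v in [set v | B (F (q n v))])
      \bigcap_(i in [set: 'I_d]) [set x : 'rV[R]_d | Num.floor (n.+1%:R * x ord0 i) = v i]).
    rewrite bigcup_mkcond; apply: countable_bigcupT_measurable.
      exact: countableP.
    move=> v; case: ifPn => // _; apply: fin_bigcap_measurable => // i _.
    rewrite (_ : [set x | _] = (fun x : 'rV[R]_d => (x ord0 i : measurableTypeR R)) @^-1`
       `[(v i)%:~R / n.+1%:R, (v i + 1)%:~R / n.+1%:R[%classic).
      rewrite -[X in measurable X]setTI; apply: measurable_rV_coord => //.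
    apply/seteqP; split => x /=; rewrite in_itv/= ler_pdivrMr// ltr_pdivlMr// [_ * n.+1%:R]mulrC.
      by move=> <-; exact: floor_itv.
    exact: floor_def.
  apply/seteqP; split => x /=.
    by move=> Bx; exists (fl n x) => //= i _; rewrite ffunE.
  move=> [v /= Bv xv]; suff -> : fl n x = v by [].
  by apply/ffunP => i; rewrite ffunE xv.
move=> x _; apply: continuous_cvg; first exact: cF.
apply/cvg_ballP => e e0; near=> n; split => // i j.
rewrite (_ : i = ord0); last by apply/val_inj; rewrite (ord1 i).
rewrite /ball/= mxE ffunE ltr_norml.
have := floor_itv (n.+1%:R * x ord0 j).
set z : R := (Num.floor _)%:~R => /andP[z1].
rewrite intrD -/z => z2.
have n1 : 0 < n.+1%:R :> R by [].
have ne : n.+1%:R^-1 < e by near: n; exact: near_infty_natSinv_lt (PosNum e0).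
have zx : z / n.+1%:R <= x ord0 j by rewrite ler_pdivrMr// mulrC.
have xz : x ord0 j < (z + 1) / n.+1%:R by rewrite ltr_pdivlMr// mulrC.
move: xz; rewrite mulrDl mul1r => xz.
move: zx xz ne; move: (x ord0 j) (z / n.+1%:R) (n.+1%:R^-1) => u w v zx xz ne.
by apply/andP; split; lra.
Unshelve. all: by end_near. Qed.


Definition rV_head d (x : 'rV[R]_d.+1) : R := x ord0 ord0.
Definition rV_tail d (x : 'rV[R]_d.+1) : 'rV[R]_d := \row_j x ord0 (lift ord0 j).

Lemma rV_head_cons d t (y : 'rV[R]_d) : rV_head (rV_cons (t, y)) = t.
Proof. by rewrite /rV_head mxE unlift_none. Qed.

Lemma rV_tail_cons d t (y : 'rV[R]_d) : rV_tail (rV_cons (t, y)) = y.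
Proof. by apply/rowP => j; rewrite !mxE liftK. Qed.

Lemma measurable_rV_head d :
  measurable_fun [set: 'rV[R]_d.+1] (@rV_head d : _ -> measurableTypeR R).
Proof. exact: measurable_rV_coord. Qed.

Lemma measurable_rV_tail d : measurable_fun [set: 'rV[R]_d.+1] (@rV_tail d).
Proof.
apply: measurable_fun_rVP => j /=.
rewrite (_ : _ \o _ = fun x : 'rV[R]_d.+1 => x ord0 (lift ord0 j)).
  exact: measurable_rV_coord.
by apply/funext => x /=; rewrite mxE.
Qed.

Lemma dotv_recl d (x y : 'rV[R]_d.+1) :
  dotv x y = rV_head x * rV_head y + dotv (rV_tail x) (rV_tail y).
Proof.
rewrite /dotv big_ord_recl; congr (_ + _); apply: eq_bigr => j _.
by rewrite !mxE.
Qed.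

(** Mirrors the recursion of [lebesgue_rV], which splits off the first coordinate; Fubini then
    factorises the integrals of such products. *)
Definition tensor d (g : R -> R) (k : 'rV[R]_d -> R) (x : 'rV[R]_d.+1) : R :=
  g (rV_head x) * k (rV_tail x).

Lemma measurable_tensor d (g : R -> R) (k : 'rV[R]_d -> R) :
  measurable_fun [set: measurableTypeR R] (g : measurableTypeR R -> measurableTypeR R) -> measurable_fun setT k ->
  measurable_fun setT (tensor g k).
Proof.
move=> mg mk; apply: measurable_funM.
  exact: (measurableT_comp mg (@measurable_rV_head d)).
exact: (measurableT_comp mk (@measurable_rV_tail d)).
Qed.

Local Notation leb := (@lebesgue_measure R).
Local Open Scope ereal_scope.

Lemma ge0_integral_tensor d (g : R -> R) (k : 'rV[R]_d -> R) :
  measurable_fun setT g -> measurable_fun setT k ->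
  (forall t, 0 <= g t)%R -> (forall y, 0 <= k y)%R ->
  \int[lebesgue_rV d.+1]_x (tensor g k x)%:E =
  (\int[leb]_t (g t)%:E) * (\int[lebesgue_rV d]_y (k y)%:E).
Proof.
move=> mg mk g0 k0.
(* [lebesgue_rV d.+1] unfolds to this image measure, which moves the integral to [R x R^d] for
   Tonelli. *)
transitivity (\int[pushforward (leb \x lebesgue_rV d) (@rV_cons R d)]_x (tensor g k x)%:E).
  by [].
rewrite ge0_integral_pushforward//=; last 3 first.
- exact: measurable_rV_cons.
- by apply/measurable_EFinP; exact: measurable_tensor.
- by move=> x _; rewrite lee_fin mulr_ge0.
rewrite preimage_setT fubini_tonelli1/=; last 2 first.
- apply/measurable_EFinP.
  exact: (measurableT_comp (measurable_tensor mg mk) (@measurable_rV_cons R d)).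
- by move=> x; rewrite lee_fin mulr_ge0.
rewrite /fubini_F /=.
transitivity (\int[leb]_t ((g t)%:E * \int[lebesgue_rV d]_y (k y)%:E)).
  apply: eq_integral => t _; rewrite -ge0_integralZl ?lee_fin//; last 2 first.
  - exact/measurable_EFinP.
  - by move=> y _; rewrite lee_fin.
  by apply: eq_integral => y _; rewrite /tensor rV_head_cons rV_tail_cons EFinM.
rewrite ge0_integralZr//.
- exact/measurable_EFinP.
- by move=> y _; rewrite lee_fin.
- by apply: integral_ge0 => y _; rewrite lee_fin.
Qed.

Lemma integrable_tensor d (g : R -> R) (k : 'rV[R]_d -> R) :
  leb.-integrable setT (EFin \o g) -> (lebesgue_rV d).-integrable setT (EFin \o k) ->
  (lebesgue_rV d.+1).-integrable setT (EFin \o tensor g k).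
Proof.
move=> /integrableP[mg ig] /integrableP[mk ik].
have mg' : measurable_fun setT g by exact/measurable_EFinP.
have mk' : measurable_fun setT k by exact/measurable_EFinP.
apply/integrableP; split; first by apply/measurable_EFinP; exact: measurable_tensor.
rewrite (_ : (\int[_]_x _) =
  \int[lebesgue_rV d.+1]_x (tensor (fun t => `|g t|)%R (fun y => `|k y|)%R x)%:E); last first.
  by apply: eq_integral => x _; rewrite /tensor /= normrM.
rewrite ge0_integral_tensor//; last 2 first.
- exact: measurableT_comp.
- exact: measurableT_comp.
by rewrite lte_mul_pinfty//; [exact: integral_ge0|rewrite ge0_fin_numE//; exact: integral_ge0].
Qed.

Lemma Rintegral_tensor d (g : R -> R) (k : 'rV[R]_d -> R) :
  leb.-integrable setT (EFin \o g) -> (lebesgue_rV d).-integrable setT (EFin \o k) ->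
  (\int[lebesgue_rV d.+1]_x tensor g k x = (\int[leb]_t g t) * (\int[lebesgue_rV d]_y k y))%R.
Proof.
move=> ig ik; have it := integrable_tensor ig ik.
have mt := measurable_int _ it.
have itc : (leb \x lebesgue_rV d).-integrable setT ((EFin \o tensor g k) \o @rV_cons R d).
  apply/integrableP; split; first exact: (measurableT_comp mt (@measurable_rV_cons R d)).
  case/integrableP: it => _; apply: le_lt_trans.
  rewrite [leRHS](_ : _ = \int[pushforward (leb \x lebesgue_rV d) (@rV_cons R d)]_x `|(tensor g k x)%:E|)//.
  rewrite ge0_integral_pushforward//=; first exact: measurable_rV_cons.
  by apply/measurable_EFinP; apply: measurableT_comp => //; exact/measurable_EFinP.
rewrite /Rintegral.
transitivity (fine (\int[pushforward (leb \x lebesgue_rV d) (@rV_cons R d)]_x (tensor g k x)%:E)).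
  by [].
rewrite integral_pushforward//=; last exact: measurable_rV_cons.
rewrite preimage_setT -integral12_prod_meas1//=.
transitivity (fine (\int[leb]_t ((g t)%:E * \int[lebesgue_rV d]_y (k y)%:E))).
  congr fine; apply: eq_integral => t _; rewrite -integralZl//.
  by apply: eq_integral => y _; rewrite /tensor rV_head_cons rV_tail_cons EFinM.
rewrite -[\int[lebesgue_rV d]_x _]fineK; last exact: integrable_fin_num.
rewrite integralZr// fineM//.
exact: integrable_fin_num.
Qed.

End rV_measure.

(** * Integrable real functions and exchange of integrals *)

Section integrals.
Context d (T : measurableType d) (R : realType) (mu : {measure set T -> \bar R}).

Implicit Types f g h : T -> R.

Definition L1 f := mu.-integrable [set: T] (EFin \o f).

Lemma L1_measurable f : L1 f -> measurable_fun setT f.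
Proof. by move=> /measurable_int/measurable_EFinP. Qed.

Lemma L1_le f g : measurable_fun setT f -> (forall x, `|f x| <= `|g x|) ->
  L1 g -> L1 f.
Proof.
move=> mf fg; apply: le_integrable => //; first exact/measurable_EFinP.
by move=> x _; rewrite /= lee_fin.
Qed.

Lemma L1_norm f : L1 f -> L1 (fun x => `|f x|).
Proof. by move=> /integrable_norm. Qed.

Lemma L1Z a f : L1 f -> L1 (fun x => a * f x).
Proof.
move=> If; apply: (@L1_le _ (fun x => `|a| * `|f x|)).
- by apply: measurable_funM => //; exact: L1_measurable.
- by move=> x; rewrite normrM [X in _ <= X]ger0_norm// mulr_ge0.
- exact: (integrableZl measurableT (`|a|) (L1_norm If)).
Qed.

Lemma L1D f g : L1 f -> L1 g -> L1 (fun x => f x + g x).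
Proof. by move=> If Ig; exact: (integrableD measurableT If Ig). Qed.

Lemma L1B f g : L1 f -> L1 g -> L1 (fun x => f x - g x).
Proof. by move=> If Ig; exact: (integrableB measurableT If Ig). Qed.

Lemma L1_mul_bounded f h M : L1 f -> measurable_fun setT h ->
  (forall x, `|h x| <= M) -> L1 (fun x => f x * h x).
Proof.
move=> If mh hM; apply: (@L1_le _ (fun x => M * f x)); last exact: L1Z.
  by apply: measurable_funM => //; exact: L1_measurable.
move=> x; rewrite !normrM mulrC ler_wpM2r// (le_trans (hM x))//; exact: ler_norm.
Qed.

Lemma L1_nonneg_lty f : measurable_fun setT f -> (forall x, 0 <= f x) ->
  (\int[mu]_x (f x)%:E < +oo)%E -> L1 f.
Proof.
move=> mf f0 fo; apply/integrableP; split; first exact/measurable_EFinP.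
by under eq_integral do rewrite /= ger0_norm//.
Qed.

Lemma Rintegral_mul_bounded_le f h M : L1 f -> measurable_fun setT h ->
  (forall x, `|h x| <= M) ->
  `|\int[mu]_x (f x * h x)| <= M * \int[mu]_x `|f x|.
Proof.
move=> If mh hM; have Ifh := L1_mul_bounded If mh hM.
rewrite (le_trans (le_normr_Rintegral measurableT Ifh))//.
rewrite -RintegralZl//; last exact: L1_norm.
apply: le_Rintegral => //; first exact: L1_norm.
  by apply: L1Z; exact: L1_norm.
by move=> x _; rewrite normrM mulrC ler_wpM2r.
Qed.

Lemma EFin_Rintegral f : L1 f -> (\int[mu]_x f x)%:E = (\int[mu]_x (f x)%:E)%E.
Proof. by move=> If; rewrite /Rintegral fineK//; exact: integrable_fin_num. Qed.

End integrals.

Section param.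
Context d1 d2 (T1 : measurableType d1) (T2 : measurableType d2) (R : realType).
Variable m1 : {sigma_finite_measure set T1 -> \bar R}.
Variable m2 : {sigma_finite_measure set T2 -> \bar R}.

(** A real integral is [fine] of the difference of the integrals of the positive and negative parts,
    each measurable in the parameter by Tonelli. *)
Lemma measurable_Rintegral_param (f : T1 * T2 -> R) : measurable_fun setT f ->
  measurable_fun setT (fun x => \int[m2]_y f (x, y)).
Proof.
move=> mf.
rewrite (_ : (fun x => _) = fine \o (fun x => (fubini_F m2 (EFin \o f)^\+ x - fubini_F m2 (EFin \o f)^\- x)%E)).
  apply: measurableT_comp => //; apply: emeasurable_funB.
    apply: measurable_fun_fubini_tonelli_F => //.
    by apply: measurable_funepos; exact/measurable_EFinP.
  apply: measurable_fun_fubini_tonelli_F => //.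
  by apply: measurable_funeneg; exact/measurable_EFinP.
apply/funext => x; rewrite /Rintegral integralE /fubini_F /=.
by congr (fine (_ - _)%E); apply: eq_integral => y _; rewrite ?funeposE ?funenegE.
Qed.

(** Fubini, the integrand being dominated by [|g x| |a y|]. With cosine and sine kernels it moves a
    Fourier integral from one factor to the other. *)
Lemma Rintegral_kernel_exchange (g : T1 -> R) (a : T2 -> R) (k : T1 * T2 -> R) :
  L1 m1 g -> L1 m2 a -> measurable_fun setT k -> (forall z, `|k z| <= 1) ->
  \int[m1]_x (g x * \int[m2]_y (a y * k (x, y))) =
  \int[m2]_y (a y * \int[m1]_x (g x * k (x, y))).
Proof.
move=> Ig Ia mk k1.
have mg := L1_measurable Ig; have ma := L1_measurable Ia.
have mkx x : measurable_fun setT (fun y => k (x, y)) by exact: measurableT_comp.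
have mky y : measurable_fun setT (fun x => k (x, y)) by exact: measurableT_comp.
have Iak x : L1 m2 (fun y => a y * k (x, y)) by exact: (L1_mul_bounded Ia _ (fun y => k1 _)).
have Igk y : L1 m1 (fun x => g x * k (x, y)) by exact: (L1_mul_bounded Ig _ (fun y => k1 _)).
pose f (z : T1 * T2) := g z.1 * (a z.2 * k z).
have mf : measurable_fun setT f.
  apply: measurable_funM; first exact: measurableT_comp.
  by apply: measurable_funM => //; exact: measurableT_comp.
have If : (m1 \x m2)%E.-integrable setT (EFin \o f).
  apply/integrable12ltyP; first exact/measurable_EFinP.
  apply: (@le_lt_trans _ _ (\int[m1]_x ((\int[m2]_y `|a y|) * `|g x|)%:E)%E).
    apply: ge0_le_integral => //=.
    + by move=> x _; exact: integral_ge0.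
    + apply: (measurable_fun_fubini_tonelli_F (fun z => `|(f z)%:E|)%E) => //.
      by apply: measurableT_comp => //; exact/measurable_EFinP.
    + apply/measurable_EFinP; apply: measurable_funM => //.
      exact: measurableT_comp.
    move=> x _; rewrite mulrC EFinM EFin_Rintegral; last exact: L1_norm.
    rewrite -ge0_integralZl//; last first.
      by apply/measurable_EFinP; exact: measurableT_comp.
    apply: ge0_le_integral => //=.
    + apply/measurable_EFinP; apply: measurableT_comp => //.
      apply: (@measurable_funM _ _ _ _ (fun=> g x) (fun y => a y * k (x, y))) => //.
      exact: measurable_funM.
    + rewrite (_ : (fun y => _) = EFin \o (fun y => `|g x| * `|a y|)%R)//.
      apply/measurable_EFinP; apply: measurable_funM => //; exact: measurableT_comp.
    + move=> y _; rewrite lee_fin /f/= !normrM ler_wpM2l// -[leRHS]mulr1.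
      by rewrite ler_wpM2l.
  have := L1Z (\int[m2]_y `|a y|) (L1_norm Ig).
  move/integrableP => [_]; apply: le_lt_trans.
  rewrite le_eqVlt; apply/orP; left; apply/eqP; apply: eq_integral => x _.
  by rewrite /= [in RHS]ger0_norm// mulr_ge0//; apply: Rintegral_ge0.
rewrite /Rintegral.
transitivity (fine (\int[m1]_x \int[m2]_y (EFin \o f) (x, y))%E).
  congr fine; apply: eq_integral => x _.
  rewrite EFinM EFin_Rintegral// -integralZl//; exact: Iak.
rewrite (Fubini If); congr fine; apply: eq_integral => y _.
rewrite EFinM EFin_Rintegral// -integralZl//; last exact: Igk.
by apply: eq_integral => x _; rewrite -EFinM /f /= mulrCA.
Qed.

End param.

(** * Integrable weights *)

Section weight.
Context {R : realType}.
Local Notation leb := (@lebesgue_measure R).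

Definition weight (a t : R) : R := (1 + `|t|) `^ (- a).

Lemma weight_gt0 a t : 0 < weight a t.
Proof. by rewrite powR_gt0// ltr_pwDl. Qed.

Lemma measurable_weight a : measurable_fun setT (weight a).
Proof.
apply: (@measurableT_comp _ _ _ _ _ _ (fun x : R => x `^ (- a)) _ (fun t : R => 1 + `|t|)).
  exact: measurable_powR.
by apply: measurable_funD => //; exact: measurableT_comp.
Qed.

Lemma continuous_powR_pos (a : R) (t : R) : 0 < t -> {for t, continuous (fun x : R => x `^ a)}.
Proof.
move=> t0; apply: differentiable_continuous; apply/derivable1_diffP.
exact: (@ex_derive _ _ _ _ _ _ _ (is_derive1_powR a t0)).
Qed.

Lemma continuous_weight a : continuous (weight a).
Proof.
move=> t; rewrite /weight.
have c1 : {for t, continuous (fun t : R => 1 + `|t|)}.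
  by apply: cvgD; [exact: cvg_cst|apply: cvg_norm; exact: cvg_id].
have c2 : {for 1 + `|t|, continuous (fun x : R => x `^ (- a))}.
  by apply: continuous_powR_pos; rewrite ltr_pwDl.
exact: (continuous_comp c1 c2).
Qed.

Lemma powRN_cvg0 (a : R) : 0 < a -> x `^ (- a) @[x --> +oo] --> (0 : R).
Proof.
move=> a0; apply/cvgrPdist_le => e e0.
near=> x.
have x0 : 0 < x by near: x; exact: nbhs_pinfty_gt.
rewrite sub0r normrN ger0_norm ?powR_ge0// powRN invf_ple ?posrE ?powR_gt0//.
have : (e^-1) `^ (a^-1) <= x by near: x; apply: nbhs_pinfty_ge; rewrite num_real.
move=> /(ge0_ler_powR (ltW a0)); rewrite !nnegrE => /(_ (powR_ge0 _ _) (ltW x0)).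
by rewrite -powRrM mulVf ?gt_eqF// powRr1// invr_ge0 ltW.
Unshelve. all: by end_near. Qed.

Lemma L1_weight a : 1 < a -> L1 leb (weight a).
Proof.
move=> a1; have b0 : 0 < a - 1 by rewrite subr_gt0.
apply: L1_nonneg_lty; first exact: measurable_weight.
  by move=> x; exact/ltW/weight_gt0.
rewrite ge0_symfun_integralT; first last.
- by move=> x /=; rewrite /weight normrN.
- exact: continuous_weight.
- by move=> x; exact/ltW/weight_gt0.
rewrite lte_mul_pinfty//.
rewrite (_ : [set x | 0 <= x] = `[0, +oo[%classic); last first.
  by apply/seteqP; split => x /=; rewrite in_itv/= andbT.
(* An antiderivative of the weight on the half-line; it tends to [0] at infinity because [a > 1]. *)
pose F (t : R) := - (a - 1)^-1 * (1 + t) `^ (- (a - 1)).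
have dF (t : R) : 0 <= t -> is_derive t 1 F (weight a t).
  move=> t0; have t1 : 0 < 1 + t by rewrite ltr_pwDl.
  have d1 : is_derive t 1 (fun t : R => 1 + t) 1.
    by have := @is_deriveD _ _ _ (cst (1 : R)) id t 1 _ _ (is_derive_cst _ _ _) (is_derive_id _ _); rewrite add0r.
  have d2 := is_derive1_comp (is_derive1_powR (- (a - 1)) t1) d1.
  have -> : weight a t = - (a - 1)^-1 *: (- (a - 1) * (1 + t) `^ (- (a - 1) - 1) * 1).
    rewrite /weight ger0_norm// (_ : - (a - 1) - 1 = - a); last by ring.
    rewrite /GRing.scale/= mulr1 mulrA mulrNN mulVf ?mul1r// gt_eqF//.
  exact: is_deriveZ.
rewrite (@ge0_continuous_FTC2y _ _ F _ 0).
- by rewrite ltry.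
- by move=> x _; exact/ltW/weight_gt0.
- by apply: continuous_subspaceT; exact: continuous_weight.
- rewrite -[X in _ --> X](mulr0 (- (a - 1)^-1)); apply: cvgM; first exact: cvg_cst.
  apply: (cvg_comp (fun t : R => 1 + t) (fun x : R => x `^ (- (a - 1)))); last exact: powRN_cvg0.
  exact: cvg_addrl.
- by move=> x x0; have [] := dF x (ltW x0).
- apply: cvg_at_right_filter; apply: differentiable_continuous; apply/derivable1_diffP.
  by have [] := dF 0 (lexx _).
- move=> x; rewrite in_itv/= andbT => /ltW x0; rewrite derive1E.
  by have [] := dF x x0.
Qed.

(** The product of the [(1 + |x_j|) ^ -2], an integrable comparison function for Schwartz functions
    whose integral factorises. *)
Fixpoint rV_weight d : 'rV[R]_d -> R :=
  match d with 0 => fun=> 1 | d'.+1 => tensor (weight 2) (@rV_weight d') end.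

End weight.

(** * Tempered distributions given by integrable functions *)

Section schwartz_bounds.
Context {R : realType}.
Local Notation leb := (@lebesgue_measure R).

Lemma rV_weight_gt0 d (x : 'rV[R]_d) : 0 < rV_weight x.
Proof. by elim: d x => //= d ih x; rewrite mulr_gt0// weight_gt0. Qed.

Lemma L1_rV0 (c : R) : L1 (lebesgue_rV 0) (fun=> c).
Proof.
apply/integrableP; split; first exact: measurable_cst.
rewrite [ltLHS](_ : _ = \int[lebesgue_rV 0]_x cst (`|c|%:E)%E x)%E//.
by rewrite integral_cst//= [X in (_ * X)%E]diracE in_setT mule1 ltry.
Qed.

Lemma Rintegral_rV0 (c : R) : \int[lebesgue_rV 0]_x c = c.
Proof.
rewrite /Rintegral [X in fine X](_ : _ = \int[lebesgue_rV 0]_x cst (c%:E)%E x)%E//.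
by rewrite integral_cst// [X in (_ * X)%E]diracE in_setT mule1.
Qed.

Lemma L1_rV_weight d : L1 (lebesgue_rV d) (@rV_weight R d).
Proof.
elim: d => [|d ih]; first exact: L1_rV0.
by apply: integrable_tensor => //; apply: L1_weight; rewrite ltr1n.
Qed.

Lemma coord_le_norm d (x : 'rV[R]_d) i : `|x ord0 i| <= `|x|.
Proof.
rewrite [leRHS]mx_normrE.
exact: (le_bigmax _ (fun ij : 'I_1 * 'I_d => `|x ij.1 ij.2|) (ord0, i)).
Qed.

Lemma norm_rV_tail d (x : 'rV[R]_d.+1) : `|rV_tail x| <= `|x|.
Proof.
rewrite [leLHS]mx_normrE; apply: bigmax_le => // -[i j] _ /=.
by rewrite mxE coord_le_norm.
Qed.

(** Each factor [(1 + |x_j|) ^ 2] is at most [(1 + |x|) ^ 2] for the sup norm, so polynomial decay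
    of order [2 d] is enough to be dominated by the weight. *)
Lemma rV_weight_ge d (x : 'rV[R]_d) : 1 <= (1 + `|x|) ^+ (2 * d) * rV_weight x.
Proof.
elim: d x => [|d ih] x; first by rewrite muln0 expr0 mulr1.
have x1 : 0 < 1 + `|x| by rewrite ltr_pwDl.
rewrite mulnS exprD /= /tensor mulrACA -[leLHS]mulr1 ler_pM//.
  rewrite /weight powRN (@powR_mulrn _ _ 2) ?addr_ge0//.
  rewrite ler_pdivlMr ?mul1r ?exprn_gt0 ?ltr_pwDl//.
  by rewrite lerXn2r ?nnegrE ?addr_ge0// lerD2l coord_le_norm.
apply: (le_trans (ih (rV_tail x))); rewrite ler_wpM2r//; first exact/ltW/rV_weight_gt0.
by rewrite lerXn2r ?nnegrE ?addr_ge0// lerD2l norm_rV_tail.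
Qed.

Lemma normr_Re_le (z : R[i]) : `|complex.Re z| <= cabs z.
Proof.
by case: z => a b /=; rewrite -sqrtr_sqr ler_wsqrtr// lerDl sqr_ge0.
Qed.

Lemma normr_Im_le (z : R[i]) : `|complex.Im z| <= cabs z.
Proof.
by case: z => a b /=; rewrite -sqrtr_sqr ler_wsqrtr// lerDr sqr_ge0.
Qed.

Lemma cabs_le (z : R[i]) : cabs z <= `|complex.Re z| + `|complex.Im z|.
Proof.
case: z => a b /=; rewrite -[leRHS]ger0_norm ?addr_ge0// -sqrtr_sqr ler_wsqrtr//.
by rewrite sqrrD !real_normK ?num_real// addrAC lerDl mulrn_wge0// mulr_ge0.
Qed.

Lemma cabs_ge0 (z : R[i]) : 0 <= cabs z.
Proof. by case: z => a b; exact: sqrtr_ge0. Qed.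

Section fixed_dim.
Context {d : nat}.
Implicit Types (phi : schwartz R d) (g : 'rV[R]_d -> R).

Lemma iter_cpartial_nil (F : 'rV[R]_d -> R[i]) x : iter_cpartial [::] F x = F x.
Proof. by rewrite /iter_cpartial /=; case: (F x). Qed.

Lemma schwartz_weight_bound phi : exists M, forall x, cabs (phi x) <= M * rV_weight x.
Proof.
have /set_mem[_ /(_ [::]) hphi] := valP phi.
have /choice[M hM] : forall k, exists M, forall x : 'rV[R]_d, `|x| ^+ k * cabs (phi x) <= M.
  by move=> k; have [M hM] := hphi k; exists M => x; rewrite -[phi x]iter_cpartial_nil.
(* Binomial expansion of [(1 + |x|) ^ (2 d)]; each power of [|x|] is controlled by its own Schwartz
   seminorm. *)
exists (\sum_(i < (2 * d).+1) M i *+ 'C(2 * d, i)) => x.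
have w0 := rV_weight_gt0 x.
apply: (@le_trans _ _ (cabs (phi x) * (1 + `|x|) ^+ (2 * d) * rV_weight x)).
  by rewrite -mulrA -[leLHS]mulr1 ler_wpM2l// ?cabs_ge0// rV_weight_ge.
rewrite ler_wpM2r//; first exact: ltW.
rewrite exprDn mulr_sumr ler_sum// => i _.
by rewrite expr1n mul1r mulrnAr mulrC lerMn2r hM orbT.
Qed.

Lemma schwartz_measurable phi :
  measurable_fun setT (fun x => complex.Re (phi x)) /\
  measurable_fun setT (fun x => complex.Im (phi x)).
Proof.
have /set_mem[[sR sI] _] := valP phi.
by split; apply: continuous_measurable_rV; [exact: (sR [::]).1|exact: (sI [::]).1].
Qed.

Lemma schwartz_L1 phi : L1 (lebesgue_rV d) (fun x => complex.Re (phi x)) /\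
  L1 (lebesgue_rV d) (fun x => complex.Im (phi x)).
Proof.
have [mR mI] := schwartz_measurable phi; have [M hM] := schwartz_weight_bound phi.
have Iw := L1Z M (L1_rV_weight d).
split; apply: (L1_le _ _ Iw) => // x.
  by rewrite (le_trans (normr_Re_le _))// (le_trans (hM x))// ler_norm.
by rewrite (le_trans (normr_Im_le _))// (le_trans (hM x))// ler_norm.
Qed.

Lemma schwartz_bounded phi : exists M, forall x, cabs (phi x) <= M.
Proof.
have /set_mem[_ /(_ [::] 0%N)[M hM]] := valP phi.
by exists M => x; have := hM x; rewrite expr0 mul1r iter_cpartial_nil.
Qed.

Lemma cintegral_realM g (F : 'rV[R]_d -> R[i]) :
  cintegral (fun x => (g x)%:C%C * F x) =
  ((\int[lebesgue_rV d]_x (g x * complex.Re (F x)))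
   +i* (\int[lebesgue_rV d]_x (g x * complex.Im (F x))))%C.
Proof.
rewrite /cintegral; congr (_ +i* _)%C; congr Rintegral; apply/funext => x;
  by case: (F x) => a b /=; rewrite mul0r ?subr0 ?addr0.
Qed.

Definition regular_fun g (phi : schwartz R d) : R[i] :=
  cintegral (fun x => (g x)%:C%C * phi x).

Lemma regular_is_tempered g : L1 (lebesgue_rV d) g -> regular_fun g \in is_tempered.
Proof.
move=> Ig; rewrite inE; split=> [c phi psi|].
  have [M1 h1] := schwartz_bounded phi; have [M2 h2] := schwartz_bounded psi.
  have [m1 m1'] := schwartz_measurable phi; have [m2 m2'] := schwartz_measurable psi.
  have I1 := L1_mul_bounded Ig m1 (fun x => le_trans (normr_Re_le _) (h1 x)).
  have I2 := L1_mul_bounded Ig m1' (fun x => le_trans (normr_Im_le _) (h1 x)).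
  have I3 := L1_mul_bounded Ig m2 (fun x => le_trans (normr_Re_le _) (h2 x)).
  have I4 := L1_mul_bounded Ig m2' (fun x => le_trans (normr_Im_le _) (h2 x)).
  rewrite /regular_fun !cintegral_realM.
  case: c => a b.
  apply/eqP; rewrite eq_complex/=; apply/andP; split; apply/eqP.
    rewrite -!RintegralZl// -RintegralB//; [|exact: L1Z|exact: L1Z].
    rewrite -RintegralD//; last by apply: L1B; exact: L1Z.
    apply: eq_Rintegral => x _ /=.
    rewrite -[X in complex.Re X]/((a +i* b)%C * phi x + psi x).
    by case: (phi x) (psi x) => [p q] [u v] /=; ring.
  rewrite -!RintegralZl// -RintegralD//; [|exact: L1Z|exact: L1Z].
  rewrite -RintegralD//; last by apply: L1D; exact: L1Z.
  apply: eq_Rintegral => x _ /=.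
  rewrite -[X in complex.Im X]/((a +i* b)%C * phi x + psi x).
  by case: (phi x) (psi x) => [p q] [u v] /=; ring.
(* Sup-norm control of [phi] suffices, so the order is [0]; the factor [2] comes from treating real
   and imaginary parts separately. *)
exists (2 * \int[lebesgue_rV d]_x `|g x|), 0%N => phi M hM.
have hb x : cabs (phi x) <= M.
  by have := hM [::] 0%N x; rewrite expr0 mul1r iter_cpartial_nil; exact.
have [mR mI] := schwartz_measurable phi.
rewrite /regular_fun cintegral_realM (le_trans (cabs_le _))//=.
have := Rintegral_mul_bounded_le Ig mR (fun x => le_trans (normr_Re_le _) (hb x)).
have := Rintegral_mul_bounded_le Ig mI (fun x => le_trans (normr_Im_le _) (hb x)).
by move=> /= e1 e2; lra.
Qed.

End fixed_dim.
End schwartz_bounds.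

Section regular.
Context {R : realType} {d : nat}.
Implicit Types (phi : schwartz R d) (g : 'rV[R]_d -> R).
Local Notation mu := (lebesgue_rV d).

Definition regular g (Ig : L1 mu g) : tempered R d :=
  Tempered (regular_is_tempered Ig).

Lemma L1_mul_schwartz g phi : L1 mu g ->
  L1 mu (fun x => g x * complex.Re (phi x)) /\
  L1 mu (fun x => g x * complex.Im (phi x)).
Proof.
move=> Ig; have [M h] := schwartz_bounded phi; have [mR mI] := schwartz_measurable phi.
split.
  exact: (L1_mul_bounded Ig mR (fun x => le_trans (normr_Re_le _) (h x))).
exact: (L1_mul_bounded Ig mI (fun x => le_trans (normr_Im_le _) (h x))).
Qed.

(** The difference comes as a separate [g3], equal pointwise, so that it can be given directly as a
    multiple of a tail. *)
Lemma regularB g1 g2 g3 (I1 : L1 mu g1) (I2 : L1 mu g2) (I3 : L1 mu g3) :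
  (forall x, g3 x = g1 x - g2 x) -> regular I1 - regular I2 = regular I3.
Proof.
move=> E; apply/val_inj/funext => phi /=.
rewrite -[LHS]/(regular_fun g1 phi - regular_fun g2 phi) /regular_fun !cintegral_realM.
have [A1 B1] := L1_mul_schwartz phi I1; have [A2 B2] := L1_mul_schwartz phi I2.
apply/eqP; rewrite eq_complex/= -!RintegralB//; apply/andP; split; apply/eqP;
  by apply: eq_Rintegral => x _; rewrite E mulrBl.
Qed.

Definition cosT g (xi : 'rV[R]_d) : R := \int[mu]_x (g x * cos (dotv x xi)).
Definition sinT g (xi : 'rV[R]_d) : R := \int[mu]_x (g x * sin (dotv x xi)).
(* [|ghat xi|^2], which is multiplicative on tensor products. *)
Definition power g xi : R := cosT g xi ^+ 2 + sinT g xi ^+ 2.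

Lemma dotvC (x y : 'rV[R]_d) : dotv x y = dotv y x.
Proof. by apply: eq_bigr => j _; rewrite mulrC. Qed.

Lemma measurable_dotv : measurable_fun setT (fun z : 'rV[R]_d * 'rV[R]_d => dotv z.1 z.2).
Proof.
apply: measurable_sum => j; apply: measurable_funM.
  exact: (measurableT_comp (measurable_rV_coord j) measurable_fst).
exact: (measurableT_comp (measurable_rV_coord j) measurable_snd).
Qed.

Lemma measurable_cos_dotv :
  measurable_fun setT (fun z : 'rV[R]_d * 'rV[R]_d => cos (dotv z.1 z.2)).
Proof.
apply: (@measurableT_comp _ _ _ _ _ _ (@cos R) _ _ _ measurable_dotv).
by apply: continuous_measurable_fun; exact: continuous_cos.
Qed.

Lemma measurable_sin_dotv :
  measurable_fun setT (fun z : 'rV[R]_d * 'rV[R]_d => sin (dotv z.1 z.2)).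
Proof.
apply: (@measurableT_comp _ _ _ _ _ _ (@sin R) _ _ _ measurable_dotv).
by apply: continuous_measurable_fun; exact: continuous_sin.
Qed.

Lemma L1_cos g xi : L1 mu g -> L1 mu (fun x => g x * cos (dotv x xi)).
Proof.
move=> Ig; apply: (@L1_mul_bounded _ _ _ _ _ _ 1 Ig); last by move=> x; exact: cos_max.
exact: (measurableT_comp measurable_cos_dotv (measurable_pair2 xi)).
Qed.

Lemma L1_sin g xi : L1 mu g -> L1 mu (fun x => g x * sin (dotv x xi)).
Proof.
move=> Ig; apply: (@L1_mul_bounded _ _ _ _ _ _ 1 Ig); last by move=> x; exact: sin_max.
exact: (measurableT_comp measurable_sin_dotv (measurable_pair2 xi)).
Qed.

Lemma fourierE g xi : L1 mu g ->
  fourier (fun x => (g x)%:C%C) xi = (cosT g xi -i* sinT g xi)%C.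
Proof.
move=> Ig; rewrite /fourier /cintegral /cosT /sinT; apply/eqP; rewrite eq_complex/=; apply/andP; split; apply/eqP.
  by apply: eq_Rintegral => x _ /=; rewrite mulr0 subr0 mulrC.
rewrite -[RHS]mulN1r -RintegralZl//; last exact: L1_sin.
by apply: eq_Rintegral => x _ /=; rewrite mulr0 add0r mulN1r mulNr mulrC.
Qed.

Lemma measurable_cosT g : measurable_fun setT g -> measurable_fun setT (cosT g).
Proof.
move=> mg; apply: (measurable_Rintegral_param mu
  (f := fun z => g z.2 * cos (dotv z.2 z.1))).
apply: measurable_funM; first exact: measurableT_comp.
exact: (measurableT_comp measurable_cos_dotv
  (measurable_fun_pair measurable_snd measurable_fst)).
Qed.

Lemma measurable_sinT g : measurable_fun setT g -> measurable_fun setT (sinT g).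
Proof.
move=> mg; apply: (measurable_Rintegral_param mu
  (f := fun z => g z.2 * sin (dotv z.2 z.1))).
apply: measurable_funM; first exact: measurableT_comp.
exact: (measurableT_comp measurable_sin_dotv
  (measurable_fun_pair measurable_snd measurable_fst)).
Qed.

Lemma cosT_le g xi : L1 mu g -> `|cosT g xi| <= \int[mu]_x `|g x|.
Proof.
move=> Ig; rewrite -[leRHS]mul1r; apply: Rintegral_mul_bounded_le => //.
  exact: (measurableT_comp measurable_cos_dotv (measurable_pair2 xi)).
by move=> x; exact: cos_max.
Qed.

Lemma sinT_le g xi : L1 mu g -> `|sinT g xi| <= \int[mu]_x `|g x|.
Proof.
move=> Ig; rewrite -[leRHS]mul1r; apply: Rintegral_mul_bounded_le => //.
  exact: (measurableT_comp measurable_sin_dotv (measurable_pair2 xi)).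
by move=> x; exact: sin_max.
Qed.

Lemma cosT_exchange g a : L1 mu g -> L1 mu a ->
  \int[mu]_x (g x * cosT a x) = \int[mu]_x (a x * cosT g x).
Proof.
move=> Ig Ia.
have := Rintegral_kernel_exchange Ig Ia measurable_cos_dotv (fun z => cos_max _).
rewrite /= => <-; apply: eq_Rintegral => x _; congr (_ * _).
by apply: eq_Rintegral => y _; rewrite dotvC.
Qed.

Lemma sinT_exchange g a : L1 mu g -> L1 mu a ->
  \int[mu]_x (g x * sinT a x) = \int[mu]_x (a x * sinT g x).
Proof.
move=> Ig Ia.
have := Rintegral_kernel_exchange Ig Ia measurable_sin_dotv (fun z => sin_max _).
rewrite /= => <-; apply: eq_Rintegral => x _; congr (_ * _).
by apply: eq_Rintegral => y _; rewrite dotvC.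
Qed.

Lemma L1_mul_cosT g a : L1 mu g -> L1 mu a -> L1 mu (fun x => g x * cosT a x).
Proof.
move=> Ig Ia; apply: (L1_mul_bounded Ig) => [|x]; last exact: cosT_le.
by apply: measurable_cosT; exact: L1_measurable Ia.
Qed.

Lemma L1_mul_sinT g a : L1 mu g -> L1 mu a -> L1 mu (fun x => g x * sinT a x).
Proof.
move=> Ig Ia; apply: (L1_mul_bounded Ig) => [|x]; last exact: sinT_le.
by apply: measurable_sinT; exact: L1_measurable Ia.
Qed.

Lemma fourier_schwartzE phi x : fourier phi x =
  ((cosT (fun y => complex.Re (phi y)) x + sinT (fun y => complex.Im (phi y)) x)
   +i* (cosT (fun y => complex.Im (phi y)) x - sinT (fun y => complex.Re (phi y)) x))%C.
Proof.
have [IR II] := schwartz_L1 phi.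
rewrite /fourier /cintegral; apply/eqP; rewrite eq_complex/= -RintegralD//; last 2 first.
- exact: L1_cos.
- exact: L1_sin.
rewrite -RintegralB//; last 2 first.
- exact: L1_cos.
- exact: L1_sin.
apply/andP; split; apply/eqP; apply: eq_Rintegral => y _;
  by case: (phi y) => p q /=; ring.
Qed.

(** The multiplication formula [int g phihat = int ghat phi], split into four real exchanges of
    integrals. *)
Lemma has_fourier_transform_regular g (Ig : L1 mu g) :
  has_fourier_transform (regular Ig) (fourier (fun x => (g x)%:C%C)).
Proof.
move=> phi phihat E.
have [IR II] := schwartz_L1 phi.
rewrite [LHS]cintegral_realM.
set a := (fun y => complex.Re (phi y)) in IR *.
set b := (fun y => complex.Im (phi y)) in II *.
transitivity ((\int[mu]_x (g x * cosT a x) + \int[mu]_x (g x * sinT b x))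
  +i* (\int[mu]_x (g x * cosT b x) - \int[mu]_x (g x * sinT a x)))%C.
  apply/eqP; rewrite eq_complex/= -RintegralD//; last 2 first.
  - exact: L1_mul_cosT.
  - exact: L1_mul_sinT.
  rewrite -RintegralB//; last 2 first.
  - exact: L1_mul_cosT.
  - exact: L1_mul_sinT.
  by apply/andP; split; apply/eqP; apply: eq_Rintegral => x _;
    rewrite E fourier_schwartzE/= mulrDr ?mulrN.
rewrite (cosT_exchange Ig IR) (cosT_exchange Ig II) (sinT_exchange Ig IR) (sinT_exchange Ig II).
apply/eqP; rewrite /cintegral eq_complex/= -RintegralD//; last 2 first.
- exact: L1_mul_cosT.
- exact: L1_mul_sinT.
rewrite -RintegralB//; last 2 first.
- exact: L1_mul_cosT.
- exact: L1_mul_sinT.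
apply/andP; split; apply/eqP; apply: eq_Rintegral => x _; rewrite fourierE// /a /b;
  move: (cosT g x) (sinT g x) => u v; by case: (phi x) => p q /=; ring.
Qed.

End regular.

(** * Upper bounds for the two norms *)

Section norms.
Context {R : realType} {d : nat}.
Implicit Types (g : 'rV[R]_d -> R).
Local Notation mu := (lebesgue_rV d).
Local Open Scope ereal_scope.

Definition vregular N g (Ig : L1 mu g) : vtempered R d N := fun=> regular Ig.

Lemma vnorm_const N (z : R[i]) :
  vnorm (fun _ : 'I_N => z) = (Num.sqrt N%:R * cabs z)%R.
Proof.
rewrite /vnorm sumr_const card_ord -[in LHS]mulr_natl sqrtrM// sqrtr_sqr.
by rewrite ger0_norm// cabs_ge0.
Qed.

Lemma Lnorm_lt (p e : R) (f : 'rV[R]_d -> \bar R) : (0 < p)%R -> (0 < e)%R ->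
  \int[mu]_x `|f x| `^ p < (e `^ p)%:E -> Lnorm mu p%:E f < e%:E.
Proof.
move=> p0 e0; rewrite -powR_Lnorm ?gt_eqF// => h.
rewrite ltNge; apply/negP => /(gt0_ler_poweR (ltW p0)).
rewrite !in_itv/= !leey !andbT !lee_fin Lnorm_ge0 (ltW e0) => /(_ isT isT).
by rewrite leNgt h.
Qed.

Lemma cabs_real (r : R) : cabs (r%:C)%C = `|r|%R.
Proof. by rewrite /= expr0n addr0 sqrtr_sqr. Qed.

(** The infimum is at most its value at the representative [g]; the [N] equal components produce the
    factor [sqrt N]. *)
Lemma lebesgue_norm_regular_lt N g (Ig : L1 mu g) (p e : R) :
  (0 < p)%R -> (0 < e)%R ->
  ((Num.sqrt N%:R) `^ p)%:E * \int[mu]_x (`|g x| `^ p)%:E < (e `^ p)%:E ->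
  lebesgue_norm p (@vregular N g Ig) < e%:E.
Proof.
move=> p0 e0 h.
have mg := L1_measurable Ig.
apply: (@le_lt_trans _ _ (Lnorm mu p%:E (fun x => (vnorm (fun _ : 'I_N => (g x)%:C%C))%:E))).
  apply: ereal_inf_lbound; exists (fun=> fun x => (g x)%:C%C); split => // _; split => //=.
apply: Lnorm_lt => //; apply: le_lt_trans h.
rewrite -ge0_integralZl ?lee_fin ?powR_ge0//; last first.
- apply/measurable_EFinP; apply: (@measurableT_comp _ _ _ _ _ _ (fun x : R => x `^ p)%R).
    exact: measurable_powR.
  exact: measurableT_comp.
rewrite le_eqVlt; apply/orP; left; apply/eqP; apply: eq_integral => x _.
rewrite vnorm_const cabs_real abse_EFin ger0_norm ?mulr_ge0// poweR_EFin -EFinM.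
by rewrite powRM.
Qed.

(** The infimum is at most its value at the classical transform of [g]. Squaring turns the exponent
    [s / 2] into [s], the factor [sqrt N] into [N] and the modulus into [power]. *)
Lemma sobolev_norm_regular_lt N g (Ig : L1 mu g) (s e : R) : (0 < e)%R ->
  \int[mu]_xi (N%:R * ((1 + dotv xi xi) `^ s * power g xi))%:E < (e ^+ 2)%:E ->
  sobolev_norm s (@vregular N g Ig) < e%:E.
Proof.
move=> e0 h; have mg := L1_measurable Ig.
pose F (xi : 'rV[R]_d) := fourier (fun x => (g x)%:C%C) xi.
apply: (@le_lt_trans _ _ (Lnorm mu 2%:E (fun xi =>
   ((1 + dotv xi xi) `^ (s / 2) * vnorm (fun _ : 'I_N => F xi))%:E))).
  apply: ereal_inf_lbound; exists (fun=> F); split => // k; last first.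
    exact: has_fourier_transform_regular.
  rewrite (_ : F = fun xi => (cosT g xi -i* sinT g xi)%C); last first.
    by apply/funext => xi; rewrite /F fourierE.
  split => /=; first exact: measurable_cosT.
  by apply: measurableT_comp => //; exact: measurable_sinT.
apply: Lnorm_lt => //.
rewrite -[X in _ < (X)%:E]/(e `^ 2)%R (@powR_mulrn _ _ 2) ?(ltW e0)//.
apply: le_lt_trans h; rewrite le_eqVlt; apply/orP; left; apply/eqP.
apply: eq_integral => xi _; rewrite vnorm_const abse_EFin poweR_EFin (@powR_mulrn _ _ 2)//.
rewrite real_normK ?num_real// !exprMn sqr_sqrtr// -(powR_mulrn 2) ?powR_ge0//.
rewrite -powRrM divfK ?pnatr_eq0// mulrCA; congr (_ * (_ * _))%:E.
by rewrite /F fourierE//= sqr_sqrtr ?addr_ge0 ?sqr_ge0// sqrrN.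
Qed.

End norms.

(** * The lacunary sum of bumps *)

Section bump.
Context {R : realType}.
Implicit Types a b t : R.
Local Notation leb := (@lebesgue_measure R).

Lemma expinv1_gt0 (t : R) : 0 < t -> 0 < expinv 1 t.
Proof. by move=> t0; rewrite expinv_gt0E// hornerC mul1r expR_gt0. Qed.

Lemma expinv1_ge0 (t : R) : 0 <= expinv 1 t.
Proof. by have [/expinv1_gt0/ltW//|/expinv_le0 ->] := ltP 0 t. Qed.

Lemma expinv1_le1 (t : R) : expinv 1 t <= 1.
Proof.
have [t0|/expinv_le0 ->//] := ltP 0 t.
by rewrite expinv_gt0E// hornerC mul1r -expR0 ler_expR oppr_le0 invr_ge0 ltW.
Qed.

Lemma expinv1_nd (s t : R) : s <= t -> expinv 1 s <= expinv 1 t.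
Proof.
move=> st; have [s0|/expinv_le0 ->] := ltP 0 s; last exact: expinv1_ge0.
have t0 := lt_le_trans s0 st.
by rewrite !expinv_gt0E// !hornerC !mul1r ler_expR lerN2 lef_pV2.
Qed.

Lemma continuous_expinv (p : {poly R}) : continuous (expinv p).
Proof.
move=> t; apply: differentiable_continuous; apply/derivable1_diffP.
exact: (@ex_derive _ _ _ _ _ _ _ (is_derive_expinv p _)).
Qed.

Definition bump (a b t : R) : R := expinv 1 (t - a) * expinv 1 (b - t).

Lemma bump_ge0 a b t : 0 <= bump a b t.
Proof. by rewrite mulr_ge0// expinv1_ge0. Qed.

Lemma bump_le1 a b t : bump a b t <= 1.
Proof. by rewrite mulr_ile1// ?expinv1_ge0// expinv1_le1. Qed.

Lemma bump_neq0 a b t : bump a b t != 0 -> a < t < b.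
Proof.
rewrite mulf_eq0 negb_or => /andP[ta tb]; apply/andP; split.
  by rewrite ltNge; apply: contraNN ta => ?; rewrite expinv_le0 ?subr_le0.
by rewrite ltNge; apply: contraNN tb => ?; rewrite expinv_le0 ?subr_le0.
Qed.

(** At distance at least [e] from both ends, monotonicity bounds each factor below by
    [expinv 1 e]. *)
Lemma bump_ge a b (e t : R) : 0 < e -> a + e <= t <= b - e ->
  expinv 1 e ^+ 2 <= bump a b t.
Proof.
by move=> e0 /andP[ta tb]; rewrite expr2 ler_pM ?expinv1_ge0//; apply: expinv1_nd; lra.
Qed.

(** The polynomial is just [X^2], left in the shape that [is_derive_expinv] produces. *)
Definition dbump (a b t : R) : R :=
  expinv ('X^2 * (1 - 1^`())) (t - a) * expinv 1 (b - t)
  - expinv 1 (t - a) * expinv ('X^2 * (1 - 1^`())) (b - t).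

Lemma is_derive_bump a b t : is_derive t 1 (bump a b) (dbump a b t).
Proof.
have d1 : is_derive t 1 (fun t : R => t - a) (1 : R).
  by have := @is_deriveB _ _ _ id (cst a) t 1 _ _ (is_derive_id _ _) (is_derive_cst _ _ _); rewrite subr0.
have d2 : is_derive t 1 (fun t : R => b - t) (- 1 : R).
  by have := @is_deriveB _ _ _ (cst b) id t 1 _ _ (is_derive_cst _ _ _) (is_derive_id _ _); rewrite sub0r.
have e1 := @is_derive1_comp _ (expinv 1) (fun t : R => t - a) t _ _ (is_derive_expinv 1 (t - a)) d1.
have e2 := @is_derive1_comp _ (expinv 1) (fun t : R => b - t) t _ _ (is_derive_expinv 1 (b - t)) d2.
apply: (@is_derive_eq _ _ _ _ _ _ _ _ (is_deriveM e1 e2)).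
by rewrite /dbump /GRing.scale/=; ring.
Qed.

Lemma continuous_dbump a b : continuous (dbump a b).
Proof.
have c1 p : continuous (fun t : R => expinv p (t - a)).
  move=> t; apply: (@continuous_comp _ _ _ (fun t : R => t - a) (expinv p)).
    by apply: cvgB; [exact: cvg_id|exact: cvg_cst].
  exact: continuous_expinv.
have c2 p : continuous (fun t : R => expinv p (b - t)).
  move=> t; apply: (@continuous_comp _ _ _ (fun t : R => b - t) (expinv p)).
    by apply: cvgB; [exact: cvg_cst|exact: cvg_id].
  exact: continuous_expinv.
by move=> t; apply: cvgB; apply: cvgM; [exact: c1|exact: c2|exact: c1|exact: c2].
Qed.

Lemma dbump_out a b t : ~~ (a < t < b) -> dbump a b t = 0.
Proof.
rewrite negb_and -!leNgt /dbump => /orP[ta|tb].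
  by rewrite !(@expinv_le0 _ _ (t - a)) ?subr_le0// !mul0r subr0.
by rewrite !(@expinv_le0 _ _ (b - t)) ?subr_le0// !mulr0 subr0.
Qed.

Lemma dbump_bounded a b : a <= b -> exists2 S, 0 <= S & forall t, `|dbump a b t| <= S.
Proof.
move=> ab.
have cn : {within `[a, b], continuous (fun t => `|dbump a b t|)}.
  by apply: continuous_subspaceT => t; apply: cvg_norm; exact: continuous_dbump.
have [c _ hc] := EVT_max ab cn.
exists `|dbump a b c| => // t; have [tab|tab] := boolP (a < t < b).
  by apply: hc; rewrite in_itv/=; case/andP: tab => /ltW -> /ltW ->.
by rewrite dbump_out// normr0.
Qed.

End bump.

(** * Fourier integrals on the line *)

Section one_dim.
Context {R : realType}.
Local Notation leb := (@lebesgue_measure R).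

Lemma itv_bound_integral (f : R -> R) (M a b : R) : measurable_fun setT f ->
  a <= b -> 0 <= M -> (forall t, `|f t| <= M) -> (forall t, ~~ (a < t < b) -> f t = 0) ->
  (\int[leb]_t `|f t|%:E <= (M * (b - a))%:E)%E.
Proof.
move=> mf ab M0 fM f0.
apply: (@le_trans _ _ (\int[leb]_t (M * \1_(`[a, b]%classic : set R) t)%:E)%E).
  apply: ge0_le_integral => //.
  - by apply/measurable_EFinP; exact: measurableT_comp.
  - by apply/measurable_EFinP; apply: measurable_funM => //; exact: measurable_indic.
  - move=> t _; rewrite lee_fin indicE.
    have [tab|tab] := boolP (a < t < b); last by rewrite f0// normr0 mulr_ge0.
    rewrite mem_set ?mulr1//= in_itv/=; by case/andP: tab => /ltW -> /ltW ->.
under eq_integral do rewrite EFinM.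
rewrite ge0_integralZl//; last first.
  by apply/measurable_EFinP; exact: measurable_indic.
have L : leb `[a, b]%classic = (b - a)%:E.
  rewrite lebesgue_measure_itv/= lte_fin; case: ifPn => [_|]; first by rewrite EFinB.
  by rewrite -leNgt => ba; rewrite (le_anti (introT andP (conj ab ba))) subrr.
by rewrite integral_indic// setIT [X in (_ * X <= _)%E]L -EFinM.
Qed.

Lemma itv_bound_L1 (f : R -> R) (M a b : R) : measurable_fun setT f ->
  a <= b -> 0 <= M -> (forall t, `|f t| <= M) -> (forall t, ~~ (a < t < b) -> f t = 0) ->
  L1 leb f /\ \int[leb]_t `|f t| <= M * (b - a).
Proof.
move=> mf ab M0 fM f0; have h := itv_bound_integral mf ab M0 fM f0.
have If : L1 leb f.
  apply/integrableP; split; first exact/measurable_EFinP.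
  by apply: (le_lt_trans h); rewrite ltry.
by split => //; rewrite -lee_fin EFin_Rintegral//; exact: L1_norm.
Qed.

(** The primitive vanishes at both ends of [[a, b]]. Applied to products, this is integration by
    parts without boundary terms. *)
Lemma Rintegral_derive_compact (Phi phi : R -> R) (a b : R) : a < b ->
  (forall t : R, is_derive t 1 Phi (phi t)) -> continuous phi ->
  (forall t, ~~ (a < t < b) -> Phi t = 0) -> (forall t, ~~ (a < t < b) -> phi t = 0) ->
  \int[leb]_t phi t = 0.
Proof.
move=> ab dPhi cphi P0 p0.
have cP t : {for t, continuous Phi}.
  apply: differentiable_continuous; apply/derivable1_diffP.
  exact: (@ex_derive _ _ _ _ _ _ _ (dPhi t)).
rewrite /Rintegral (_ : (\int[leb]_t (phi t)%:E)%E = \int[leb]_(t in `[a, b]) (phi t)%:E)%E.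
  rewrite (@continuous_FTC2 _ phi Phi)//.
  - by rewrite !P0 ?ltxx ?andbF//= subrr.
  - exact: continuous_subspaceT.
  - split.
    + by move=> t _; have [] := dPhi t.
    + by apply: cvg_at_right_filter; exact: cP.
    + by apply: cvg_at_left_filter; exact: cP.
  - by move=> t _; rewrite derive1E; have [] := dPhi t.
rewrite [RHS]integral_mkcond; apply: eq_integral => t _; rewrite patchE.
case: ifPn => // /negP tab; rewrite p0//; apply/negP => /andP[at_ tb]; apply: tab.
by rewrite inE/= in_itv/= !ltW.
Qed.

Definition cos1 (g : R -> R) (tau : R) : R := \int[leb]_t (g t * cos (t * tau)).
Definition sin1 (g : R -> R) (tau : R) : R := \int[leb]_t (g t * sin (t * tau)).

Lemma measurable_cosM (tau : R) : measurable_fun setT (fun t : R => cos (t * tau)).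
Proof.
have m1 : measurable_fun setT (@cos R).
  by apply: continuous_measurable_fun; exact: continuous_cos.
have m2 : measurable_fun setT (fun t : R => t * tau) by exact: measurable_funM.
exact: (measurableT_comp m1 m2).
Qed.

Lemma measurable_sinM (tau : R) : measurable_fun setT (fun t : R => sin (t * tau)).
Proof.
have m1 : measurable_fun setT (@sin R).
  by apply: continuous_measurable_fun; exact: continuous_sin.
have m2 : measurable_fun setT (fun t : R => t * tau) by exact: measurable_funM.
exact: (measurableT_comp m1 m2).
Qed.

Lemma L1_cos1 g tau : L1 leb g -> L1 leb (fun t => g t * cos (t * tau)).
Proof.
by move=> Ig; apply: (L1_mul_bounded Ig (measurable_cosM tau)) => t; exact: cos_max.
Qed.

Lemma L1_sin1 g tau : L1 leb g -> L1 leb (fun t => g t * sin (t * tau)).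
Proof.
by move=> Ig; apply: (L1_mul_bounded Ig (measurable_sinM tau)) => t; exact: sin_max.
Qed.

Lemma cos1_le g tau : L1 leb g -> `|cos1 g tau| <= \int[leb]_t `|g t|.
Proof.
move=> Ig; rewrite -[leRHS]mul1r; apply: (Rintegral_mul_bounded_le Ig (measurable_cosM tau)).
by move=> t; exact: cos_max.
Qed.

Lemma sin1_le g tau : L1 leb g -> `|sin1 g tau| <= \int[leb]_t `|g t|.
Proof.
move=> Ig; rewrite -[leRHS]mul1r; apply: (Rintegral_mul_bounded_le Ig (measurable_sinM tau)).
by move=> t; exact: sin_max.
Qed.

Lemma is_derive_cosM (tau t : R) : is_derive t 1 (fun t : R => cos (t * tau)) (- (tau * sin (t * tau))).
Proof.
have d : is_derive t 1 (fun t : R => t * tau) tau.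
  have := @is_deriveM _ _ id (cst tau) t 1 _ _ (is_derive_id _ _) (is_derive_cst _ _ _).
  by rewrite /GRing.scale/= mulr0 add0r mulr1.
have := @is_derive1_comp _ (@cos R) (fun t : R => t * tau) t _ _ (is_derive_cos (t * tau)) d.
by rewrite mulNr mulrC.
Qed.

Lemma is_derive_sinM (tau t : R) : is_derive t 1 (fun t : R => sin (t * tau)) (tau * cos (t * tau)).
Proof.
have d : is_derive t 1 (fun t : R => t * tau) tau.
  have := @is_deriveM _ _ id (cst tau) t 1 _ _ (is_derive_id _ _) (is_derive_cst _ _ _).
  by rewrite /GRing.scale/= mulr0 add0r mulr1.
have := @is_derive1_comp _ (@sin R) (fun t : R => t * tau) t _ _ (is_derive_sin (t * tau)) d.
by rewrite mulrC.
Qed.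

Lemma continuous_cosM (tau : R) : continuous (fun t : R => cos (t * tau)).
Proof.
move=> t; apply: (@continuous_comp _ _ _ (fun t : R => t * tau) (@cos R)).
  by apply: cvgM; [exact: cvg_id|exact: cvg_cst].
exact: continuous_cos.
Qed.

Lemma continuous_sinM (tau : R) : continuous (fun t : R => sin (t * tau)).
Proof.
move=> t; apply: (@continuous_comp _ _ _ (fun t : R => t * tau) (@sin R)).
  by apply: cvgM; [exact: cvg_id|exact: cvg_cst].
exact: continuous_sin.
Qed.

(** The derivatives of [g sin (t tau)] and [g cos (t tau)] integrate to [0], so [tau] times one
    transform of [g] is, up to sign, the other transform of [dg], which the [L^1] norm of [dg]
    bounds. *)
Lemma transform_decay (g dg : R -> R) (a b tau : R) : a < b ->
  (forall t : R, is_derive t 1 g (dg t)) -> continuous dg ->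
  (forall t, ~~ (a < t < b) -> g t = 0) -> (forall t, ~~ (a < t < b) -> dg t = 0) ->
  L1 leb g -> L1 leb dg ->
  `|tau| * `|cos1 g tau| <= \int[leb]_t `|dg t| /\
  `|tau| * `|sin1 g tau| <= \int[leb]_t `|dg t|.
Proof.
move=> ab dgE cdg g0 dg0 Ig Idg.
have cg : continuous g.
  move=> t; apply: differentiable_continuous; apply/derivable1_diffP.
  exact: (@ex_derive _ _ _ _ _ _ _ (dgE t)).
split.
- have : \int[leb]_t (dg t * sin (t * tau) + tau * (g t * cos (t * tau))) = 0.
    apply: (@Rintegral_derive_compact (fun t => g t * sin (t * tau)) _ a b) => // [t|t|t tab|t tab].
    + apply: (@is_derive_eq _ _ _ _ _ _ _ _ (is_deriveM (dgE t) (is_derive_sinM tau t))).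
      by rewrite /GRing.scale/=; ring.
    + apply: cvgD; first by apply: cvgM; [exact: cdg|exact: continuous_sinM].
      by apply: cvgM; [exact: cvg_cst|apply: cvgM; [exact: cg|exact: continuous_cosM]].
    + by rewrite g0// mul0r.
    + by rewrite dg0// g0// !mul0r mulr0 addr0.
  rewrite RintegralD//; [|exact: L1_sin1|by apply: L1Z; exact: L1_cos1].
  rewrite RintegralZl//; last exact: L1_cos1.
  move/eqP; rewrite addrC addr_eq0 => /eqP E.
  by rewrite -normrM E normrN; exact: sin1_le.
- have : \int[leb]_t (dg t * cos (t * tau) - tau * (g t * sin (t * tau))) = 0.
    apply: (@Rintegral_derive_compact (fun t => g t * cos (t * tau)) _ a b) => // [t|t|t tab|t tab].
    + apply: (@is_derive_eq _ _ _ _ _ _ _ _ (is_deriveM (dgE t) (is_derive_cosM tau t))).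
      by rewrite /GRing.scale/=; ring.
    + apply: cvgB; first by apply: cvgM; [exact: cdg|exact: continuous_cosM].
      by apply: cvgM; [exact: cvg_cst|apply: cvgM; [exact: cg|exact: continuous_sinM]].
    + by rewrite g0// mul0r.
    + by rewrite dg0// g0// !mul0r mulr0 subr0.
  rewrite RintegralB//; [|exact: L1_cos1|by apply: L1Z; exact: L1_sin1].
  rewrite RintegralZl//; last exact: L1_sin1.
  move/eqP; rewrite subr_eq0 => /eqP E.
  by rewrite -normrM -E; exact: cos1_le.
Qed.

End one_dim.

(** With at most one nonzero term the sum is that term, so any map sending [0] to [0] passes inside.
    It serves for powers of sums of disjoint bumps. *)
Lemma sum_at_most_one (V W : nmodType) (phi : V -> W) (f : nat -> V) (kappa m n : nat) :
  phi 0 = 0 -> (forall k, k != kappa -> f k = 0) ->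
  phi (\sum_(m <= k < n) f k) = \sum_(m <= k < n) phi (f k).
Proof.
move=> phi0 f0; elim: n => [|n ih]; first by rewrite !big_geq.
have [mn|nm] := leqP m n; last by rewrite !big_geq.
rewrite !big_nat_recr//=; have [nk|nk] := eqVneq n kappa; last first.
  by rewrite f0// !addr0 phi0 addr0.
rewrite big_nat_cond big1 ?add0r; last first.
  by move=> k /andP[/andP[_ kn] _]; rewrite f0// -nk ltn_eqF.
rewrite big_nat_cond big1 ?add0r// => k /andP[/andP[_ kn] _].
by rewrite f0 ?phi0// -nk ltn_eqF.
Qed.

Section lacunary.
Context {R : realType}.
Local Notation leb := (@lebesgue_measure R).

Definition sqrt2 : R := Num.sqrt 2.

Lemma sqrt2_sqr : sqrt2 ^+ 2 = 2. Proof. by rewrite sqr_sqrtr. Qed.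
Lemma sqrt2_gt0 : 0 < sqrt2. Proof. by rewrite sqrtr_gt0. Qed.
Lemma sqrt2_gt1 : 1 < sqrt2. Proof. by rewrite -[ltLHS]sqrtr1 ltr_sqrt ?ltr1n. Qed.
Lemma sqrt2X_ge1 k : 1 <= sqrt2 ^+ k. Proof. by rewrite exprn_ege1// ltW// sqrt2_gt1. Qed.
Lemma pow2E k : 2 ^+ k = sqrt2 ^+ k * sqrt2 ^+ k :> R.
Proof. by rewrite -exprMn -expr2 sqrt2_sqr. Qed.

(** The interval [(1/4, 1/2)] has its right end at twice its left end, so that its dilates by
    [2 ^ - k] are pairwise disjoint. *)
Definition unit_bump : R -> R := bump 4^-1 2^-1.
Definition dyadic_bump (k : nat) (t : R) : R := sqrt2 ^+ k * unit_bump (2 ^+ k * t).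
Definition dyadic_dbump (k : nat) (t : R) : R := sqrt2 ^+ k * (2 ^+ k * dbump 4^-1 2^-1 (2 ^+ k * t)).

Lemma dyadic_bump_ge0 k t : 0 <= dyadic_bump k t.
Proof. by rewrite mulr_ge0 ?bump_ge0// exprn_ge0// ltW// sqrt2_gt0. Qed.

Lemma dyadic_bump_le k t : dyadic_bump k t <= sqrt2 ^+ k.
Proof. by rewrite -[leRHS]mulr1 ler_wpM2l ?bump_le1// exprn_ge0// ltW// sqrt2_gt0. Qed.

Lemma dyadic_bump_neq0 k t : dyadic_bump k t != 0 -> 4^-1 < 2 ^+ k * t < 2^-1.
Proof. by rewrite mulf_eq0 negb_or => /andP[_]; exact: bump_neq0. Qed.

(** The interval is enlarged to one starting at [0], still of length of order [2 ^ - k], which is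
    what the norm bounds require. *)
Lemma scale_itv k (t : R) : 4^-1 < 2 ^+ k * t < 2^-1 -> 0 < t < (2 ^+ k)^-1.
Proof.
have p : 0 < 2 ^+ k :> R by rewrite exprn_gt0.
move=> /andP[a b]; apply/andP; split.
  by rewrite -(pmulr_rgt0 _ p) (lt_trans _ a)// invr_gt0.
rewrite -(ltr_pM2l p) divff ?gt_eqF// (lt_trans b)// invf_lt1// ltr1n//.
Qed.

Lemma dyadic_bump_out k t : ~~ (0 < t < (2 ^+ k)^-1) -> dyadic_bump k t = 0.
Proof. by apply: contraNeq => /dyadic_bump_neq0/scale_itv. Qed.

Lemma dyadic_dbump_out k t : ~~ (0 < t < (2 ^+ k)^-1) -> dyadic_dbump k t = 0.
Proof.
move=> tk; rewrite /dyadic_dbump dbump_out ?mulr0//; apply: contraNN tk.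
exact: scale_itv.
Qed.

Lemma is_derive_dyadic_bump k (t : R) : is_derive t 1 (dyadic_bump k) (dyadic_dbump k t).
Proof.
have d : is_derive t 1 (fun t : R => 2 ^+ k * t) (2 ^+ k).
  have := @is_deriveM _ _ (cst (2 ^+ k)) id t 1 _ _ (is_derive_cst _ _ _) (is_derive_id _ _).
  by rewrite /GRing.scale/= mulr0 addr0 mulr1.
have d2 := @is_derive1_comp _ unit_bump (fun t : R => 2 ^+ k * t) t _ _ (is_derive_bump _ _ _) d.
have := is_deriveZ (sqrt2 ^+ k) d2.
by rewrite /GRing.scale/= [_ * 2 ^+ k]mulrC.
Qed.

Lemma continuous_dyadic_bump k : continuous (dyadic_bump k).
Proof.
move=> t; apply: differentiable_continuous; apply/derivable1_diffP.
exact: (@ex_derive _ _ _ _ _ _ _ (is_derive_dyadic_bump k t)).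
Qed.

Lemma continuous_dyadic_dbump k : continuous (dyadic_dbump k).
Proof.
move=> t; apply: cvgM; first exact: cvg_cst.
apply: cvgM; first exact: cvg_cst.
apply: (@continuous_comp _ _ _ (fun t : R => 2 ^+ k * t) (dbump 4^-1 2^-1)).
  by apply: cvgM; [exact: cvg_cst|exact: cvg_id].
exact: continuous_dbump.
Qed.

Lemma measurable_dyadic_bump k : measurable_fun setT (dyadic_bump k).
Proof. by apply: continuous_measurable_fun; exact: continuous_dyadic_bump. Qed.

(** Height [sqrt 2 ^ k] times length [2 ^ - k]. *)
Lemma dyadic_bump_L1 k : L1 leb (dyadic_bump k) /\ \int[leb]_t `|dyadic_bump k t| <= (sqrt2 ^+ k)^-1.
Proof.
have := @itv_bound_L1 _ (dyadic_bump k) (sqrt2 ^+ k) 0 (2 ^+ k)^-1 (measurable_dyadic_bump k).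
have r0 : 0 < sqrt2 ^+ k by rewrite exprn_gt0// sqrt2_gt0.
rewrite subr0 pow2E invfM mulrA divff ?gt_eqF// mul1r -invfM -pow2E; apply.
- by rewrite invr_ge0 exprn_ge0.
- exact: ltW.
- by move=> t; rewrite ger0_norm ?dyadic_bump_ge0 ?dyadic_bump_le.
- exact: dyadic_bump_out.
Qed.

(** Differentiation costs a factor [2 ^ k], which the length [2 ^ - k] of the support compensates;
    [S] is the supremum for the undilated bump. *)
Lemma dyadic_dbump_L1 : exists2 S, 0 <= S & forall k,
  L1 leb (dyadic_dbump k) /\ \int[leb]_t `|dyadic_dbump k t| <= S * sqrt2 ^+ k.
Proof.
have h42 : 4^-1 <= 2^-1 :> R by rewrite lef_pV2 ?posrE// ler_nat.
have [S S0 hS] := dbump_bounded h42.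
exists S => // k.
have p : 0 < 2 ^+ k :> R by rewrite exprn_gt0.
have r0 : 0 < sqrt2 ^+ k by rewrite exprn_gt0// sqrt2_gt0.
have := @itv_bound_L1 _ (dyadic_dbump k) (sqrt2 ^+ k * (2 ^+ k * S)) 0 (2 ^+ k)^-1.
rewrite subr0 (_ : _ * (2 ^+ k)^-1 = S * sqrt2 ^+ k); last first.
  by rewrite -mulrA [2 ^+ k * S]mulrC mulfK ?gt_eqF// mulrC.
apply.
- by apply: continuous_measurable_fun; exact: continuous_dyadic_dbump.
- by rewrite invr_ge0 ltW.
- by rewrite !mulr_ge0// ltW.
- move=> t; rewrite !normrM (ger0_norm (ltW r0)) (ger0_norm (ltW p)).
  by rewrite !ler_wpM2l// ltW.
- exact: dyadic_dbump_out.
Qed.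

(** A geometric mean: write [c = c ^ theta c ^ (1 - theta)], with the size bound on the first factor
    and the decay bound on the second. The exponents of [sqrt 2 ^ k] add up to [1 - 2 theta]. *)
Lemma decay_interpolation (S c theta tau : R) (k : nat) : 0 <= S -> 0 <= c ->
  0 < theta < 1 -> c <= (sqrt2 ^+ k)^-1 -> `|tau| * c <= S * sqrt2 ^+ k ->
  c <= (1 + S) * (sqrt2 `^ (1 - theta *+ 2)) ^+ k * weight (1 - theta) tau.
Proof.
move=> S0 c0 /andP[th0 th1] cu cv.
have r0 := sqrt2_gt0; have x0 : 0 < sqrt2 ^+ k by rewrite exprn_gt0.
have x1 := sqrt2X_ge1 k.
have t0 : 0 < 1 + `|tau| by rewrite ltr_pwDl.
have S1 : 0 < 1 + S by rewrite ltr_pwDl.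
(* Adding [c <= 1 <= sqrt 2 ^ k] to the decay bound replaces [|tau|] by [1 + |tau|], at the price of
   [1 + S] for [S]. *)
have cv' : c <= (1 + S) * sqrt2 ^+ k / (1 + `|tau|).
  rewrite ler_pdivlMr// mulrDr mulr1 mulrDl mul1r [c * _]mulrC lerD//.
  by rewrite (le_trans cu)// (le_trans _ x1)// invf_le1.
have -> : c = c `^ theta * c `^ (1 - theta).
  rewrite -powRD; first by rewrite addrC subrK powRr1//.
  by rewrite addrC subrK oner_eq0.
have h1 : c `^ theta <= (sqrt2 ^+ k)^-1 `^ theta.
  by apply: (ge0_ler_powR (ltW th0)); rewrite ?nnegrE// invr_ge0 ltW.
have h2 : c `^ (1 - theta) <= ((1 + S) * sqrt2 ^+ k / (1 + `|tau|)) `^ (1 - theta).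
  apply: ge0_ler_powR => //; rewrite ?nnegrE// ?subr_ge0 ?(ltW th1)//.
  by rewrite divr_ge0 ?mulr_ge0 ?(ltW x0) ?(ltW t0) ?(ltW S1).
rewrite (le_trans (ler_pM (powR_ge0 _ _) (powR_ge0 _ _) h1 h2))//.
have -> : (sqrt2 ^+ k)^-1 `^ theta = (sqrt2 ^+ k) `^ (- theta).
  by rewrite -powR_inv1 ?(ltW x0)// -powRrM mulN1r.
have -> : ((1 + S) * sqrt2 ^+ k / (1 + `|tau|)) `^ (1 - theta) =
    (1 + S) `^ (1 - theta) * (sqrt2 ^+ k) `^ (1 - theta) * weight (1 - theta) tau.
  rewrite powRM ?mulr_ge0 ?invr_ge0 ?(ltW x0) ?(ltW t0) ?(ltW S1)//.
  rewrite powRM ?(ltW x0) ?(ltW S1)//; congr (_ * _).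
  by rewrite -powR_inv1 ?(ltW t0)// -powRrM mulN1r.
rewrite mulrA ler_wpM2r ?powR_ge0// mulrCA -powRD; last by apply/implyP => _; rewrite gt_eqF.
rewrite (_ : - theta + (1 - theta) = 1 - theta *+ 2); last by rewrite mulr2n; ring.
have -> : (sqrt2 ^+ k) `^ (1 - theta *+ 2) = (sqrt2 `^ (1 - theta *+ 2)) ^+ k.
  by rewrite -(powR_mulrn k (ltW r0)) -(powR_mulrn k (powR_ge0 _ _)) -!powRrM mulrC.
rewrite ler_wpM2r ?exprn_ge0 ?powR_ge0//.
have : (1 + S) `^ (1 - theta) <= (1 + S) `^ 1.
  by apply: ler_powR; rewrite ?lerDl// lerBlDr lerDl (ltW th0).
by rewrite powRr1// (ltW S1).
Qed.

Lemma dyadic_bump_transform_decay (theta : R) : 0 < theta < 1 -> exists2 B, 0 <= B & forall k tau,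
  `|cos1 (dyadic_bump k) tau| <= B * (sqrt2 `^ (1 - theta *+ 2)) ^+ k * weight (1 - theta) tau /\
  `|sin1 (dyadic_bump k) tau| <= B * (sqrt2 `^ (1 - theta *+ 2)) ^+ k * weight (1 - theta) tau.
Proof.
move=> th; have [S S0 hS] := dyadic_dbump_L1; exists (1 + S); first by rewrite addr_ge0.
move=> k tau; have [Id dle] := hS k; have [IH Hle] := dyadic_bump_L1 k.
have p : 0 < (2 ^+ k)^-1 :> R by rewrite invr_gt0 exprn_gt0.
have [c s] := transform_decay tau p (is_derive_dyadic_bump k) (@continuous_dyadic_dbump k)
  (@dyadic_bump_out k) (@dyadic_dbump_out k) IH Id.
split; apply: decay_interpolation => //.
- exact: le_trans (cos1_le _ IH) Hle.
- exact: le_trans c dle.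
- exact: le_trans (sin1_le _ IH) Hle.
- exact: le_trans s dle.
Qed.

End lacunary.

(** * The lacunary series and its tails *)

Section series.
Context {R : realType}.
Local Notation leb := (@lebesgue_measure R).
Local Notation r := (@sqrt2 R).

Definition bump_sum (n : nat) (t : R) : R := \sum_(0 <= k < n) dyadic_bump k t.
Definition bump_series (t : R) : R := limn (bump_sum ^~ t).
Definition bump_tail (m : nat) (t : R) : R := bump_series t - bump_sum m t.

(** All bumps vanish for [t <= 0]; for [t > 0] the [k]-th one vanishes once [2 ^ k >= 1 / t], and
    [2 ^ k > k]. *)
Lemma dyadic_bump_eventually0 (t : R) : exists N, forall k, (N <= k)%N -> dyadic_bump k t = 0.
Proof.
have [t0|t0] := leP t 0; first by exists 0%N => k _; rewrite dyadic_bump_out// ltNge t0.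
have [N hN] : exists N : nat, t^-1 < N%:R.
  by exists (Num.bound t^-1); rewrite archi_boundP// invr_ge0 ltW.
exists N => k Nk; apply: dyadic_bump_out; rewrite t0/= -leNgt -[leRHS]invrK lef_pV2 ?posrE ?exprn_gt0 ?invr_gt0//.
apply: (le_trans (ltW hN)); rewrite -natrX ler_nat (leq_trans Nk)// ltnW// ltn_expl//.
Qed.

Lemma bump_series_stable (t : R) : exists N, forall n, (N <= n)%N -> bump_series t = bump_sum n t.
Proof.
have [N hN] := dyadic_bump_eventually0 t.
have FN n : (N <= n)%N -> bump_sum n t = bump_sum N t.
  move=> Nn; rewrite /bump_sum (big_cat_nat (n := N))//= [X in _ + X = _](_ : _ = 0) ?addr0//.
  rewrite big_nat_cond big1//.
  by move=> k /andP[/andP[Nk _] _]; rewrite hN.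
exists N => n Nn; rewrite FN//; apply: cvg_lim => //; apply: cvg_near_cst.
by exists N => // k; exact: FN.
Qed.

Lemma bump_sum_cat m n (t : R) : (m <= n)%N -> bump_sum n t = bump_sum m t + \sum_(m <= k < n) dyadic_bump k t.
Proof. by move=> mn; rewrite /bump_sum (big_cat_nat (n := m)). Qed.

Lemma bump_tail_sum m (t : R) : exists N, forall n, (N <= n)%N -> bump_tail m t = \sum_(m <= k < n) dyadic_bump k t.
Proof.
have [N hN] := bump_series_stable t; exists (maxn m N) => n; rewrite geq_max => /andP[mn Nn].
by rewrite /bump_tail (hN n)// (bump_sum_cat _ mn) addrC addKr.
Qed.

Lemma bump_tail_ge0 m (t : R) : 0 <= bump_tail m t.
Proof.
by have [N hN] := bump_tail_sum m t; rewrite (hN N)//; apply: sumr_ge0 => k _; exact: dyadic_bump_ge0.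
Qed.

Lemma bump_sum_ge0 n (t : R) : 0 <= bump_sum n t.
Proof. by apply: sumr_ge0 => k _; exact: dyadic_bump_ge0. Qed.

Lemma bump_tail_cat m n (t : R) : (m <= n)%N -> bump_tail m t = bump_tail n t + \sum_(m <= k < n) dyadic_bump k t.
Proof. by move=> mn; rewrite /bump_tail (bump_sum_cat _ mn); ring. Qed.

(** If [2 ^ k t > 1/4] then [2 ^ l t >= 2 (2 ^ k t) > 1/2], beyond the support of the [l]-th
    bump. *)
Lemma dyadic_bump_disjoint k l (t : R) : (k < l)%N -> dyadic_bump k t != 0 -> dyadic_bump l t = 0.
Proof.
move=> kl /dyadic_bump_neq0/andP[k1 _]; apply/eqP/negPn/negP => /dyadic_bump_neq0/andP[_].
rewrite -(subnK kl) -addSnnS exprD -mulrA; apply/negP; rewrite -leNgt.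
have p0 : 0 < 2 ^+ k * t by rewrite (lt_trans _ k1)// invr_gt0.
rewrite exprS; apply: (@le_trans _ _ (2 * (2 ^+ k * t))).
  rewrite -ler_pdivrMl// (le_trans _ (ltW k1))// -invfM -natrM//.
rewrite -mulrA ler_wpM2l// -[leLHS]mul1r ler_wpM2r ?(ltW p0)//.
by rewrite exprn_ege1// ler1n.
Qed.

Lemma dyadic_bump_at_most_one (t : R) : exists kappa, forall k, k != kappa -> dyadic_bump k t = 0.
Proof.
have [[kappa hk]|h] := pselect (exists k, dyadic_bump k t != 0); last first.
  by exists 0%N => k _; apply/eqP/negPn/negP => hk; apply: h; exists k.
exists kappa => k; rewrite neq_ltn => /orP[kl|kl]; last exact: dyadic_bump_disjoint kl hk.
by apply/eqP/negPn/negP => /(dyadic_bump_disjoint kl) E; rewrite E eqxx in hk.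
Qed.

Lemma sum_dyadic_bump_powR (p t : R) m n : 0 < p ->
  (\sum_(m <= k < n) dyadic_bump k t) `^ p = \sum_(m <= k < n) (dyadic_bump k t `^ p).
Proof.
move=> p0; have [kappa h] := dyadic_bump_at_most_one t.
by apply: (@sum_at_most_one _ _ (fun x : R => x `^ p) _ kappa) => //; rewrite powR0// gt_eqF.
Qed.

Lemma measurable_bump_sum n : measurable_fun setT (bump_sum n).
Proof. by apply: measurable_sum => k; exact: measurable_dyadic_bump. Qed.

Lemma measurable_bump_series : measurable_fun setT bump_series.
Proof.
apply: (@measurable_fun_cvg _ _ _ _ bump_sum) => [n|t _]; first exact: measurable_bump_sum.
have [N hN] := bump_series_stable t; rewrite (hN N)//; apply: cvg_near_cst.
by exists N => // n Nn; rewrite -(hN N)// (hN n).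
Qed.

Lemma measurable_bump_tail m : measurable_fun setT (bump_tail m).
Proof. by apply: measurable_funB; [exact: measurable_bump_series|exact: measurable_bump_sum]. Qed.

(** The [p]-th power of the height [sqrt 2 ^ k] times the length [2 ^ - k]; the ratio
    [sqrt 2 ^ p / 2] is below [1] exactly when [p < 2]. *)
Lemma integral_dyadic_bump_powR (p : R) k : 0 < p ->
  (\int[leb]_t (dyadic_bump k t `^ p)%:E <= ((r `^ p / 2) ^+ k)%:E)%E.
Proof.
move=> p0.
have x0 : 0 < r ^+ k by rewrite exprn_gt0// sqrt2_gt0.
have := @itv_bound_integral R (fun t => dyadic_bump k t `^ p) ((r ^+ k) `^ p) 0 (2 ^+ k)^-1.
rewrite subr0 (_ : _ * (2 ^+ k)^-1 = (r `^ p / 2) ^+ k); last first.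
  rewrite expr_div_n; congr (_ / _).
  by rewrite -(powR_mulrn k (ltW sqrt2_gt0)) -(powR_mulrn k (powR_ge0 _ _)) -!powRrM mulrC.
under eq_integral do rewrite ger0_norm ?powR_ge0//; apply.
- apply: (@measurableT_comp _ _ _ _ _ _ (fun x : R => x `^ p)).
    exact: measurable_powR.
  exact: measurable_dyadic_bump.
- by rewrite invr_ge0 exprn_ge0.
- exact: powR_ge0.
- move=> t; rewrite ger0_norm ?powR_ge0//; apply: (ge0_ler_powR (ltW p0)).
  + by rewrite nnegrE dyadic_bump_ge0.
  + by rewrite nnegrE ltW.
  + exact: dyadic_bump_le.
- by move=> t tk; rewrite dyadic_bump_out// powR0// gt_eqF.
Qed.

Lemma geom_sum_le (q : R) m n : 0 <= q < 1 -> \sum_(m <= k < n) q ^+ k <= (1 - q)^-1 * q ^+ m.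
Proof.
move=> /andP[q0 q1]; have q1' : 0 < 1 - q by rewrite subr_gt0.
rewrite mulrC ler_pdivlMr//.
have [mn|nm] := leqP m n; last first.
  by rewrite big_geq ?mul0r ?exprn_ge0// ltnW.
rewrite mulr_suml (_ : \sum_(m <= i < n) _ = \sum_(m <= i < n) (- q ^+ i.+1 - - q ^+ i)); last first.
  by apply: eq_bigr => i _; rewrite exprS; ring.
by rewrite telescope_sumr// opprK addrC lerBlDr lerDl exprn_ge0.
Qed.

Lemma sqrt2_powR_gt1 (a : R) : 0 < a -> 1 < r `^ a.
Proof.
move=> a0; rewrite [ltLHS](_ : 1 = 1 `^ a); last by rewrite powR1.
apply: gt0_ltr_powR => //.
- by rewrite nnegrE.
- by rewrite nnegrE ltW// sqrt2_gt0.
- exact: sqrt2_gt1.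
Qed.

(** Disjoint supports turn the power of a sum into a sum of powers, whose integrals are dominated by
    a geometric series; monotone convergence passes to the infinite tail. *)
Lemma integral_bump_tail_powR (p : R) : 0 < p < 2 -> exists Q q, [/\ 0 <= Q, 0 <= q < 1 &
  forall m, (\int[leb]_t (bump_tail m t `^ p)%:E <= (Q * q ^+ m)%:E)%E].
Proof.
move=> /andP[p0 p2]; set q := r `^ p / 2.
have q01 : 0 <= q < 1.
  rewrite divr_ge0 ?powR_ge0//= ltr_pdivrMr// mul1r -[ltRHS]sqrt2_sqr.
  rewrite -(powR_mulrn 2 (ltW sqrt2_gt0)) -[X in _ < _ `^ X](subrK p) powRD; last first.
    by apply/implyP => _; rewrite gt_eqF// sqrt2_gt0.
  by rewrite ltr_pMl ?powR_gt0 ?sqrt2_gt0// sqrt2_powR_gt1// subr_gt0.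
exists (1 - q)^-1, q; split => //.
  by rewrite invr_ge0 subr_ge0 ltW//; case/andP: q01.
move=> m.
pose g n t : \bar R := ((\sum_(m <= k < n) dyadic_bump k t) `^ p)%:E.
have mHp k : measurable_fun setT (fun t : R => dyadic_bump k t `^ p).
  exact: (measurableT_comp (measurable_powR p) (measurable_dyadic_bump k)).
have gE t n : g n t = (\sum_(m <= k < n) (dyadic_bump k t `^ p)%:E)%E.
  by rewrite /g sum_dyadic_bump_powR// sumEFin.
have mg n : measurable_fun setT (g n).
  apply/measurable_EFinP.
  apply: (measurableT_comp (measurable_powR p)).
  by apply: measurable_sum => k; exact: measurable_dyadic_bump.
have gint n : (\int[leb]_t g n t <= ((1 - q)^-1 * q ^+ m)%:E)%E.
  under eq_integral do rewrite gE.
  rewrite ge0_integral_sum//; last 2 first.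
  - by move=> k; apply/measurable_EFinP; exact: mHp.
  - by move=> k t _; rewrite lee_fin powR_ge0.
  apply: (@le_trans _ _ (\sum_(m <= k < n) (q ^+ k)%:E)%E).
    by apply: lee_sum => k _; exact: integral_dyadic_bump_powR.
  by rewrite sumEFin lee_fin; exact: geom_sum_le.
have glim t : limn (g ^~ t) = (bump_tail m t `^ p)%:E.
  have [N hN] := bump_tail_sum m t; apply: cvg_lim => //; apply: cvg_near_cst.
  by exists N => // n Nn; rewrite /g -hN.
have nd t : {homo g^~ t : n n' / (n <= n')%N >-> (n <= n')%E}.
  move=> n n' nn'; rewrite !gE; have [mn|nm] := leqP m n.
    rewrite [leRHS](big_cat_nat (n := n))//= leeDl// sume_ge0// => k _.
    by rewrite lee_fin powR_ge0.
  by rewrite big_geq ?(ltnW nm)// sume_ge0// => k _; rewrite lee_fin powR_ge0.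
have cg := @cvg_monotone_convergence _ _ _ leb setT measurableT g mg
  (fun n t _ => powR_ge0 _ _) (fun t _ => nd t).
under eq_integral do rewrite -glim.
rewrite -(cvg_lim _ cg)//; apply: lime_le; first by apply/cvg_ex; eexists; exact: cg.
by near=> n; exact: gint.
Unshelve. all: by end_near. Qed.

Lemma bump_tail_L1 : exists Q q, [/\ 0 <= Q, 0 <= q < 1 &
  forall m, L1 leb (bump_tail m) /\ \int[leb]_t `|bump_tail m t| <= Q * q ^+ m].
Proof.
have h12 : 0 < (1 : R) < 2 by rewrite ltr01/= ltr1n.
have [Q [q [Q0 q01 h]]] := integral_bump_tail_powR h12.
exists Q, q; split => // m.
have hm : (\int[leb]_t `|bump_tail m t|%:E <= (Q * q ^+ m)%:E)%E.
  rewrite (_ : (\int[leb]_t _)%E = \int[leb]_t (bump_tail m t `^ 1)%:E)%E//.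
  by apply: eq_integral => t _; rewrite powRr1 ?ger0_norm ?bump_tail_ge0.
have IG : L1 leb (bump_tail m).
  apply/integrableP; split; first by apply/measurable_EFinP; exact: measurable_bump_tail.
  exact: (le_lt_trans hm (ltry _)).
by split => //; rewrite -lee_fin EFin_Rintegral//; exact: L1_norm.
Qed.

Lemma bump_series_L1 : L1 leb bump_series.
Proof.
have [Q [q [_ _ h]]] := bump_tail_L1; have [+ _] := h 0%N.
rewrite (_ : bump_tail 0 = bump_series)//; apply/funext => t.
by rewrite /bump_tail /bump_sum big_geq// subr0.
Qed.

Lemma bump_sum_L1 n : L1 leb (bump_sum n).
Proof.
have [Q [q [_ _ h]]] := bump_tail_L1; have [IG _] := h n.
rewrite (_ : bump_sum n = fun t => bump_series t - bump_tail n t); first exact: L1B bump_series_L1 IG.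
by apply/funext => t; rewrite /bump_tail; ring.
Qed.

Lemma cos1D (g1 g2 : R -> R) tau : L1 leb g1 -> L1 leb g2 ->
  cos1 (fun t => g1 t + g2 t) tau = cos1 g1 tau + cos1 g2 tau.
Proof.
move=> I1 I2; rewrite /cos1 -RintegralD//; [|exact: L1_cos1|exact: L1_cos1].
by apply: eq_Rintegral => t _; rewrite mulrDl.
Qed.

Lemma sin1D (g1 g2 : R -> R) tau : L1 leb g1 -> L1 leb g2 ->
  sin1 (fun t => g1 t + g2 t) tau = sin1 g1 tau + sin1 g2 tau.
Proof.
move=> I1 I2; rewrite /sin1 -RintegralD//; [|exact: L1_sin1|exact: L1_sin1].
by apply: eq_Rintegral => t _; rewrite mulrDl.
Qed.

(* Instead of exchanging an infinite sum with the transform [L], the remainder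
   [L (bump_tail n)] is sent to [0]. *)
Lemma functional_tail (L : (R -> R) -> R) (Q q B rho w : R) (m : nat) :
  0 <= q < 1 -> 0 <= rho < 1 -> 0 <= B -> 0 <= w ->
  (forall g1 g2, L1 leb g1 -> L1 leb g2 -> L (fun t => g1 t + g2 t) = L g1 + L g2) ->
  (forall n, L1 leb (bump_tail n) /\ `|L (bump_tail n)| <= Q * q ^+ n) ->
  (forall k, `|L (dyadic_bump k)| <= B * rho ^+ k * w) ->
  `|L (bump_tail m)| <= B * (1 - rho)^-1 * rho ^+ m * w.
Proof.
move=> /andP[q0 q1] rho01 B0 w0 LD LG LH.
have step n : (m <= n)%N -> L (bump_tail m) = L (bump_tail n) + \sum_(m <= k < n) L (dyadic_bump k).
  elim: n => [|n ih].
    by rewrite leqn0 => /eqP ->; rewrite big_geq// addr0.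
  rewrite leq_eqVlt => /orP[/eqP <-|]; first by rewrite big_geq// addr0.
  rewrite ltnS => mn; rewrite ih// big_nat_recr//= [_ + L (dyadic_bump n)]addrC addrA; congr (_ + _).
  rewrite -LD; last 2 first.
  - by have [] := LG n.+1.
  - by have [] := @dyadic_bump_L1 R n.
  congr L; apply/funext => t; by rewrite (bump_tail_cat _ (leqnSn n)) big_nat1.
have bound n : (m <= n)%N -> `|L (bump_tail m)| <= Q * q ^+ n + B * (1 - rho)^-1 * rho ^+ m * w.
  move=> mn; rewrite (step n mn) (le_trans (ler_normD _ _))// lerD//; first by have [] := LG n.
  rewrite (le_trans (ler_norm_sum _ _ _))//.
  apply: (@le_trans _ _ (\sum_(m <= k < n) (B * rho ^+ k * w))).
    by apply: ler_sum => k _; exact: LH.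
  rewrite -mulr_suml -mulr_sumr ler_wpM2r// -mulrA ler_wpM2l//.
  exact: geom_sum_le.
have c : Q * q ^+ n + B * (1 - rho)^-1 * rho ^+ m * w @[n --> \oo] -->
    Q * 0 + B * (1 - rho)^-1 * rho ^+ m * w.
  apply: cvgD; last exact: cvg_cst.
  apply: cvgM; first exact: cvg_cst.
  by apply: cvg_expr; rewrite ger0_norm.
have := c; rewrite mulr0 add0r => c'.
rewrite -(cvg_lim _ c')//; apply: limr_ge; first by apply/cvg_ex; eexists; exact: c'.
by near=> n; apply: bound; near: n; exact: nbhs_infty_ge.
Unshelve. all: by end_near. Qed.

(** The condition [theta > 1/2] makes the ratio [sqrt 2 ^ (1 - 2 theta)] less than [1], and the
    [L^1] decay of the tails disposes of the remainder. *)
Lemma bump_tail_transform_decay (theta : R) : 2^-1 < theta < 1 -> exists B rho,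
  [/\ 0 <= B, 0 <= rho < 1 & forall m tau,
  `|cos1 (bump_tail m) tau| <= B * rho ^+ m * weight (1 - theta) tau /\
  `|sin1 (bump_tail m) tau| <= B * rho ^+ m * weight (1 - theta) tau].
Proof.
move=> /andP[th1 th2].
have th0 : 0 < theta by rewrite (lt_trans _ th1)// invr_gt0.
have [B B0 hB] := @dyadic_bump_transform_decay R theta (introT andP (conj th0 th2)).
set rho := r `^ _ in hB.
have rho01 : 0 <= rho < 1.
  rewrite powR_ge0/= /rho -[X in _ `^ X]opprK powRN invf_lt1 ?powR_gt0 ?sqrt2_gt0//.
  by rewrite sqrt2_powR_gt1// oppr_gt0 subr_lt0 -(mulr_natr theta) -ltr_pdivrMr// mul1r.
have [Q [q [Q0 q01 h]]] := bump_tail_L1.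
exists (B * (1 - rho)^-1), rho; split => //.
  by rewrite mulr_ge0// invr_ge0 subr_ge0 ltW//; case/andP: rho01.
move=> m tau; split.
  apply: (@functional_tail (cos1^~ tau) Q q) => //; first exact/ltW/weight_gt0.
  - by move=> g1 g2; exact: cos1D.
  - by move=> n; have [IG hG] := h n; split => //; exact: le_trans (cos1_le _ IG) hG.
  - by move=> k; have [] := hB k tau.
apply: (@functional_tail (sin1^~ tau) Q q) => //; first exact/ltW/weight_gt0.
- by move=> g1 g2; exact: sin1D.
- by move=> n; have [IG hG] := h n; split => //; exact: le_trans (sin1_le _ IG) hG.
- by move=> k; have [] := hB k tau.
Qed.

End series.

Section lower_bound.
Context {R : realType}.
Local Notation leb := (@lebesgue_measure R).

Lemma bump_sum_le n (t : R) : bump_sum n t <= \sum_(0 <= k < n) sqrt2 ^+ k.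
Proof. by apply: ler_sum => k _; exact: dyadic_bump_le. Qed.

Lemma bump_sum_sqr_L1 n : L1 leb (fun t => bump_sum n t ^+ 2).
Proof.
have h (t : R) : `|bump_sum n t| <= \sum_(0 <= k < n) sqrt2 ^+ k.
  by rewrite ger0_norm ?bump_sum_ge0// bump_sum_le.
rewrite (_ : (fun t => _) = fun t => bump_sum n t * bump_sum n t); last by apply/funext => t; rewrite expr2.
exact: (L1_mul_bounded (bump_sum_L1 n) (measurable_bump_sum n) h).
Qed.

Lemma integral_dyadic_bump_sqr_ge : exists2 c : R, 0 < c & forall k, (c%:E <= \int[leb]_t (dyadic_bump k t ^+ 2)%:E)%E.
Proof.
(* A margin of [1/16] at each end of [(1/4, 1/2)] leaves an interval of length [1/8] on which the
   unit bump is at least [b]. Squared height [2 ^ k b ^ 2] times length [2 ^ - k / 8] gives a bound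
   free of [k]. *)
have e0 : 0 < (16^-1 : R) by rewrite invr_gt0.
pose b := expinv 1 (16^-1 : R) ^+ 2.
have b0 : 0 < b by rewrite exprn_gt0// expinv1_gt0.
exists (b ^+ 2 * 8^-1); first by rewrite mulr_gt0// exprn_gt0.
move=> k; have p : 0 < 2 ^+ k :> R by rewrite exprn_gt0.
have lo : (4^-1 + 16^-1) / 2 ^+ k <= (2^-1 - 16^-1) / 2 ^+ k :> R.
  by rewrite ler_pM2r ?invr_gt0//; lra.
pose D : set R := `[(4^-1 + 16^-1) / 2 ^+ k, (2^-1 - 16^-1) / 2 ^+ k]%classic.
have mD : measurable D by exact: measurable_itv.
have L : leb D = (8^-1 / 2 ^+ k)%:E.
  rewrite /D lebesgue_measure_itv/= lte_fin ifT.
    by rewrite -EFinB -mulrBl; congr (_ * _)%:E; lra.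
  by rewrite ltr_pM2r ?invr_gt0//; lra.
apply: (@le_trans _ _ (\int[leb]_t (2 ^+ k * b ^+ 2 * \1_D t)%:E)%E).
  under eq_integral do rewrite EFinM.
  rewrite ge0_integralZl//; last 2 first.
  - by apply/measurable_EFinP; exact: measurable_indic.
  - by rewrite lee_fin mulr_ge0 ?sqr_ge0// ltW.
  rewrite integral_indic// setIT [X in (_ * X)%E]L -EFinM lee_fin.
  rewrite [leRHS](_ : _ = b ^+ 2 * 8^-1)//.
  have : 2 ^+ k != 0 :> R by rewrite gt_eqF.
  by move: (2 ^+ k : R) (b ^+ 2) => x y x0; field.
apply: ge0_le_integral => //.
- by move=> t _; rewrite lee_fin indicE mulr_ge0// mulr_ge0 ?sqr_ge0// ltW.
- by apply/measurable_EFinP; apply: measurable_funM => //; exact: measurable_indic.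
- by apply/measurable_EFinP; apply: measurable_funX; exact: measurable_dyadic_bump.
move=> t _; rewrite lee_fin indicE.
have [tD|tD] := boolP (t \in D); last by rewrite mulr0 sqr_ge0.
rewrite mulr1 /dyadic_bump [leRHS]exprMn [sqrt2 ^+ k ^+ 2]expr2 -pow2E ler_wpM2l ?(ltW p)//.
rewrite lerXn2r ?nnegrE ?bump_ge0 ?(ltW b0)//; apply: bump_ge => //.
by move: tD; rewrite inE /D/= in_itv/= ler_pdivrMr// ler_pdivlMr// ![t * _]mulrC.
Qed.

(** Squares of disjoint bumps add up, and each of the [n] terms contributes at least [c]. *)
Lemma Rintegral_bump_sum_sqr_ge : exists2 c : R, 0 < c &
  forall n, c * n%:R <= \int[leb]_t (bump_sum n t ^+ 2).
Proof.
have [c c0 h] := integral_dyadic_bump_sqr_ge; exists c => // n.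
rewrite -lee_fin EFin_Rintegral; last exact: bump_sum_sqr_L1.
have E (t : R) : bump_sum n t ^+ 2 = \sum_(0 <= k < n) dyadic_bump k t ^+ 2.
  have [kappa hk] := dyadic_bump_at_most_one t.
  by apply: (@sum_at_most_one _ _ (fun x : R => x ^+ 2) _ kappa) => //; rewrite expr0n.
rewrite (_ : (\int[leb]_t _)%E = \int[leb]_t (\sum_(0 <= k < n) (dyadic_bump k t ^+ 2)%:E)%E)%E; last first.
  by apply: eq_integral => t _; rewrite E sumEFin.
rewrite ge0_integral_sum//; last 2 first.
- by move=> k; apply/measurable_EFinP; apply: measurable_funX; exact: measurable_dyadic_bump.
- by move=> k t _; rewrite lee_fin sqr_ge0.
apply: (@le_trans _ _ (\sum_(0 <= k < n) c%:E)%E); last by apply: lee_sum.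
by rewrite sumEFin lee_fin sumr_const_nat subn0 mulr_natr.
Qed.

End lower_bound.

(** * Fourier transforms of tensor products *)

Section tensor_power.
Context {R : realType}.
Local Notation leb := (@lebesgue_measure R).

Definition power1 (g : R -> R) tau : R := cos1 g tau ^+ 2 + sin1 g tau ^+ 2.

Lemma power_ge0 d (g : 'rV[R]_d -> R) xi : 0 <= power g xi.
Proof. by rewrite addr_ge0// sqr_ge0. Qed.

Lemma measurable_power d (g : 'rV[R]_d -> R) : measurable_fun setT g ->
  measurable_fun setT (power g).
Proof.
move=> mg; apply: measurable_funD; apply: measurable_funX.
  exact: measurable_cosT.
exact: measurable_sinT.
Qed.

(** By the addition formulas the transform of a tensor product is the product of the transforms, and
    squared moduli multiply. *)
Lemma power_tensor d (g : R -> R) (k : 'rV[R]_d -> R) xi :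
  L1 leb g -> L1 (lebesgue_rV d) k ->
  power (tensor g k) xi = power1 g (rV_head xi) * power k (rV_tail xi).
Proof.
move=> Ig Ik; set tau := rV_head xi; set eta := rV_tail xi.
have Igc := L1_cos1 tau Ig; have Igs := L1_sin1 tau Ig.
have Ikc := L1_cos eta Ik; have Iks := L1_sin eta Ik.
have cE : cosT (tensor g k) xi = cos1 g tau * cosT k eta - sin1 g tau * sinT k eta.
  rewrite /cos1 /sin1 /cosT /sinT -!Rintegral_tensor// -RintegralB//; last 2 first.
  - exact: integrable_tensor.
  - exact: integrable_tensor.
  apply: eq_Rintegral => x _; rewrite /tensor dotv_recl cosD -/tau -/eta; ring.
have sE : sinT (tensor g k) xi = sin1 g tau * cosT k eta + cos1 g tau * sinT k eta.
  rewrite /cos1 /sin1 /cosT /sinT -!Rintegral_tensor// -RintegralD//; last 2 first.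
  - exact: integrable_tensor.
  - exact: integrable_tensor.
  apply: eq_Rintegral => x _; rewrite /tensor dotv_recl sinD -/tau -/eta; ring.
by rewrite /power cE sE /power1; ring.
Qed.

Lemma powerZ d (c : R) (g : 'rV[R]_d -> R) xi : L1 (lebesgue_rV d) g ->
  power (fun x => c * g x) xi = c ^+ 2 * power g xi.
Proof.
move=> Ig; have Ic := L1_cos xi Ig; have Is := L1_sin xi Ig.
rewrite /power (_ : cosT _ xi = c * cosT g xi); last first.
  by rewrite /cosT -RintegralZl//; apply: eq_Rintegral => x _; rewrite mulrA.
rewrite (_ : sinT _ xi = c * sinT g xi); last first.
  by rewrite /sinT -RintegralZl//; apply: eq_Rintegral => x _; rewrite mulrA.
by ring.
Qed.

Definition bump_prod d (y : 'rV[R]_d) : R := \prod_(j < d) unit_bump (y ord0 j).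

Lemma bump_prod_recl d : @bump_prod d.+1 = tensor unit_bump (@bump_prod d).
Proof.
apply/funext => x; rewrite /bump_prod big_ord_recl /tensor; congr (_ * _).
by apply: eq_bigr => j _; rewrite mxE.
Qed.

Lemma bump_prod_rV0 : @bump_prod 0 = fun=> 1.
Proof. by apply/funext => x; rewrite /bump_prod big_ord0. Qed.

Lemma unit_bumpE : unit_bump = dyadic_bump 0 :> (R -> R).
Proof. by apply/funext => t; rewrite /dyadic_bump !expr0 !mul1r. Qed.

Lemma bump_prod_ge0 d (y : 'rV[R]_d) : 0 <= bump_prod y.
Proof. by apply: prodr_ge0 => j _; exact: bump_ge0. Qed.

Lemma bump_prod_le1 d (y : 'rV[R]_d) : bump_prod y <= 1.
Proof. by apply: prodr_ile1 => j _; rewrite bump_ge0 bump_le1. Qed.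

Lemma bump_prod_L1 d : L1 (lebesgue_rV d) (@bump_prod d).
Proof.
elim: d => [|d ih]; first by rewrite bump_prod_rV0; exact: L1_rV0.
by rewrite bump_prod_recl; apply: integrable_tensor => //; rewrite unit_bumpE; have [] := @dyadic_bump_L1 R 0.
Qed.

Lemma bump_prod_sqr_L1 d : L1 (lebesgue_rV d) (fun y => bump_prod y ^+ 2).
Proof.
rewrite (_ : (fun y => _) = fun y => bump_prod y * bump_prod y); last by apply/funext => y; rewrite expr2.
apply: (@L1_mul_bounded _ _ _ _ _ _ 1 (bump_prod_L1 d) (L1_measurable (bump_prod_L1 d))) => y.
by rewrite ger0_norm ?bump_prod_ge0// bump_prod_le1.
Qed.

Lemma sqr_tensor d (g : R -> R) (k : 'rV[R]_d -> R) :
  (fun x => tensor g k x ^+ 2) = tensor (fun t => g t ^+ 2) (fun y => k y ^+ 2).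
Proof. by apply/funext => x; rewrite /tensor exprMn. Qed.

Lemma Rintegral_bump_prod_sqr_gt0 d : 0 < \int[lebesgue_rV d]_y (bump_prod y ^+ 2).
Proof.
elim: d => [|d ih]; first by rewrite bump_prod_rV0 expr1n Rintegral_rV0.
rewrite bump_prod_recl sqr_tensor Rintegral_tensor; last 2 first.
- by have := @bump_sum_sqr_L1 R 1; rewrite /bump_sum; under eq_fun do rewrite big_nat1 -unit_bumpE.
- exact: bump_prod_sqr_L1.
(* The lower bound for a single bump, [bump_sum 1] being [unit_bump]. *)
rewrite mulr_gt0//; have [c c0 /(_ 1%N)] := @Rintegral_bump_sum_sqr_ge R.
rewrite mulr1; under eq_Rintegral do rewrite /bump_sum big_nat1 -unit_bumpE.
exact: lt_le_trans.
Qed.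

Lemma power1_le (g : R -> R) (M a tau : R) : 0 <= M ->
  `|cos1 g tau| <= M * weight a tau -> `|sin1 g tau| <= M * weight a tau ->
  power1 g tau <= 2 * M ^+ 2 * weight (a *+ 2) tau.
Proof.
move=> M0 hc hs.
have wE : weight (a *+ 2) tau = weight a tau ^+ 2.
  rewrite /weight mulr2n opprD powRD ?expr2//; apply/implyP => _.
  by rewrite gt_eqF// ltr_pwDl.
have M1 : 0 <= M * weight a tau by rewrite mulr_ge0// ltW// weight_gt0.
rewrite wE -mulrA -exprMn mulr_natl mulr2n lerD//.
  by rewrite -real_normK ?num_real// lerXn2r ?nnegrE.
by rewrite -real_normK ?num_real// lerXn2r ?nnegrE.
Qed.

Lemma measurable_power1 (g : R -> R) : measurable_fun setT g ->
  measurable_fun setT (power1 g).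
Proof.
move=> mg; apply: measurable_funD; apply: measurable_funX.
  apply: (measurable_Rintegral_param leb (f := fun z => g z.2 * cos (z.2 * z.1))).
  apply: measurable_funM; first exact: measurableT_comp.
  apply: (@measurableT_comp _ _ _ _ _ _ (@cos R)).
    by apply: continuous_measurable_fun; exact: continuous_cos.
  exact: measurable_funM.
apply: (measurable_Rintegral_param leb (f := fun z => g z.2 * sin (z.2 * z.1))).
apply: measurable_funM; first exact: measurableT_comp.
apply: (@measurableT_comp _ _ _ _ _ _ (@sin R)).
  by apply: continuous_measurable_fun; exact: continuous_sin.
exact: measurable_funM.
Qed.

Lemma power_bump_prod_L1 d : L1 (lebesgue_rV d) (power (@bump_prod d)).
Proof.
elim: d => [|d ih].
  rewrite (_ : power (@bump_prod 0) = fun=> power (@bump_prod 0) 0); first exact: L1_rV0.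
  by apply/funext => x; congr (power _ _); apply/rowP => -[].
rewrite bump_prod_recl.
have Ipsi : L1 leb (unit_bump : R -> R) by rewrite unit_bumpE; have [] := @dyadic_bump_L1 R 0.
rewrite (_ : power _ = tensor (power1 unit_bump) (power (@bump_prod d))); last first.
  by apply/funext => xi; rewrite power_tensor//; exact: bump_prod_L1.
apply: integrable_tensor => //.
(* Any value in [(0, 1/2)] would do: the squared bound decays like
   [(1 + |tau|) ^ (- 2 (1 - theta))], here with [2 (1 - theta) = 3/2 > 1]. Only [k = 0] is used,
   where the geometric factor is [1]. *)
have th : 0 < (4^-1 : R) < 1 by apply/andP; split; lra.
have [B B0 hB] := dyadic_bump_transform_decay th.
have Iw : L1 leb (fun t => 2 * B ^+ 2 * weight ((1 - 4^-1) *+ 2) t).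
  by apply: L1Z; apply: L1_weight; rewrite mulr2n; lra.
apply: (L1_le _ _ Iw); first by apply: measurable_power1; exact: L1_measurable Ipsi.
move=> tau; rewrite ger0_norm ?addr_ge0 ?sqr_ge0// ger0_norm; last first.
  by rewrite !mulr_ge0 ?sqr_ge0// ltW// weight_gt0.
have [hc hs] := hB 0%N tau.
by apply: power1_le => //; rewrite unit_bumpE; [move: hc|move: hs]; rewrite expr0 mulr1.
Qed.

End tensor_power.

(** * Geometric decay of the tails in both norms *)

Section tails.
Context {R : realType} {d N : nat}.
Local Notation leb := (@lebesgue_measure R).
Implicit Types nu : vtempered R d.+1 N -> \bar R.

(* The factor [c] covers the datum ([c = 1], [m = 0]), its difference with the
   approximants ([c = -1]) and the zero function ([c = 0]). *)
Definition tail_controlled nu := exists p Q q : R, [/\ 0 < p, 0 <= Q, 0 <= q < 1 &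
  forall m (c : R) g (Ig : L1 (lebesgue_rV d.+1) g) (e : R), `|c| <= 1 -> 0 < e ->
    (forall x, g x = c * tensor (bump_tail m) (@bump_prod R d) x) -> Q * q ^+ m < e `^ p ->
    (nu (@vregular R d.+1 N g Ig) < e%:E)%E].

Lemma tail_controlled_lebesgue (p : R) : 1 <= p < 2 ->
  tail_controlled (lebesgue_norm p).
Proof.
move=> /andP[p1 p2]; have p0 : 0 < p by rewrite (lt_le_trans _ p1).
have [Q [q [Q0 q01 hG]]] := @integral_bump_tail_powR R p (introT andP (conj p0 p2)).
set kap := \int[lebesgue_rV d]_y (@bump_prod R d y).
have kap0 : 0 <= kap by apply: Rintegral_ge0 => y _; exact: bump_prod_ge0.
exists p, ((Num.sqrt N%:R) `^ p * (Q * kap)), q; split => //.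
  by rewrite !mulr_ge0// powR_ge0.
move=> m c g Ig e c1 e0 gE he; apply: lebesgue_norm_regular_lt => //.
have mGp : measurable_fun setT (fun t : R => bump_tail m t `^ p).
  exact: (measurableT_comp (measurable_powR p) (measurable_bump_tail m)).
have mK := L1_measurable (bump_prod_L1 (R := R) d).
have mg := L1_measurable Ig.
have h : (\int[lebesgue_rV d.+1]_x (`|g x| `^ p)%:E <= (Q * kap * q ^+ m)%:E)%E.
  apply: (@le_trans _ _ (\int[lebesgue_rV d.+1]_x (tensor (fun t => bump_tail m t `^ p) (@bump_prod R d) x)%:E)%E).
    apply: ge0_le_integral => //.
    - apply/measurable_EFinP; apply: (measurableT_comp (measurable_powR p)).
      exact: measurableT_comp.
    - by apply/measurable_EFinP; exact: measurable_tensor.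
    - move=> x _; rewrite lee_fin gE normrM powRM//.
      rewrite /tensor normrM powRM// (ger0_norm (bump_tail_ge0 _ _)) (ger0_norm (bump_prod_ge0 _)).
      rewrite -[leRHS]mul1r ler_pM ?powR_ge0 ?mulr_ge0 ?powR_ge0//.
        rewrite [leRHS](_ : 1 = 1 `^ p); last by rewrite powR1.
        by apply: (ge0_ler_powR (ltW p0)); rewrite ?nnegrE.
      (* For [p >= 1] a number of [[0, 1]] dominates its [p]-th power, so the integral [kap] of
         [bump_prod] serves for every [p]. *)
      rewrite ler_wpM2l ?powR_ge0//.
      have [->|K0] := eqVneq (bump_prod (rV_tail x)) 0; first by rewrite powR0// gt_eqF.
      by apply: ge1r_powR => //; rewrite lt_neqAle eq_sym K0 bump_prod_ge0 bump_prod_le1.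
  rewrite ge0_integral_tensor//; last 2 first.
  - by move=> t; exact: powR_ge0.
  - by move=> y; exact: bump_prod_ge0.
  rewrite -(EFin_Rintegral (bump_prod_L1 d)) -/kap mulrAC EFinM; apply: lee_wpmul2r; first by rewrite lee_fin.
  exact: hG.
apply: (@le_lt_trans _ _ ((Num.sqrt N%:R `^ p)%:E * (Q * kap * q ^+ m)%:E)%E).
  by apply: lee_wpmul2l => //; rewrite lee_fin powR_ge0.
by rewrite -EFinM lte_fin mulrA.
Qed.

Lemma dotv_ge0 n (x : 'rV[R]_n) : 0 <= dotv x x.
Proof. by apply: sumr_ge0 => j _; rewrite -expr2 sqr_ge0. Qed.

(** From [(1 + |t|) ^ 2 <= 2 (1 + t ^ 2) <= 2 (1 + |xi| ^ 2)], with [t] the first frequency; the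
    negative power [s] reverses the inequality. The majorant involves one coordinate, as needed to
    factorise the integral. *)
Lemma sobolev_weight_le (s : R) (xi : 'rV[R]_d.+1) : s < 0 ->
  (1 + dotv xi xi) `^ s <= 2 `^ (- s) * weight (- s *+ 2) (rV_head xi).
Proof.
move=> s0; set t := rV_head xi.
have t1 : 0 < 1 + `|t| by rewrite ltr_pwDl.
have d1 : 0 < 1 + dotv xi xi by rewrite ltr_pwDl// dotv_ge0.
have le2 : (1 + `|t|) ^+ 2 <= 2 * (1 + dotv xi xi).
  rewrite dotv_recl -/t -expr2 -(real_normK (num_real t)).
  have := dotv_ge0 (rV_tail xi); have := sqr_ge0 (`|t| - 1).
  by move: (dotv _ _) (`|t|) => u v; rewrite !expr2; nra.
have s0' : 0 <= - s by rewrite oppr_ge0 ltW.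
have : ((1 + `|t|) ^+ 2) `^ (- s) <= (2 * (1 + dotv xi xi)) `^ (- s).
  by apply: (ge0_ler_powR s0') => //; rewrite nnegrE ?exprn_ge0 ?mulr_ge0 ?(ltW d1) ?(ltW t1).
rewrite powRM ?(ltW d1)// [(1 + dotv _ _) `^ (- s)]powRN ler_pdivlMr ?powR_gt0//.
move=> h; rewrite /weight [_ `^ (- (_ *+ 2))]powRN ler_pdivlMr ?powR_gt0// mulrC.
by move: h; rewrite -(powR_mulrn 2 (ltW t1)) -powRrM mulr_natl.
Qed.

Lemma weightD (a b t : R) : weight (a + b) t = weight a t * weight b t.
Proof.
rewrite /weight opprD powRD//; apply/implyP => _.
by rewrite gt_eqF// ltr_pwDl.
Qed.

Lemma tail_controlled_sobolev (s : R) : s < 0 -> tail_controlled (sobolev_norm s).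
Proof.
move=> s0.
(* The interpolated bound on the transform is of order [|t| ^ (th - 1)]; its
   square is integrable against [(1 + t ^ 2) ^ s] when [th < 1/2 - s], and the
   bounds are summable in [k] when [1/2 < th]. *)
have [th th1 th2] : exists2 th : R, 2^-1 < th < 1 & th < 2^-1 - s.
  (* The value [1/2 - s/4] lies a quarter of the way into the window, but is below [1] only for
     [s > -2]; for [s < -1] a fixed value serves. *)
  have [h|h] := leP (-1) s.
    by exists (2^-1 - s / 4); [apply/andP; split|]; lra.
  by exists (3 / 4); [apply/andP; split|]; lra.
have [B [rho [B0 /andP[rho0 rho1] hB]]] := bump_tail_transform_decay th1.
(* Total decay exponent of the Sobolev weight and the squared transform; [a > 1] is the condition
   [th < 1/2 - s]. *)
pose a := - s *+ 2 + (1 - th) *+ 2.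
have a1 : 1 < a by rewrite /a !mulr2n; lra.
have Iw := L1_weight a1.
have IK := power_bump_prod_L1 (R := R) d.
pose W := (\int[leb]_t weight a t) * (\int[lebesgue_rV d]_y power (@bump_prod R d) y).
have W0 : 0 <= W.
  rewrite mulr_ge0//; apply: Rintegral_ge0 => t _; first exact/ltW/weight_gt0.
  exact: power_ge0.
pose C := N%:R * (2 `^ (- s) * (2 * B ^+ 2)).
have C0 : 0 <= C by rewrite !mulr_ge0 ?powR_ge0 ?sqr_ge0.
exists 2, (C * W), (rho ^+ 2); split => //.
- exact: mulr_ge0.
- by rewrite sqr_ge0 expr_lt1.
move=> m c g Ig e c1 e0 gE; rewrite (@powR_mulrn _ _ 2) ?(ltW e0)// => he.
apply: sobolev_norm_regular_lt => //.
have [Q [q [_ _ /(_ m)[IG _]]]] := @bump_tail_L1 R.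
have mg := L1_measurable Ig.
have mdot : measurable_fun setT (fun xi : 'rV[R]_d.+1 => dotv xi xi).
  by apply: measurable_sum => j; apply: measurable_funM; exact: measurable_rV_coord.
have gT : g = fun x => c * tensor (bump_tail m) (@bump_prod R d) x by apply/funext.
have powE xi : power g xi <= power1 (bump_tail m) (rV_head xi) * power (@bump_prod R d) (rV_tail xi).
  have IT := integrable_tensor IG (bump_prod_L1 d).
  rewrite gT powerZ// -power_tensor//; last exact: bump_prod_L1.
  rewrite -[leRHS]mul1r ler_wpM2r ?power_ge0// -real_normK ?num_real//.
  by rewrite expr_le1.
apply: (@le_lt_trans _ _ (\int[lebesgue_rV d.+1]_xi
    (C * (rho ^+ 2) ^+ m * tensor (weight a) (power (@bump_prod R d)) xi)%:E)%E).
  apply: ge0_le_integral => //.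
  - by move=> xi _; rewrite lee_fin !mulr_ge0 ?powR_ge0 ?power_ge0.
  - apply/measurable_EFinP; apply: measurable_funM => //; apply: measurable_funM.
      apply: (measurableT_comp (measurable_powR s)).
      exact: measurable_funD.
    exact: measurable_power.
  - apply/measurable_EFinP; apply: measurable_funM => //; apply: measurable_tensor.
      exact: measurable_weight.
    exact: L1_measurable IK.
  move=> xi _; rewrite lee_fin.
  set tau := rV_head xi; set eta := rV_tail xi.
  have [hc hs] := hB m tau.
  have p1 := power1_le (mulr_ge0 B0 (exprn_ge0 m rho0)) hc hs.
  have K0 := power_ge0 (@bump_prod R d) eta.
  have w1 := sobolev_weight_le xi s0.
  apply: (@le_trans _ _ (N%:R * (2 `^ (- s) * weight (- s *+ 2) tau *
     (2 * (B * rho ^+ m) ^+ 2 * weight ((1 - th) *+ 2) tau * power (@bump_prod R d) eta)))).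
    rewrite ler_wpM2l// ler_pM ?powR_ge0 ?power_ge0//.
    by rewrite (le_trans (powE xi))// ler_wpM2r.
  have E : (rho ^+ 2) ^+ m = (rho ^+ m) ^+ 2 by rewrite -!exprM mulnC.
  rewrite /tensor -/tau -/eta /a (weightD (- s *+ 2)) /C E.
  move: (rho ^+ m) (weight (- s *+ 2) tau) (weight ((1 - th) *+ 2) tau) => x y z.
  move: (power _ _) (2 `^ _) (N%:R : R) => u v w.
  rewrite le_eqVlt; apply/orP; left; apply/eqP; ring.
under eq_integral do rewrite EFinM.
rewrite ge0_integralZl//; last 3 first.
- apply/measurable_EFinP; apply: measurable_tensor; first exact: measurable_weight.
  exact: L1_measurable IK.
- by move=> xi _; rewrite lee_fin mulr_ge0 ?power_ge0// ltW// weight_gt0.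
- by rewrite lee_fin mulr_ge0// exprn_ge0// sqr_ge0.
rewrite -(EFin_Rintegral (integrable_tensor Iw IK)).
by rewrite Rintegral_tensor// -EFinM lte_fin -/W mulrAC.
Qed.

End tails.

(** * The datum and its approximants *)

Section test_functions.
Context {R : realType} {d : nat}.

Definition box (rho : R) : set 'rV[R]_d := [set x | forall i, x ord0 i \in `[- rho, rho]].

Lemma compact_box rho : compact (box rho).
Proof.
apply: (@rV_compact R d (fun=> `[- rho, rho]%classic)) => _; exact: segment_compact.
Qed.

Lemma smooth_real (f : 'rV[R]_d -> R) : smooth f -> csmooth (fun x => (f x)%:C%C).
Proof. by move=> sf; split => //=; exact: smooth0. Qed.

Lemma real_test_function (U : set 'rV[R]_d) (f : 'rV[R]_d -> R) rho : smooth f ->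
  (forall x, f x != 0 -> box rho x) -> box rho `<=` U ->
  (fun x => (f x)%:C%C) \in test_function U.
Proof.
move=> sf fb bU.
have sub : csupport (fun x => (f x)%:C%C) `<=` box rho.
  have cl : closed (box rho) by apply: compact_closed; [exact: norm_hausdorff|exact: compact_box].
  rewrite [X in _ `<=` X]((closure_id _).1 cl); apply: closureS => x /= fx; apply: fb.
  by apply: contraNneq fx => ->.
rewrite inE; split; first exact: smooth_real.
  have cb : compact (box rho) by exact: compact_box.
  exact: (subclosed_compact (@closed_closure _ _) cb sub).
exact: subset_trans sub bU.
Qed.

Lemma smooth_bump_coord (a b c : R) (i : 'I_d) :
  smooth (fun x : 'rV[R]_d => bump a b (c * x ord0 i)).
Proof.
rewrite (_ : (fun x => _) = fun x : 'rV[R]_d =>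
    expinv 1 (c * x ord0 i + - a) * expinv 1 (- c * x ord0 i + b)).
  by apply: smoothM; exact: smooth_expinv.
by apply/funext => x; rewrite /bump mulNr [- _ + b]addrC.
Qed.

Lemma csupport_iter_partial s (f : 'rV[R]_d -> R[i]) :
  csupport (iter_cpartial s f) `<=` csupport f.
Proof.
elim: s => [|j s ih].
  by rewrite (_ : iter_cpartial [::] f = f)//; apply/funext => x; exact: iter_cpartial_nil.
rewrite (_ : iter_cpartial (j :: s) f = cpartial j (iter_cpartial s f))//.
exact: subset_trans (@csupport_partial _ _ _ _) ih.
Qed.

Lemma test_function_schwartz (f : 'rV[R]_d -> R[i]) :
  f \in test_function setT -> f \in schwartz_function.
Proof.
rewrite inE => -[[sR sI] cf _]; rewrite inE; split=> // s k.
(* A visibly continuous majorant: the modulus is replaced by the sum of the absolute values of the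
   real and imaginary parts. *)
pose g (x : 'rV[R]_d) := `|x| ^+ k * (`|iter_partial s (fun x => complex.Re (f x)) x| +
   `|iter_partial s (fun x => complex.Im (f x)) x|).
have cg : continuous g.
  move=> x.
  have cn : {for x, continuous (fun x : 'rV[R]_d => `|x|)} by exact: norm_continuous.
  have ce : {for `|x|, continuous (fun u : R => u ^+ k)} by exact: exprn_continuous.
  have cr u : {for u, continuous (fun u : R => `|u|)} by exact: norm_continuous.
  exact: (continuousM (continuous_comp cn ce)
    (continuousD (continuous_comp ((sR s).1 x) (cr _)) (continuous_comp ((sI s).1 x) (cr _)))).
have g0 x : 0 <= g x by rewrite mulr_ge0 ?exprn_ge0// addr_ge0.
have le_g x : `|x| ^+ k * cabs (iter_cpartial s f x) <= g x.
  by rewrite ler_wpM2l ?exprn_ge0//; exact: cabs_le.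
have out x : ~ csupport f x -> iter_cpartial s f x = 0.
  move=> xf; apply/eqP/negPn/negP => nz; apply: xf; apply: (@csupport_iter_partial s).
  exact: subset_closure.
have [e0|/set0P ne] := eqVneq (csupport f) set0.
  by exists 0 => x; rewrite out ?e0// ComplexField.Normc.normc0 mulr0.
have [c _ hc] := compact_EVT_max ne cf (continuous_subspaceT cg).
exists (g c) => x; have [xf|xf] := pselect (csupport f x).
  by rewrite (le_trans (le_g x))// hc// inE.
by rewrite out// ComplexField.Normc.normc0 mulr0 g0.
Qed.

End test_functions.

Section approximants.
Context {R : realType} {d : nat}.
Local Notation mu := (lebesgue_rV d.+1).

Definition approx (n : nat) : 'rV[R]_d.+1 -> R := tensor (bump_sum n) (@bump_prod R d).
Definition bad_datum : 'rV[R]_d.+1 -> R := tensor bump_series (@bump_prod R d).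

Lemma approx_L1 n : L1 mu (approx n).
Proof. by apply: integrable_tensor; [exact: bump_sum_L1|exact: bump_prod_L1]. Qed.

Lemma bad_datum_L1 : L1 mu bad_datum.
Proof. by apply: integrable_tensor; [exact: bump_series_L1|exact: bump_prod_L1]. Qed.

Lemma approx_ge0 n x : 0 <= approx n x.
Proof. by rewrite mulr_ge0 ?bump_sum_ge0 ?bump_prod_ge0. Qed.

Lemma approx_le_bad_datum n x : approx n x <= bad_datum x.
Proof.
by rewrite ler_wpM2r ?bump_prod_ge0// -subr_ge0; exact: bump_tail_ge0.
Qed.

Lemma approx_subE n x : approx n x - bad_datum x = -1 * tensor (bump_tail n) (@bump_prod R d) x.
Proof. by rewrite /approx /bad_datum /tensor /bump_tail; ring. Qed.

Lemma smooth_approx n : smooth (approx n).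
Proof.
rewrite (_ : approx n = fun x => (\sum_(0 <= k < n)
   sqrt2 ^+ k * bump 4^-1 2^-1 (2 ^+ k * x ord0 ord0)) *
   \prod_(j < d) bump 4^-1 2^-1 (1 * x ord0 (lift ord0 j))).
  apply: smoothM; last by apply: smooth_prod => j; exact: smooth_bump_coord.
  by apply: smooth_sum => k; apply: smoothZ; exact: smooth_bump_coord.
apply/funext => x; rewrite /approx /tensor /bump_sum; congr (_ * _).
by apply: eq_bigr => j _; rewrite mxE mul1r.
Qed.

(** All bumps live in [(0, 1/2)], the one with [k = 0] reaching farthest, so that one cutoff serves
    for all [n]. *)
Lemma approx_neq0 n x : approx n x != 0 -> forall i, 0 < x ord0 i < 2^-1.
Proof.
rewrite mulf_eq0 negb_or => /andP[F0 K0] i.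
have [j ->|->] := unliftP ord0 i.
  have : unit_bump ((rV_tail x) ord0 j) != 0.
    by apply: contraNneq K0 => pj; rewrite /bump_prod (bigD1 j)//= pj mul0r.
  rewrite mxE => /bump_neq0/andP[h1 ->]; rewrite (lt_trans _ h1)//.
have [k hk] : exists k, dyadic_bump k (x ord0 ord0) != 0.
  apply: contrapT => h; move: F0; rewrite /bump_sum big1 ?eqxx// => k _.
  by apply/eqP/negPn/negP => hk; apply: h; exists k.
have /dyadic_bump_neq0 /andP[k1 k2] := hk.
have p : 0 < 2 ^+ k :> R by rewrite exprn_gt0.
have x0 : 0 < x ord0 ord0 by rewrite -(pmulr_rgt0 _ p) (lt_trans _ k1).
rewrite x0/= (le_lt_trans _ k2)// ler_peMl ?(ltW x0)//.
by rewrite exprn_ege1// ler1n.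
Qed.

Lemma approx_box n x : approx n x != 0 -> box 2^-1 x.
Proof.
by move=> /approx_neq0 h i; have /andP[h1 h2] := h i; rewrite in_itv/=; apply/andP; split; lra.
Qed.

Lemma approx_test n : (fun x => (approx n x)%:C%C) \in test_function setT.
Proof. exact: (real_test_function (smooth_approx n) (@approx_box n)). Qed.

Definition approx_testfun n : testfun [set: 'rV[R]_d.+1] := TestFun (approx_test n).
Definition approx_schwartz n : schwartz R d.+1 :=
  Schwartz (test_function_schwartz (approx_test n)).

Lemma approx_sqr_L1 n : L1 mu (fun x => approx n x ^+ 2).
Proof.
rewrite sqr_tensor; apply: integrable_tensor; first exact: bump_sum_sqr_L1.
exact: bump_prod_sqr_L1.
Qed.

Lemma Rintegral_approx_sqr_ge : exists2 c : R, 0 < c &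
  forall n, c * n%:R <= \int[mu]_x (approx n x ^+ 2).
Proof.
have [c c0 h] := @Rintegral_bump_sum_sqr_ge R.
have k0 := @Rintegral_bump_prod_sqr_gt0 R d.
exists (c * \int[lebesgue_rV d]_y (bump_prod y ^+ 2)); first exact: mulr_gt0.
move=> n; rewrite sqr_tensor Rintegral_tensor; [|exact: bump_sum_sqr_L1|exact: bump_prod_sqr_L1].
by rewrite mulrAC ler_wpM2r// ltW.
Qed.

Lemma approx_bounded n : exists M, forall x, `|approx n x| <= M.
Proof.
exists (\sum_(0 <= k < n) sqrt2 ^+ k) => x; rewrite ger0_norm ?approx_ge0//.
by rewrite -[leRHS]mulr1 ler_pM ?bump_sum_ge0 ?bump_prod_ge0 ?bump_sum_le ?bump_prod_le1.
Qed.

(** Finiteness of the infimum yields some square integrable representative [f], related to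
    [bad_datum] only through the distribution they induce. Testing both against
    [approx n <= bad_datum] bounds the squared norms of the approximants by that of [f], against
    their linear growth. *)
Lemma bad_datum_not_L2 N : (0 < N)%N ->
  ~ norm_space (lebesgue_norm 2) (@vregular R d.+1 N bad_datum bad_datum_L1).
Proof.
case: N => // N _; rewrite /norm_space/= => /ereal_inf_lt[_ [f [mf indf ->]]] fin.
pose a x := complex.Re (f ord0 x).
have [ma _] := mf ord0; rewrite -/a in ma.
have a2fin : (\int[mu]_x (a x ^+ 2)%:E < +oo)%E.
  have := poweR_lty 2 fin; rewrite powR_Lnorm ?pnatr_eq0//.
  rewrite [X in (X < _)%E -> _](_ : _ = \int[mu]_x (\sum_(k < N.+1)
      (complex.Re (f k x) ^+ 2 + complex.Im (f k x) ^+ 2))%:E)%E; last first.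
    apply: eq_integral => x _; rewrite abse_EFin poweR_EFin (@powR_mulrn _ _ 2)//.
    rewrite real_normK ?num_real// /vnorm sqr_sqrtr; last first.
      by apply: sumr_ge0 => k _; exact: sqr_ge0.
    congr (_%:E); apply: eq_bigr => k _; case: (f k x) => u v /=.
    by rewrite sqr_sqrtr// addr_ge0// sqr_ge0.
  apply: le_lt_trans; apply: ge0_le_integral => //.
  - by move=> x _; rewrite lee_fin sqr_ge0.
  - by apply/measurable_EFinP; exact: measurable_funX.
  - apply/measurable_EFinP; apply: measurable_sum => k; have [mR mI] := mf k.
    by apply: measurable_funD; exact: measurable_funX.
  - move=> x _; rewrite lee_fin big_ord_recl -[leLHS]addr0 lerD//.
      by rewrite lerDl sqr_ge0.
    by apply: sumr_ge0 => k _; rewrite addr_ge0// sqr_ge0.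
have a2L1 : L1 mu (fun x => a x ^+ 2).
  by apply: L1_nonneg_lty => //; [exact: measurable_funX|move=> x; exact: sqr_ge0].
(* [approx n] is tested against the datum: [2 a v <= a ^ 2 + v ^ 2] replaces
   the Cauchy-Schwarz inequality. *)
have bound n : \int[mu]_x (approx n x ^+ 2) <= \int[mu]_x (a x ^+ 2).
  have [M hM] := approx_bounded n.
  have Ibad : L1 mu (fun x => bad_datum x * approx n x).
    exact: (L1_mul_bounded bad_datum_L1 (L1_measurable (approx_L1 n)) hM).
  have Iaa := L1D a2L1 (approx_sqr_L1 n).
  have Ia : L1 mu (fun x => a x * approx n x).
    apply: (L1_le _ _ Iaa).
      by apply: measurable_funM => //; exact: L1_measurable (approx_L1 n).
    move=> x; rewrite [leRHS]ger0_norm ?addr_ge0 ?sqr_ge0// normrM.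
    rewrite -[a x ^+ 2]real_normK ?num_real// -[approx n x ^+ 2]real_normK ?num_real//.
    move: `|a x| `|approx n x| (normr_ge0 (a x)) (normr_ge0 (approx n x)) => u v u0 v0.
    by rewrite !expr2; nra.
  have E : \int[mu]_x (bad_datum x * approx n x) = \int[mu]_x (a x * approx n x).
    have := congr1 (@complex.Re R) (indf ord0 (approx_schwartz n)).
    rewrite /vregular /= => e.
    transitivity (complex.Re (regular_fun bad_datum (approx_schwartz n))).
      by rewrite /regular_fun cintegral_realM.
    rewrite [LHS]e; apply: eq_Rintegral => x _ /=; rewrite /a.
    by case: (f ord0 x) => u v /=; rewrite mulr0 subr0.
  have le1 : \int[mu]_x (approx n x ^+ 2) <= \int[mu]_x (bad_datum x * approx n x).
    apply: le_Rintegral => //; first exact: approx_sqr_L1.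
    by move=> x _; rewrite expr2 ler_wpM2r ?approx_ge0// approx_le_bad_datum.
  have le2 : \int[mu]_x (a x * approx n x) <=
      2^-1 * (\int[mu]_x (a x ^+ 2) + \int[mu]_x (approx n x ^+ 2)).
    rewrite -RintegralD//; last exact: approx_sqr_L1.
    rewrite -RintegralZl//; apply: le_Rintegral => //; first exact: L1Z.
    move=> x _; move: (a x) (approx n x) => u v; have := sqr_ge0 (u - v).
    by rewrite !expr2; nra.
  move: le1 le2; rewrite E; lra.
have [c c0 hc] := Rintegral_approx_sqr_ge.
set B := \int[mu]_x (a x ^+ 2) in bound.
have B0 : 0 <= B by apply: Rintegral_ge0 => x _; exact: sqr_ge0.
have := archi_boundP (divr_ge0 B0 (ltW c0)).
rewrite ltr_pdivrMr// mulrC ltNge; apply/negP/negPn.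
exact: le_trans (hc _) (bound _).
Qed.

End approximants.

(** * Weak-* convergence of sequences of distributions *)

Section weak_convergence.
Context {R : realType} {d : nat} {U : set 'rV[R]_d}.

(** Stated through evaluations, so that sums and derivatives of distributions reduce to limits of
    scalars. *)
Definition wcvg (S : nat -> schwartz_distribution U) (T : schwartz_distribution U) :=
  forall phi, ((S n phi : R[i]^o) @[n --> \oo] --> (T phi : R[i]^o)).

Lemma wcvg0 : wcvg (fun=> 0) 0.
Proof. by move=> phi; exact: cvg_cst. Qed.

Lemma wcvgD S1 S2 T1 T2 : wcvg S1 T1 -> wcvg S2 T2 ->
  wcvg (fun n => S1 n + S2 n) (T1 + T2).
Proof. by move=> h1 h2 phi; exact: (cvgD (h1 phi) (h2 phi)). Qed.

Lemma wcvgB S1 S2 T1 T2 : wcvg S1 T1 -> wcvg S2 T2 ->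
  wcvg (fun n => S1 n - S2 n) (T1 - T2).
Proof. by move=> h1 h2 phi; exact: (cvgB (h1 phi) (h2 phi)). Qed.

Lemma wcvg_partial j S T : wcvg S T ->
  wcvg (fun n => distribution_partial j (S n)) (distribution_partial j T).
Proof. by move=> h phi; exact: (cvgN (h (testfun_partial j phi))). Qed.

Lemma wcvg_sum I (r : seq I) (S : I -> nat -> schwartz_distribution U) T :
  (forall i, wcvg (S i) (T i)) ->
  wcvg (fun n => \sum_(i <- r) S i n) (\sum_(i <- r) T i).
Proof.
move=> h; elim: r => [|i r ih].
  rewrite big_nil (_ : (fun n => _) = fun=> 0); first exact: wcvg0.
  by apply/funext => n; rewrite big_nil.
rewrite big_cons (_ : (fun n => _) = fun n => S i n + \sum_(j <- r) S j n).
  exact: (wcvgD (h i) ih).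
by apply/funext => n; rewrite big_cons.
Qed.

(** The topology is initial for the embedding into pointwise functions, where evaluation at [phi] is
    a projection. *)
Lemma eval_continuous (T : schwartz_distribution U) phi :
  (S phi : R[i]^o) @[S --> T] --> (T phi : R[i]^o).
Proof.
pose ev : schwartz_distribution U -> {ptws testfun U -> R[i]^o} := @distribution_fun _ _ _.
have c1 : ev S @[S --> T] --> ev T.
  exact: (@initial_continuous _ _ ev T).
have c2 : f phi @[f --> ev T] --> ev T phi.
  exact: (@proj_continuous (testfun U) (fun=> R[i]^o) phi (ev T)).
exact: (cvg_comp _ _ c1 c2).
Qed.

Lemma wcvg_bounded S T phi : wcvg S T ->
  exists M N, forall n, (N <= n)%N -> complex.Re (S n phi) <= M.
Proof.
move=> /(_ phi) /cvgrPdist_lt/(_ 1 ltr01)[N _ hN].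
exists (complex.Re (T phi) + 1), N => n Nn; have /= := hN n Nn.
rewrite -[`|_|]/((cabs (T phi - S n phi))%:C)%C -[1]/((1 : R)%:C)%C ltcR => h.
have := le_lt_trans (normr_Re_le _) h; rewrite ltr_norml => /andP[+ _].
by case: (T phi) (S n phi) {h hN} => [a b] [u v] /=; lra.
Qed.

(** Continuity is understood within [Omega], so the sequence has to enter [Omega] eventually,
    besides converging for [nu]. *)
Lemma norm_continuous_wcvg N (nu : vtempered R d N -> \bar R) Omega F
    (u : nat -> vtempered R d N) (v : vtempered R d N) :
  norm_continuous_on nu Omega F -> Omega v ->
  (forall e : R, 0 < e -> \forall n \near \oo, (nu (u n - v)%R < e%:E)%E) ->
  (\forall n \near \oo, Omega (u n)) ->
  wcvg (fun n => F (u n)) (F v).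
Proof.
move=> cF Ov uv Ou phi.
have c1 : F w @[w --> within Omega (norm_nbhs nu v)] --> F v := cF v Ov.
have c2 : u n @[n --> \oo] --> within Omega (norm_nbhs nu v).
  move=> A [e e0 eA].
  have : \forall n \near \oo, A (u n).
    near=> n; have Oun : Omega (u n) by near: n.
    by apply: eA => //=; near: n; exact: uv.
  exact.
have c3 := cvg_comp _ _ c2 c1.
exact: (cvg_comp _ _ c3 (@eval_continuous (F v) phi)).
Unshelve. all: by end_near. Qed.

End weak_convergence.

Section cutoff.
Context {R : realType} {d : nat}.

(* The cube [-theta, theta]^3 lies in the Euclidean unit ball because
   3 * theta ^ 2 < 1, while theta > 1/2. *)
Let theta : R := 57 / 100.

Definition cutoff (x : 'rV[R]_d.+1) : R := \prod_(j < d.+1) bump (- theta) theta (1 * x ord0 j).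

Lemma smooth_cutoff : smooth cutoff.
Proof. by apply: smooth_prod => j; exact: smooth_bump_coord. Qed.

Lemma cutoff_ge0 x : 0 <= cutoff x.
Proof. by apply: prodr_ge0 => j _; exact: bump_ge0. Qed.

Lemma cutoff_le1 x : cutoff x <= 1.
Proof. by apply: prodr_ile1 => j _; rewrite bump_ge0 bump_le1. Qed.

Lemma cutoff_box x : cutoff x != 0 -> box theta x.
Proof.
move=> c0 i; have : bump (- theta) theta (1 * x ord0 i) != 0.
  by apply: contraNneq c0 => bi; rewrite /cutoff (bigD1 i)//= bi mul0r.
by rewrite mul1r => /bump_neq0/andP[h1 h2]; rewrite in_itv/= !ltW.
Qed.

Lemma box_unit_ball : (d.+1 <= 3)%N -> box theta `<=` unit_ball R d.+1.
Proof.
move=> d3 x xb; rewrite /unit_ball/= /dotv.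
apply: (@le_lt_trans _ _ (\sum_(j < d.+1) theta ^+ 2)).
  apply: ler_sum => j _; rewrite -expr2 -real_normK ?num_real// lerXn2r ?nnegrE//.
    by rewrite /theta; lra.
  by rewrite ler_norml; have := xb j; rewrite in_itv.
rewrite sumr_const card_ord -mulr_natl.
apply: (@le_lt_trans _ _ (3%:R * theta ^+ 2)).
  by rewrite ler_wpM2r ?sqr_ge0// ler_nat.
by rewrite /theta expr2; lra.
Qed.

Lemma cutoff_test : (d.+1 <= 3)%N ->
  (fun x => (cutoff x)%:C%C) \in test_function (unit_ball R d.+1).
Proof.
move=> d3.
exact: (real_test_function smooth_cutoff cutoff_box (box_unit_ball d3)).
Qed.

Lemma cutoff_lower : exists2 c : R, 0 < c & forall x : 'rV[R]_d.+1,
  (forall i, 0 < x ord0 i < 2^-1) -> c <= cutoff x.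
Proof.
(* The gap [theta - 1/2] between the cube of the cutoff and the cube carrying the approximants. *)
pose e : R := 7 / 100; have e0 : 0 < e by rewrite /e; lra.
have b0 : 0 < expinv 1 e ^+ 2 by rewrite exprn_gt0// expinv1_gt0.
exists (\prod_(j < d.+1) expinv 1 e ^+ 2); first by apply: prodr_gt0.
move=> x hx; apply: ler_prod => j _; rewrite (ltW b0)/= mul1r.
apply: bump_ge => //; have /andP[h1 h2] := hx j.
by apply/andP; split; rewrite /theta /e; lra.
Qed.

End cutoff.

(** * The contradiction *)

Section main.
Context {R : realType} {d N : nat}.
Local Notation mu := (lebesgue_rV d.+1).

(** Both families of spaces are treated at once through [tail_controlled]. The dimension enters by
    the cutoff supported in the ball, and [0 < N] by a density [N approx ^ 2] that does not
    vanish. *)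
Lemma no_continuous_potentials (nu : vtempered R d.+1 N -> \bar R) :
  (d.+1 <= 3)%N -> (0 < N)%N -> tail_controlled nu ->
  let psi_bad := @vregular R d.+1 N bad_datum bad_datum_L1 in
    [/\ norm_space nu psi_bad,
        ~ norm_space (lebesgue_norm 2) psi_bad &
        forall Omega : set (vtempered R d.+1 N),
          norm_nbhs nu psi_bad Omega ->
          ~ exists I J : 'I_d.+2 -> vtempered R d.+1 N ->
                         schwartz_distribution (unit_ball R d.+1),
            [/\ forall k, norm_continuous_on nu Omega (I k),
                forall k, norm_continuous_on nu Omega (J k) &
                forall (psi : 'I_N -> testfun [set: 'rV[R]_d.+1]) u,
                  (forall k, induces_tempered (psi k) (u k)) ->
                  Omega u ->
                  induces_distribution
                    (fun x => \sum_(k < N) (psi k x)^*%C * psi k x)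
                    (\sum_(j < d.+1) distribution_partial j
                       (distribution_partial j (I ord0 u) - J (lift ord0 j) u))]].
Proof.
move=> d3 N0 [p [Q [q [p0 Q0 /andP[q0 q1] tail]]]] psi_bad.
split.
(* Chosen so that [e ^ p = Q + 1] exceeds [Q]; the datum is the tail with [m = 0]. *)
- pose e := (Q + 1) `^ p^-1.
  have Q1 : 0 < Q + 1 by rewrite ltr_wpDl.
  apply: (@lt_trans _ _ e%:E); last exact: ltry.
  apply: (tail 0%N 1) => //.
  + by rewrite normr1.
  + exact: powR_gt0.
  + by move=> x; rewrite mul1r /bad_datum /tensor /bump_tail /bump_sum big_geq// subr0.
  + by rewrite expr0 mulr1 /e -powRrM mulVf ?gt_eqF// powRr1 ?(ltW Q1)// ltrDl.
- exact: bad_datum_not_L2.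
move=> Omega [e0 e0_gt0 subO] [I [J [cI cJ HIJ]]].
pose u n : vtempered R d.+1 N := vregular (approx_L1 n).
have L0 : L1 mu (fun=> 0 : R) by have := L1Z 0 (@bad_datum_L1 R d); under eq_fun do rewrite mul0r.
have geo (e : R) : 0 < e -> \forall n \near \oo, Q * q ^+ n < e `^ p.
  move=> e_gt0; have ep : 0 < e `^ p by exact: powR_gt0.
  have c : Q * q ^+ n @[n --> \oo] --> Q * 0.
    apply: cvgM; first exact: cvg_cst.
    by apply: cvg_expr; rewrite ger0_norm.
  by rewrite mulr0 in c; exact: (cvgr_lt _ c).
(* For the abstract functional [nu], smallness at [0] is obtained by viewing zero as [0] times a
   tail far enough in the series. *)
have Obad : Omega psi_bad.
  apply: subO => /=.
  rewrite (_ : psi_bad - psi_bad = vregular L0); last first.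
    by apply/funext => k; apply: (@regularB _ _ bad_datum bad_datum) => x; rewrite subrr.
  have [n _ /(_ _ (leqnn n)) hn] := geo _ e0_gt0.
  apply: (tail n 0) => //; first by rewrite normr0.
  by move=> x; rewrite mul0r.
have near_u (e : R) : 0 < e -> \forall n \near \oo, (nu (u n - psi_bad)%R < e%:E)%E.
  move=> e_gt0.
  have LG n : L1 mu (fun x => -1 * tensor (bump_tail n) (@bump_prod R d) x).
    apply: L1Z; apply: integrable_tensor; last exact: bump_prod_L1.
    by have [? [? [_ _ /(_ n)[]]]] := @bump_tail_L1 R.
  near=> n.
  rewrite (_ : u n - psi_bad = vregular (LG n)); last first.
    by apply/funext => k; apply: (@regularB _ _ (approx n) bad_datum) => x; rewrite approx_subE.
  apply: (tail n (-1)) => //; first by rewrite normrN1.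
  by near: n; exact: geo.
have Ou : \forall n \near \oo, Omega (u n).
  by have := near_u _ e0_gt0; apply: filterS => n; exact: subO.
pose chi : testfun (unit_ball R d.+1) := TestFun (cutoff_test d3).
have WI k := norm_continuous_wcvg (cI k) Obad near_u Ou.
have WJ k := norm_continuous_wcvg (cJ k) Obad near_u Ou.
have WS : wcvg (fun n => \sum_(j < d.+1) distribution_partial j
      (distribution_partial j (I ord0 (u n)) - J (lift ord0 j) (u n)))
    (\sum_(j < d.+1) distribution_partial j
      (distribution_partial j (I ord0 psi_bad) - J (lift ord0 j) psi_bad)).
  apply: wcvg_sum => j; apply: wcvg_partial; apply: wcvgB; last exact: WJ.
  by apply: wcvg_partial; exact: WI.
have [M [N1 hM]] := wcvg_bounded chi WS.
have [c c0 hc] := @Rintegral_approx_sqr_ge R d.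
have [b b0 hb] := @cutoff_lower R d.
case: Ou => N2 _ hO.
(* The cutoff is at least [b] where [approx n] lives and there is at least one component, so the
   density tested against [chi] is at least [b c n]; weak convergence bounds the same number by
   [M]. *)
have bound n : (maxn N1 N2 <= n)%N -> b * c * n%:R <= M.
  rewrite geq_max => /andP[n1 n2]; apply: le_trans (hM n n1).
  have Iu : forall k : 'I_N, induces_tempered (approx_testfun n) (u n k) by [].
  have /(_ chi) -> := HIJ (fun=> approx_testfun n) (u n) Iu (hO n n2).
  have E : (fun x => (\sum_(k < N) (approx_testfun n x)^*%C * approx_testfun n x) * chi x) =
      (fun x => (N%:R * approx n x ^+ 2)%:C%C * chi x).
    apply/funext => x; congr (_ * _); rewrite sumr_const card_ord.
    rewrite (_ : _ * _ = (approx n x ^+ 2)%:C%C); last first.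
      by apply/eqP; rewrite eq_complex/=; apply/andP; split; apply/eqP; ring.
    by rewrite -[LHS]mulr_natl [RHS]rmorphM rmorph_nat.
  rewrite E cintegral_realM /=.
  have Ia := approx_sqr_L1 (R := R) (d := d) n.
  have mcut : measurable_fun setT (@cutoff R d).
    by apply: continuous_measurable_rV; exact: (smooth_cutoff [::]).1.
  have Iac : L1 mu (fun x : 'rV[R]_d.+1 => N%:R * approx n x ^+ 2 * cutoff x).
    apply: (@L1_mul_bounded _ _ _ mu (fun x => N%:R * approx n x ^+ 2) cutoff 1 (L1Z N%:R Ia) mcut) => x.
    by rewrite ger0_norm ?cutoff_ge0 ?cutoff_le1.
  apply: (@le_trans _ _ (\int[mu]_x (b * approx n x ^+ 2))).
    by rewrite RintegralZl// -mulrA ler_wpM2l// ltW.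
  apply: le_Rintegral => //; first exact: L1Z.
  move=> x _; have [ax|ax] := eqVneq (approx n x) 0; first by rewrite ax expr0n !mulr0 mul0r.
  have h := hb x (approx_neq0 ax).
  apply: (@le_trans _ _ (approx n x ^+ 2 * cutoff x)).
    by rewrite mulrC ler_wpM2l ?sqr_ge0.
  by rewrite -mulrA ler_peMl ?ler1n// mulr_ge0 ?sqr_ge0 ?cutoff_ge0.
have bc0 : 0 < b * c by rewrite mulr_gt0.
(* Beyond both thresholds and so large that [b c n > |M|]. *)
pose n := maxn (maxn N1 N2) (Num.bound (`|M| / (b * c))).
have := bound n (leq_maxl _ _); apply/negP; rewrite -ltNge.
apply: (le_lt_trans (ler_norm M)).
rewrite mulrC -ltr_pdivrMr//.
apply: (lt_le_trans (archi_boundP _)); first by rewrite divr_ge0// ltW.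
by rewrite ler_nat leq_maxr.
Unshelve. all: by end_near. Qed.

End main.

Lemma lebesgue_or_sobolev_tail_controlled (R : realType) (d N : nat)
    (nu : vtempered R d.+1 N -> \bar R) :
  (exists2 s : R, s < 0 & nu = sobolev_norm s) \/
  (exists2 p : R, 1 <= p < 2 & nu = lebesgue_norm p) -> tail_controlled nu.
Proof.
case=> -[a ha ->]; first exact: tail_controlled_sobolev.
exact: tail_controlled_lebesgue.
Qed.

Theorem theorem3 (R : realType) (d : nat) (hd : d \in [:: 1; 2; 3]%N)
    (nu : vtempered R d (spin_dim d) -> \bar R)
    (hnu : (exists2 s : R, s < 0 & nu = sobolev_norm s) \/
           (exists2 p : R, 1 <= p < 2 & nu = lebesgue_norm p)) :
  exists psi_bad : vtempered R d (spin_dim d),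
    [/\ norm_space nu psi_bad,
        ~ norm_space (lebesgue_norm 2) psi_bad &
        forall Omega : set (vtempered R d (spin_dim d)),
          Omega `<=` norm_space nu ->
          norm_nbhs nu psi_bad Omega ->
          ~ exists I J : 'I_d.+1 -> vtempered R d (spin_dim d) ->
                         schwartz_distribution (unit_ball R d),
            [/\ forall mu, norm_continuous_on nu Omega (I mu),
                forall mu, norm_continuous_on nu Omega (J mu) &
                forall (psi : 'I_(spin_dim d) -> testfun [set: 'rV[R]_d])
                       (u : vtempered R d (spin_dim d)),
                  (forall k, induces_tempered (psi k) (u k)) ->
                  Omega u ->
                  let a mu := I mu u in
                  let b mu := J mu u in
                  b ord0 =
                    \sum_(j < d) distribution_partial j (a (lift ord0 j)) /\
                  induces_distribution
                    (fun x => \sum_(k < spin_dim d) (psi k x)^*%C * psi k x)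
                    (\sum_(j < d) distribution_partial j
                       (distribution_partial j (a ord0) - b (lift ord0 j)))]].
Proof.
have N0 : (0 < spin_dim d)%N by rewrite /spin_dim; case: ifP.
have [d0 d3] : (0 < d)%N /\ (d <= 3)%N by move: hd; rewrite !inE => /or3P[]/eqP ->.
move: nu hnu N0; move: (spin_dim d) => N nu hnu N0.
(* The datum singles out a first coordinate, so [d] is written as a successor. *)
case: d d0 d3 nu hnu {hd} => // d _ d3 nu hnu.
have [bad_nu bad_L2 nocont] :=
  no_continuous_potentials d3 N0 (lebesgue_or_sobolev_tail_controlled hnu).
exists (vregular bad_datum_L1); split => // Omega _ nbhsO [I [J [cI cJ HIJ]]].
apply: (nocont Omega nbhsO); exists I, J; split => // psi u hu Ou.
by have [] := HIJ psi u hu Ou.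
Qed.
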